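(* Let $a\geq3$. Let $\mathfrak{T}=\tau\,1\,1\,0^{k_1}\,1\,1\,0^{k_2}\,1\,1\,0^{k_3}\ldots$ be a $B$-sequence, where $\tau$ is a finite block of binary symbols and $(k_j)_{j\geq1}$ is an increasing sequence of integers such that, for the two $A$-sequences $\mathfrak{T}^1,\mathfrak{T}^2$ that project onto $\mathfrak{T}$, the associated hairs $\gamma(\mathfrak{T}^1)$ and $\gamma(\mathfrak{T}^2)$ are distinct and limit upon themselves. Set $\Gamma^1=\overline{\gamma(\mathfrak{T}^1)}$. Then there exists a unique point $p_1\in\partial\mathcal{A}^*(-a)$ such that $p_1\in\Gamma^1$ and $p_1$ has itinerary $\mathfrak{T}^1$.
   Context: Map: $f_a(z)=a(z-(1-a))\exp(z+a)$, with superattracting fixed point $-a$; $\mathcal{A}^*(-a)$ is the connected component containing $-a$ of the basin of attraction of $-a$. Partition: the connected components of $f_a^{-1}(\mathbb{R}^+)$, $\mathbb{R}^+=(0,\infty)$, are the half-line $(1-a,+\infty)$ and, for each nonzero integer $j$, the graph of a strictly monotonic function $\zeta_j:\mathbb{R}\to\mathbb{R}$ (points $x+i\zeta_j(x)$) with $\lim_{x\to-\infty}\zeta_j(x)=\operatorname{sign}(j)(2|j|-1)\pi$ and $\lim_{x\to+\infty}\zeta_j(x)=2j\pi$. Inside the region bounded by the graphs of $\zeta_1$ and $\zeta_{-1}$, the preimage of $(-\infty,-a)$ consists of two curves, graphs of strictly monotonic functions $\eta_1,\eta_{-1}$ of $x>-a$, with $\lim_{x\to -a^+}\eta_{\pm1}(x)=0$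 and $\lim_{x\to+\infty}\eta_{\pm1}(x)=\pm\pi$. $T_0$ is the open connected set containing $z=0$ bounded by $\eta_1\cup\eta_{-1}$ (together with $-a$); $T_1$ is the open connected set bounded by $\zeta_{-1}\cup\eta_{-1}\cup\eta_1\cup\zeta_1$. For $j=0,1$, $T_{j_1}$ and $T_{j_2}$ are the parts of $T_j$ with negative and positive imaginary part. $f_a$ is one-to-one on $T_0$ and on $T_1$; $g_a^{j_i}$ denotes the inverse branch of $f_a$ with values in $T_{j_i}$ (defined on the open upper or lower half-plane $f_a(T_{j_i})$). For $R>0$, $H_R=\{z\in T_0\cup T_1:\operatorname{Re}(z)\geq R\}$. Sequences: a $B$-sequence is an element of $\{0,1\}^{\mathbb{N}}$ (indices starting at 0). $\Sigma_A$, the set of $A$-sequences, consists of sequences with entries in $\{0_1,0_2,1_1,1_2\}$ having only the transitions $0_1\to 0_1,1_1$; $0_2\to 0_2,1_2$; $1_1\to 0_2,1_2$; $1_2\to 0_1,1_1$. Erasing subscripts gives a 2-to-1 projection of $\Sigma_A$ onto $\{0,1\}^{\mathbb{N}}$; the two preimages of $t$ are denoted $t^1,t^2$ (they differ by interchanging all subscripts). $\sigma$ is the shift. $0^k$ is a block of $k$ zeros. A point $z$ has itinerary $t\in\Sigma_A$ if $f_a^n(z)\in T_{t_n}$ for all $n\geq0$. Tails and hairs: for $R$ large enough and every $t\in\Sigma_A$ not ending in zeros, the tail $\omega_t=\omega_t(R)$ is the curve of all points with itinerary $t$ whose forward orbit lies in $H_R$; its points escape to $\infty$, and it extends to infinity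 to the right, meeting each line $\operatorname{Re}(z)=r$, $r\ge R$, in exactly one point. The hair associated to $t$ is $$\gamma(t)=\bigcup_{n=0}^\infty g_a^{t_0}\circ\cdots\circ g_a^{t_{n-1}}(\omega_{\sigma^n(t)}),$$ an increasing union of curves, each extending its predecessor (the $n=0$ term being $\omega_t$). A ray is the image of $[0,+\infty)$ under a continuous one-to-one map; a final segment is the image of $[\alpha,+\infty)$, $\alpha>0$. A ray limits on itself (limits upon itself) if it is contained in the closure of every final segment of itself. Here $\gamma(t)$ is viewed as a ray starting at its end at $\infty$ (the right-hand end of its tail) and followed in the direction of the successive pullbacks, so its final segments are what remains after removing the portions of the curve toward $\infty$ along the tail end. *)

(* Defs.v *)
From HB Require Import structures.
From mathcomp Require Export all_boot all_order all_algebra.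
From mathcomp Require Export all_classical all_reals all_analysis.
From mathcomp Require Export complex.

Set Implicit Arguments.
Unset Strict Implicit.
Unset Printing Implicit Defensive.

Export Order.TTheory GRing.Theory Num.Theory.
Export numFieldNormedType.Exports.

Local Open Scope classical_set_scope.
Local Open Scope ring_scope.
Local Open Scope complex_scope.

(* MathComp-Analysis puts the norm topology of a numeric field [K] on [K^o];
   for [K = R[i]] this is the usual topology of the complex plane. *)
Notation CC R := (R[i]^o).

(* Real-valued, unlike the projections ['Re] and ['Im] of a closed field. *)
Notation re := (@complex.Re _).
Notation im := (@complex.Im _).

Definition frontier (T : topologicalType) (A : set T) : set T :=
  closure A `\` interior A.

Definition expC (R : realType) (z : CC R) : CC R :=
  (expR (re z) * cos (im z)) +i* (expR (re z) * sin (im z)).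

Definition fa (R : realType) (a : R) (z : CC R) : CC R :=
  a%:C * (z - (1 - a)%:C) * expC (z + a%:C).

Definition basin (R : realType) (a : R) : set (CC R) :=
  [set z | iter n (fa a) z @[n --> \oo] --> (- a%:C : CC R)].

Definition immediate_basin (R : realType) (a : R) : set (CC R) :=
  connected_component (basin a) (- a%:C).

Definition real_subset (R : realType) (A : set R) : set (CC R) :=
  (fun x : R => x%:C : CC R) @` A.

Definition graph_of (R : realType) (h : R -> R) : set (CC R) :=
  [set z | im z = h (re z)].

Definition strictly_monotone (R : realType) (h : R -> R) : Prop :=
  {homo h : x y / x < y} \/ {homo h : x y /~ x < y}.

Definition is_component (T : topologicalType) (A B : set T) : Prop :=
  exists2 x, A x & B = connected_component A x.

Definition is_zeta (R : realType) (a : R) (j : int) (zeta : R -> R) : Prop :=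
  [/\ strictly_monotone zeta,
      is_component (fa a @^-1` real_subset `]0, +oo[) (graph_of zeta),
      zeta x @[x --> -oo] --> (Num.sg j)%:~R * (2 * `|j|%:~R - 1) * pi
    & zeta x @[x --> +oo] --> 2 * j%:~R * pi].

Definition zeta_curve (R : realType) (a : R) (j : int) : set (CC R) :=
  [set z | exists2 zeta, is_zeta a j zeta & graph_of zeta z].

Definition bounded_by (R : realType) (K U : set (CC R)) : Prop :=
  [/\ open U, connected U & frontier U = K].

(* In [strip], [T0] and [T1] there is exactly one domain [U] with the required
   properties, and the union over all such [U] just names it. *)
Definition strip (R : realType) (a : R) : set (CC R) :=
  \bigcup_(U in bounded_by (zeta_curve a 1 `|` zeta_curve a (-1))) U.

(* The two curves eta_1 and eta_(-1), taken together. *)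
Definition eta_curves (R : realType) (a : R) : set (CC R) :=
  strip a `&` fa a @^-1` real_subset `]-oo, - a[.

(* The curves eta_1 and eta_(-1) are open arcs with common end point -a, so
   that -a has to be added to obtain the whole boundary. *)
Definition T0 (R : realType) (a : R) : set (CC R) :=
  \bigcup_(U in [set U | bounded_by (eta_curves a `|` [set - a%:C]) U /\ U 0])
    U.

Definition T1 (R : realType) (a : R) : set (CC R) :=
  \bigcup_(U in bounded_by (zeta_curve a (-1) `|` eta_curves a
                            `|` [set - a%:C] `|` zeta_curve a 1)) U.

(* The subscripts: 1 is [Lower], 2 is [Upper]. *)
Inductive half := Lower | Upper.

Definition opposite (h : half) : half := if h is Lower then Upper else Lower.

(* Binary symbols: [false] is 0 and [true] is 1; the symbol j_i is [(j, i)]. *)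
Definition bseq := nat -> bool.
Definition asymbol : Type := bool * half.
Definition aseq := nat -> asymbol.

(* 0_i is followed by 0_i or 1_i; 1_i is followed by 0_i' or 1_i', i' <> i. *)
Definition allowed (s s' : asymbol) : Prop :=
  s'.2 = if s.1 then opposite s.2 else s.2.

Definition SigmaA : set aseq :=
  [set t | forall n, allowed (t n) (t n.+1)].

Definition aproj (t : aseq) : bseq := fun n => (t n).1.

Definition ashift (t : aseq) : aseq := fun n => t n.+1.

Definition halfplane (R : realType) (h : half) : set (CC R) :=
  [set z | if h is Lower then im z < 0 else 0 < im z].

Definition Tpart (R : realType) (a : R) (s : asymbol) : set (CC R) :=
  (if s.1 then T1 a else T0 a) `&` halfplane s.2.

Definition has_itinerary (R : realType) (a : R) (t : aseq) (z : CC R) : Prop :=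
  forall n, Tpart a (t n) (iter n (fa a) z).

(* The inverse branch of [fa a] on [fa a @` Tpart a s]; its value elsewhere
   is irrelevant. *)
Definition branch (R : realType) (a : R) (s : asymbol) (w : CC R) : CC R :=
  xget 0 [set z | Tpart a s z /\ fa a z = w].

Fixpoint pullback (R : realType) (a : R) (t : aseq) (n : nat) : CC R -> CC R :=
  if n is m.+1 then branch a (t 0%N) \o pullback a (ashift t) m else id.

Definition Hset (R : realType) (a rho : R) : set (CC R) :=
  [set z | (T0 a `|` T1 a) z /\ rho <= re z].

Definition tail_curve (R : realType) (a rho : R) (t : aseq) : set (CC R) :=
  [set z | has_itinerary a t z /\ forall n, Hset a rho (iter n (fa a) z)].

Definition hair_stage (R : realType) (a rho : R) (t : aseq) (n : nat) :
    set (CC R) :=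
  pullback a t n @` tail_curve a rho (iter n ashift t).

(* This set is the same for all sufficiently large [rho]. *)
Definition hair (R : realType) (a rho : R) (t : aseq) : set (CC R) :=
  \bigcup_n hair_stage a rho t n.

(* [phi] parametrizes the hair as a ray whose initial point, corresponding to
   parameter 0, is the point at infinity of the tail; the successive stages of
   the hair are traversed one after the other. *)
Definition hair_param (R : realType) (a rho : R) (t : aseq) (phi : R -> CC R) :
    Prop :=
  [/\ {within `]0, +oo[, continuous phi},
      {in `]0, +oo[ &, injective phi},
      phi @` `]0, +oo[ = hair a rho t,
      re (phi s) @[s --> 0^'+] --> +oo
    & forall n, exists2 alpha : R, 0 < alpha
        & phi @` `]0, alpha] = hair_stage a rho t n].

Definition hair_limits_on_itself (R : realType) (a rho : R) (t : aseq) : Prop :=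
  exists2 phi, hair_param a rho t phi
    & forall alpha : R, 0 < alpha ->
        hair a rho t `<=` closure (phi @` `[alpha, +oo[).

(* The block 1 1 0^k. *)
Definition block (k : nat) : seq bool := [:: true; true] ++ nseq k false.

(* The infinite word tau 1 1 0^(k 0) 1 1 0^(k 1) ..., entry by entry: the
   prefix made of tau and the first n + 1 blocks has more than n symbols. *)
Definition block_seq (tau : seq bool) (k : nat -> nat) : bseq :=
  fun n => nth false (tau ++ flatten (mkseq (block \o k) n.+1)) n.

(* Main.v *)
Require Import Defs.
From mathcomp Require Import ring lra.

(** Write [v = z + a]. The map is [f z = a (v - 1) exp v], with
    superattracting fixed point at [v = 0] and asymptotic value 0 at the
    left end. Everything rests on two facts about the sequence: it reads the
    symbol 1 twice in a row infinitely often, and the inverse branches along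
    an itinerary contract hyperbolic distances, by a definite factor
    whenever the orbit is high above the real axis.

    Contraction. An inverse branch maps a half-plane into a half-plane,
    hence does not increase the hyperbolic metric [|dz| / |im z|]. Here this
    is the explicit inequality [|im (f z)| <= |im z| * |f' z|] ([im_fa_le]),
    which holds in the whole plane, with a factor smaller than 1 when [|im
    z|] is bounded below ([im_fa_contract]). To pass from the metric to
    points, segments are pulled back as differentiable curves of bounded
    hyperbolic speed ([slow_pullback], [itinerary_pullback],
    [itinerary_contraction]). Inverse branches exist because on the set
    where [f] has a given argument its modulus is a monotone function of the
    height ([fa_inj], [fa_surj]); they are continuous because [f] is proper
    on each piece ([branch_ext_near]).

    Compactness. A point that is in [T1] together with its image, outside a
    fixed disc around [- a], and not too far to the right lies in a compact
    subset of the open half-planes ([double_visit]). So two orbits with the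
    given itinerary that avoid the basin and return from the right at common
    times of this kind are at bounded hyperbolic distance at these times,
    and the contraction between them makes the two starting points close
    ([itinerary_close]).

    Uniqueness. The immediate basin is contained in a box to the left of [re
    z = -1] ([Astar_window]): it cannot cross the curves zeta, which are
    mapped to the positive axis, nor two vertical lines. Orbits on its
    boundary therefore never go far to the right, and two boundary points
    with the itinerary coincide ([frontier_itinerary_uniq]).

    Existence. Take preimages along the itinerary of points of a small disc
    around [- a]. They belong to the immediate basin, since a connecting set
    contained in one half-plane together with [- a] can be pulled back
    ([radial_branch]). A limit point of them has the itinerary and is
    outside the basin ([frontier_itinerary_exists]).

    The hair. For every [n] some point of the hair has an [n]-th image that
    is not far to the right, for otherwise the whole hair would be one of
    its stages ([hair_stays_left]). Taking [n] among the late times at which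
    1 is read twice, such a point has started close to the boundary point
    ([frontier_itinerary_hair]). *)

Set Implicit Arguments.
Unset Strict Implicit.
Unset Printing Implicit Defensive.

Local Open Scope classical_set_scope.
Local Open Scope ring_scope.
Local Open Scope complex_scope.

(** * Coordinates and limits in the complex plane *)

Section Plane.
Variable R : realType.
Implicit Types z w : CC R.

(** Building the point in [CC R] keeps the topology of the plane attached to
    it; a bare [x +i* y] lives in [R[i]]. *)
Definition mkC (x y : R) : CC R := x +i* y.

Lemma mkC_reim z : z = mkC (re z) (im z). Proof. by case: z. Qed.

Lemma eq_reim z w : re z = re w -> im z = im w -> z = w.
Proof. by case: z => ? ?; case: w => ? ? /= -> ->. Qed.

Lemma reD z w : re (z + w) = re z + re w. Proof. by case: z; case: w. Qed.
Lemma imD z w : im (z + w) = im z + im w. Proof. by case: z; case: w. Qed.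
Lemma reN z : re (- z) = - re z. Proof. by case: z. Qed.
Lemma imN z : im (- z) = - im z. Proof. by case: z. Qed.
Lemma reM z w : re (z * w) = re z * re w - im z * im w.
Proof. by case: z; case: w. Qed.
Lemma imM z w : im (z * w) = re z * im w + im z * re w.
Proof. by case: z; case: w. Qed.
Definition reimE := (reD, imD, reN, imN, reM, imM).

(** The norm of [CC R] takes its values in [R[i]]; squared moduli as real
    numbers are what all estimates below are made of. *)
Definition nsq z : R := re z ^+ 2 + im z ^+ 2.

Lemma normCE z : `|z| = (Num.sqrt (nsq z))%:C :> R[i].
Proof. by case: z. Qed.

Lemma nsqM z w : nsq (z * w) = nsq z * nsq w.
Proof. rewrite /nsq !reimE; ring. Qed.

(** Coordinate boxes form a basis of neighbourhoods, which reduces every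
    limit in the plane to two real limits. *)
Lemma nearC z (P : CC R -> Prop) :
  (\forall w \near z, P w) <->
  exists2 e : R, 0 < e &
    forall w, `|re w - re z| < e -> `|im w - im z| < e -> P w.
Proof.
split.
  move=> /nbhs_normP[[e e'] /=]; rewrite ltcE /= => /andP[/eqP -> e0] H.
  exists (e / 2) => [|w h1 h2]; first lra.
  apply: H => /=; rewrite normCE ltcE /= eqxx /= /nsq.
  rewrite -(ltr_pXn2r (n := 2)) ?nnegrE ?sqrtr_ge0 ?(ltW e0)//.
  rewrite sqr_sqrtr ?addr_ge0 ?sqr_ge0// !reimE.
  move: h1 h2; rewrite !ltr_norml => /andP[h1 h2] /andP[h3 h4]; nra.
move=> [e e0 H]; apply/nbhs_normP; exists e%:C => /=; first by rewrite ltcR.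
move=> w /=; rewrite normCE ltcE /= eqxx /= /nsq => h.
have {h} : nsq (z - w) < e ^+ 2.
  move: h; rewrite -/(nsq (z - w)) => h; rewrite -[X in X <
    _]sqr_sqrtr ?addr_ge0 ?sqr_ge0//.
  by rewrite ltr_pXn2r ?nnegrE ?sqrtr_ge0 ?(ltW e0).
rewrite /nsq !reimE => h.
have h1 := sqr_ge0 (re z - re w); have h2 := sqr_ge0 (im z - im w).
by apply: H; rewrite -(ltr_pXn2r (n := 2)) ?nnegrE ?normr_ge0 ?(ltW e0)//;
  rewrite real_normK ?num_real//; nra.
Qed.

Lemma continuous_re : continuous (re : CC R -> R).
Proof.
move=> z; apply/(cvgrPdist_lt (FF := nbhs_filter z)) => e e0; apply/nearC;
  exists e => // w h _.
by rewrite distrC.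
Qed.

Lemma continuous_im : continuous (im : CC R -> R).
Proof.
move=> z; apply/(cvgrPdist_lt (FF := nbhs_filter z)) => e e0; apply/nearC;
  exists e => // w _ h.
by rewrite distrC.
Qed.

Lemma cvg_mkC (T : Type) (F : set_system T) (FF : Filter F) (f g : T -> R) x y :
  f @ F --> x -> g @ F --> y -> (fun t => mkC (f t) (g t)) @ F --> mkC x y.
Proof.
move=> /cvgrPdist_lt hf /cvgrPdist_lt hg A /nearC[e e0 H].
rewrite /fmap /=; near=> t; apply: H => /=; rewrite distrC; near: t.
- exact: hf.
- exact: hg.
Unshelve. all: by end_near.
Qed.

Lemma cvg_re (T : Type) (F : set_system T) (FF : Filter F) (f : T -> CC R) z :
  f @ F --> z -> (fun t => re (f t)) @ F --> re z.
Proof. by move=> h; exact: (cvg_comp f _ h (@continuous_re z)). Qed.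

Lemma cvg_im (T : Type) (F : set_system T) (FF : Filter F) (f : T -> CC R) z :
  f @ F --> z -> (fun t => im (f t)) @ F --> im z.
Proof. by move=> h; exact: (cvg_comp f _ h (@continuous_im z)). Qed.

Section Cvg.
Variables (T : Type) (F : set_system T).
Context {FF : Filter F}.
Implicit Types f g : T -> CC R.

Lemma cvgCP f z :
  (fun t => re (f t)) @ F --> re z -> (fun t => im (f t)) @ F --> im z ->
  f @ F --> z.
Proof.
move=> h1 h2; have := cvg_mkC FF h1 h2; rewrite -mkC_reim.
by under eq_fun do rewrite -mkC_reim.
Qed.

Lemma cvgCD f g z w : f @ F --> z -> g @ F --> w ->
  (fun t => f t + g t) @ F --> (z + w : CC R).
Proof.
move=> hf hg; apply: cvgCP; rewrite !reimE;
  under eq_fun do rewrite !reimE; apply: cvgD;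
  by [exact: (cvg_re FF)|exact: (cvg_im FF)].
Qed.

Lemma cvgCM f g z w : f @ F --> z -> g @ F --> w ->
  (fun t => f t * g t) @ F --> (z * w : CC R).
Proof.
move=> hf hg; have := cvg_re FF hf; have := cvg_re FF hg; have := cvg_im FF hf;
  have := cvg_im FF hg => h1 h2 h3 h4.
apply: cvgCP; rewrite !reimE; under eq_fun do rewrite !reimE.
  by apply: cvgB; apply: cvgM.
by apply: cvgD; apply: cvgM.
Qed.

Lemma cvgC_cst z : (fun=> z) @ F --> z.
Proof. exact: cvg_cst. Qed.

Lemma cvgCV f z : z != 0 -> f @ F --> z ->
  (fun t => (f t)^-1) @ F --> (z^-1 : CC R).
Proof.
have reV (w : CC R) : re w^-1 = re w / nsq w by case: w.
have imV (w : CC R) : im w^-1 = - (im w / nsq w) by case: w.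
move=> z0 hf; have h1 := cvg_re FF hf; have h2 := cvg_im FF hf.
have hn : (fun t => nsq (f t)) @ F --> nsq z.
  by apply: cvgD; under eq_fun do rewrite expr2; rewrite expr2; apply: cvgM.
have n0 : nsq z != 0.
  apply: contra z0; rewrite /nsq paddr_eq0 ?sqr_ge0// !sqrf_eq0.
  by move=> /andP[/eqP h3 /eqP h4]; rewrite (mkC_reim z) h3 h4.
apply: cvgCP; rewrite ?reV ?imV.
  under eq_fun do rewrite reV.
  by apply: cvgM => //; apply: cvgV.
under eq_fun do rewrite imV.
by apply: cvgN; apply: cvgM => //; apply: cvgV.
Qed.

End Cvg.

Lemma continuous_expC : continuous (@expC R).
Proof.
move=> z; apply: (cvg_mkC (nbhs_filter z)); apply: cvgM.
- exact: (cvg_comp _ _ (@continuous_re z) (@continuous_expR R _)).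
- exact: (cvg_comp _ _ (@continuous_im z) (@continuous_cos R _)).
- exact: (cvg_comp _ _ (@continuous_re z) (@continuous_expR R _)).
- exact: (cvg_comp _ _ (@continuous_im z) (@continuous_sin R _)).
Qed.

Lemma continuous_fa (a : R) : continuous (fa a).
Proof.
move=> z; have FF := nbhs_filter z.
have hid : (fun w : CC R => w) @ z --> z by exact: cvg_id.
have haff (b : CC R) : (fun w : CC R => w + b) @ z --> (z + b : CC R).
  exact: (cvgCD hid (@cvgC_cst _ _ FF b)).
apply: (cvgCM (cvgCM (@cvgC_cst _ _ FF _) (haff _))).
exact: (cvg_comp _ _ (haff (a%:C : CC R)) (@continuous_expC _)).
Qed.

Lemma compact_box (b c d e : R) :
  compact [set z : CC R | b <= re z <= c /\ d <= im z <= e].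
Proof.
have -> : [set z : CC R | b <= re z <= c /\ d <= im z <= e] =
    (fun p : R * R => mkC p.1 p.2) @` (`[b, c] `*` `[d, e]).
  apply/seteqP; split => [z [h1 h2]|_ [[x y] [h1 h2] <-]] /=.
    exists (re z, im z); first by split; rewrite /= in_itv.
    by rewrite -mkC_reim.
  by move: h1 h2; rewrite /= !in_itv.
apply: continuous_compact; last by apply: compact_setX; exact: segment_compact.
apply: continuous_subspaceT => p.
by apply: cvg_mkC; [exact: cvg_fst|exact: cvg_snd].
Qed.

Lemma hausdorff_CC : hausdorff_space (CC R).
Proof. exact: norm_hausdorff. Qed.

End Plane.

(** * Real inequalities for sine, cosine and exponential *)

Section Trig.
Variable R : realType.
Implicit Types x y u v : R.

Lemma pi_lt4 : (pi : R) < 4.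
Proof. have := @pihalf_lt2 R; lra. Qed.

Lemma incr_is_derive (f df : R -> R) x y : x < y ->
  (forall t, x <= t <= y -> is_derive t 1 f (df t)) ->
  (forall t, x < t < y -> 0 < df t) -> f x < f y.
Proof.
move=> xy fd df0.
have [||t txy h] := @MVT _ f df x y xy.
- by move=> t; rewrite in_itv /= => /andP[? ?]; apply: fd; rewrite !ltW.
- apply: continuous_in_subspaceT => t; rewrite inE /= in_itv /= => txy.
  by apply: differentiable_continuous; apply/derivable1_diffP; case: (fd t txy).
- rewrite -subr_gt0 h mulr_gt0 ?subr_gt0//; apply: df0.
  by move: txy; rewrite in_itv.
Qed.

Lemma sin_lt_id y : 0 < y -> sin y < y.
Proof.
move=> y0; have [h|h] := ltP y 2; last by have := sin_le1 y; lra.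
rewrite -subr_gt0; have := @incr_is_derive (fun t => t - sin t) (fun t =>
  1 - cos t) 0 y y0.
rewrite sin0 subr0; apply => t t0.
rewrite subr_gt0 -(cos0 R); rewrite ltr_cos ?in_itv /=; have := pi_ge2 R; lra.
Qed.

Lemma sin_norm_le y : `|sin y| <= `|y|.
Proof.
have [y0|y0|->] := ltgtP y 0; last by rewrite sin0 normr0.
  have := @sin_lt_id (- y); rewrite sinN oppr_gt0 => /(_ y0) h.
  rewrite (ltr0_norm y0) ler_norml; apply/andP; split; last first.
    by have [?|?] := ltP (- y) 2; [have := @sin2_gt0 R (- y); rewrite sinN;
      lra|have := sin_le1 y; lra].
  lra.
rewrite (gtr0_norm y0) ler_norml (ltW (sin_lt_id y0)) andbT.
by have [?|?] := ltP y 2; [have := @sin2_gt0 R y; lra|have := sin_geN1 y; lra].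
Qed.

Lemma ycos_lt_sin y : 0 < y <= pi -> y * cos y < sin y.
Proof.
move=> /andP[y0 ypi].
have := @incr_is_derive (fun t => sin t - t * cos t) (fun t => t * sin t)
  0 y y0.
rewrite sin0 mul0r subrr subr_gt0; apply => t /andP[t0 ty].
  by apply: is_derive_eq; rewrite /GRing.scale /=; ring.
by rewrite mulr_gt0// sin_gt0_pi// t0 (lt_le_trans ty).
Qed.

Lemma sinpi_lt0 y : pi < y < pi *+ 2 -> sin y < 0.
Proof.
move=> /andP[h1 h2]; rewrite -[y](subrK pi) sinDpi oppr_lt0 sin_gt0_pi//.
by rewrite subr_gt0 h1 /= ltrBlDr -mulr2n.
Qed.

(** The numerator of the derivative of [y cot y] is [sin y cos y - y]. *)
Lemma ycot_decr x y :
  x < y -> (forall t, x <= t <= y -> sin t != 0) -> 0 <= x ->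
  y * cos y / sin y < x * cos x / sin x.
Proof.
move=> xy s0 x0.
rewrite -ltrN2.
apply: (@incr_is_derive (fun t => - (t * cos t / sin t))
   (fun t => (t - sin t * cos t) / sin t ^+ 2)) => // t.
  move=> /s0 st0.
  apply: is_derive_eq; rewrite /GRing.scale /=.
  have -> : t - sin t * cos t = t * (cos t ^+ 2 + sin t ^+ 2) - sin t * cos t.
    by rewrite cos2Dsin2 mulr1.
  by field.
move=> /andP[xt ty]; rewrite divr_gt0 ?exprn_even_gt0 ?s0 ?(ltW xt) ?(ltW ty)//.
rewrite subr_gt0.
have := @sin_lt_id (t *+ 2).
rewrite sin_mulr2n mulrC; rewrite !mulr2n; lra.
Qed.

Lemma one_sub_cos_le y : 1 - cos y <= y ^+ 2 / 2.
Proof.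
have [z ->] : exists z, y = z *+ 2.
  by exists (y / 2); rewrite -[RHS]mulr_natr divfK// pnatr_eq0.
have : sin z ^+ 2 <= z ^+ 2.
  rewrite -(real_normK (num_real (sin _))) -(real_normK (num_real z)).
  by rewrite ler_pXn2r ?nnegrE//; exact: sin_norm_le.
rewrite cos_mulr2n cos2sin2; set S := sin z ^+ 2 => h.
have -> : z *+ 2 = z + z by [].
have -> : (1 - S) *+ 2 = (1 - S) + (1 - S) by [].
nra.
Qed.

Lemma sin_sub_norm_le y : `|sin y - y| <= y ^+ 2.
Proof.
wlog y0 : y / 0 <= y.
  move=> h; have [|y0] := leP 0 y; first exact: h.
  have := h (- y); rewrite sinN opprK sqrrN -normrN opprD opprK.
  by apply; rewrite oppr_ge0 ltW.
have [->|yn0] := eqVneq y 0; first by rewrite sin0 subrr normr0 sqr_ge0.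
have {yn0} y0 : 0 < y by rewrite lt_def yn0.
rewrite distrC gtr0_norm ?subr_gt0 ?sin_lt_id//.
have [y2|y2] := ltP y 2; last first.
  have h2 : y * 2 <= y ^+ 2 by rewrite expr2 ler_pM2l.
  by have := sin_geN1 y; lra.
rewrite -subr_ge0 ltW//.
have := @incr_is_derive (fun t => t ^+ 2 - (t - sin t)) (fun t =>
  2 * t - (1 - cos t)) 0 y y0.
rewrite sin0 subr0 expr0n /= subr0; apply => t t0.
  by apply: is_derive_eq; rewrite /GRing.scale /=; ring.
by have := one_sub_cos_le t; move: t0 => /andP[? ?]; nra.
Qed.

Lemma expR_sub_bound x : `|x| <= 1 / 2 -> 0 <= expR x - 1 - x <= 2 * x ^+ 2.
Proof.
rewrite ler_norml => /andP[h1 h2].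
have := expR_ge1Dx x; have := expR_ge1Dx (- x).
have := expR_gt0 x; have := expRxMexpNx_1 x.
set e := expR x; set e' := expR (- x) => h3 h4 h5 h6.
have h7 : e * (1 - x) <= 1 by nra.
apply/andP; split; nra.
Qed.

(** [y ^+ 2] times the difference between [y ^+ 2] and the squared length of
    the vector [(sin y, cos y - sin y / y)]; see [im_deriv_gap]. *)
Definition contr_gap y :=
  y ^+ 4 - y ^+ 2 + y * (sin y * cos y) *+ 2 - sin y ^+ 2.

(** The derivative of the gap is [4 y (y ^+ 2 - sin y ^+ 2)]. *)
Lemma contr_gap_incr x y : 0 <= x < y -> contr_gap x < contr_gap y.
Proof.
move=> /andP[x0 xy].
apply: (@incr_is_derive contr_gap (fun t => 4 * t * (t ^+ 2 - sin t ^+ 2))) =>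
  // t.
  move=> _; rewrite /contr_gap; apply: is_derive_eq; rewrite /GRing.scale /=.
  have -> : 4 * t * (t ^+ 2 - sin t ^+ 2) = 4 * t ^+ 3 - 2 * t *
    (cos t ^+ 2 + sin t ^+ 2) + 2 * t * (cos t ^+ 2 - sin t ^+ 2).
    rewrite cos2sin2; ring.
  rewrite cos2Dsin2 !mulr2n; ring.
move=> /andP[t0 _]; have {}t0 := le_lt_trans x0 t0.
rewrite mulr_gt0 ?mulr_gt0 ?ltr0n// subr_gt0.
have h1 := sin_lt_id t0; have h2 := sin_norm_le t.
have h3 : `|sin t| < t.
  rewrite ltr_norml h1 andbT.
  by have [?|?] := ltP t 2; [have := @sin2_gt0 R t; lra|have := sin_geN1 t;
    lra].
by rewrite -(real_normK (num_real (sin _))) ltr_pXn2r ?nnegrE ?(ltW t0).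
Qed.

Lemma contr_gap0 : contr_gap 0 = 0.
Proof. by rewrite /contr_gap sin0 !mul0r mul0rn; ring. Qed.

Lemma contr_gapN y : contr_gap (- y) = contr_gap y.
Proof. rewrite /contr_gap sinN cosN; ring. Qed.

(** Cauchy-Schwarz for [u sin y + y cos y = (u + 1) sin y + (y cos y - sin
    y)]: the vectors are [(u + 1, y)] and [(sin y, cos y - sin y / y)]. *)
Lemma im_deriv_gap u y :
  y ^+ 2 * (u * sin y + y * cos y) ^+ 2 <=
  ((u + 1) ^+ 2 + y ^+ 2) * (y ^+ 4 - contr_gap y).
Proof.
set s := sin y; set c := cos y.
have -> : y ^+ 4 - contr_gap y = (y * s) ^+ 2 + (y * c - s) ^+ 2.
  rewrite /contr_gap -/s -/c.
  have -> : (y * s) ^+ 2 + (y * c - s) ^+ 2 =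
    y ^+ 2 * (c ^+ 2 + s ^+ 2) - y * (s * c) *+ 2 + s ^+ 2 by ring.
  rewrite cos2Dsin2; ring.
rewrite -subr_ge0.
have -> : ((u + 1) ^+ 2 + y ^+ 2) * ((y * s) ^+ 2 + (y * c - s) ^+ 2) -
   y ^+ 2 * (u * s + y * c) ^+ 2 =
   ((u + 1) * (y * c - s) - y * (y * s)) ^+ 2 by ring.
exact: sqr_ge0.
Qed.

(** Since [(u + 1) ^+ 2 + y ^+ 2] is, up to the common exponential factor,
    the squared modulus of the derivative of [fa a], this inequality says
    that [fa a] does not contract the hyperbolic metric [|dz| / |im z|]. It
    is the infinitesimal Schwarz-Pick lemma for the inverse branches. *)
Lemma im_deriv_le u y :
  (u * sin y + y * cos y) ^+ 2 <= y ^+ 2 * ((u + 1) ^+ 2 + y ^+ 2).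
Proof.
have [->|y0] := eqVneq y 0.
  by rewrite sin0 !mul0r mulr0 add0r !expr0n /= mul0r.
have y2 : 0 < y ^+ 2 by rewrite exprn_even_gt0.
have g0 : 0 <= contr_gap y.
  wlog yp : y y0 y2 / 0 < y.
    move=> h; have [|yn|/eqP] := ltgtP 0 y;
      [exact: h| |by rewrite eq_sym (negbTE y0)].
    by rewrite -contr_gapN; apply: h; rewrite ?oppr_eq0 ?sqrrN ?oppr_gt0.
  by rewrite -contr_gap0 ltW// contr_gap_incr// lexx.
rewrite -(ler_pM2l y2); apply: (le_trans (im_deriv_gap u y)).
have -> : y ^+ 2 * (y ^+ 2 * ((u + 1) ^+ 2 + y ^+ 2)) =
  ((u + 1) ^+ 2 + y ^+ 2) * y ^+ 4 by ring.
by rewrite ler_wpM2l ?addr_ge0 ?sqr_ge0// lerBlDr lerDl.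
Qed.

(** The gap depends on [y] alone and increases with [|y|], so the expansion
    is uniform as soon as [|y|] stays away from 0. *)
Lemma im_deriv_contract b y0 : 0 < y0 -> exists2 lam, 0 <= lam < 1 &
  forall u y, y0 <= `|y| <= b ->
  (u * sin y + y * cos y) ^+ 2 <= lam ^+ 2 * (y ^+ 2 * ((u + 1) ^+ 2 + y ^+ 2)).
Proof.
move=> y00.
have g0 : 0 < contr_gap y0 by rewrite -contr_gap0 contr_gap_incr// lexx.
set B := Num.max b y0.
have B0 : 0 < B by rewrite lt_max y00 orbT.
have B4 : 0 < B ^+ 4 by rewrite exprn_gt0.
set q := contr_gap y0 / B ^+ 4.
have q0 : 0 < q by rewrite divr_gt0.
have key y : y0 <= `|y| <= b -> q * y ^+ 4 <= contr_gap y.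
  move=> h.
  have {h} [h1 h2] : y0 <= `|y| /\ `|y| <= B.
    by move: h => /andP[-> h]; rewrite le_max h.
  have -> : contr_gap y = contr_gap `|y|.
    by have [?|?] := leP 0 y;
      [rewrite ger0_norm|rewrite ltr0_norm// contr_gapN].
  have -> : y ^+ 4 = `|y| ^+ 4.
    by rewrite -normrX ger0_norm// exprn_even_ge0.
  have h3 : contr_gap y0 <= contr_gap `|y|.
    by move: h1; rewrite le_eqVlt => /predU1P[->//|h1];
      rewrite ltW// contr_gap_incr// (ltW y00).
  apply: le_trans h3.
  rewrite /q mulrAC ler_pdivrMr// ler_pM2l//.
  by rewrite ler_pXn2r ?nnegrE// ltW.
have q1 : q <= 1.
  have h : y0 ^+ 4 <= B ^+ 4 by rewrite ler_pXn2r ?nnegrE ?(ltW y00)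
    ?(ltW B0)// le_max lexx orbT.
  rewrite /q ler_pdivrMr// mul1r; apply: le_trans h.
  have := im_deriv_gap (- 1) y0.
  have h2 : 0 <= y0 ^+ 2 * (-1 * sin y0 + y0 * cos y0) ^+ 2
    by rewrite mulr_ge0 ?sqr_ge0.
  have h3 : 0 < (-1 + 1) ^+ 2 + y0 ^+ 2
    by rewrite addNr expr0n /= add0r exprn_gt0.
  move=> /(le_trans h2); rewrite pmulr_rge0//; lra.
exists (Num.sqrt (1 - q)).
  rewrite sqrtr_ge0 /= -[ltRHS]sqrtr1 ltr_sqrt//; lra.
move=> u y hy; rewrite sqr_sqrtr ?subr_ge0//.
have y2 : 0 < y ^+ 2.
  by rewrite exprn_even_gt0 //= -normr_eq0 gt_eqF//; move: hy =>
    /andP[/(lt_le_trans y00)].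
rewrite -(ler_pM2l y2); apply: (le_trans (im_deriv_gap u y)).
have -> : y ^+ 2 * ((1 - q) * (y ^+ 2 * ((u + 1) ^+ 2 + y ^+ 2))) =
  ((u + 1) ^+ 2 + y ^+ 2) * (y ^+ 4 - q * y ^+ 4) by ring.
by rewrite ler_wpM2l ?addr_ge0 ?sqr_ge0// lerB// key.
Qed.

(** Along the set where [fa a] has argument [p], the point of height [y]
    satisfies [re z + a - 1 = y cot (p - y)], and the modulus of [fa a]
    there is this function times [a e]. *)
Definition polar_mod p y :=
  y / sin (p - y) * expR (y * cos (p - y) / sin (p - y)).

(** With [d = p - y] the logarithmic derivative is [((y + sin d cos d) ^+ 2
    + sin d ^+ 4) / (y sin d ^+ 2)]. *)
Lemma polar_mod_incr p x y : 0 <= x < y ->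
  (forall t, x <= t <= y -> 0 < sin (p - t)) -> polar_mod p x < polar_mod p y.
Proof.
move=> /andP[x0 xy] s0.
pose S t := sin (p - t); pose C t := cos (p - t).
apply: (@incr_is_derive (polar_mod p) (fun t => expR (t * C t / S t) *
  ((t ^+ 2 * (C t ^+ 2 + S t ^+ 2) + 2 * t * C t * S t + S t ^+ 2) / S t ^+ 3)))
  => // t.
  move=> /s0; rewrite -/(S t) => st0; have sn0 : S t != 0 by rewrite gt_eqF.
  have dS : is_derive t 1 S (- C t).
    by apply: is_derive_eq; rewrite /GRing.scale /= /S /C; ring.
  have dC : is_derive t 1 C (S t).
    by apply: is_derive_eq; rewrite /GRing.scale /= /S /C; ring.
  have -> : polar_mod p = (fun t => t / S t * expR (t * C t / S t)) by [].
  apply: is_derive_eq; rewrite /GRing.scale /=; field.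
  exact: sn0.
move=> /andP[xt ty]; have : 0 < S t by apply: s0; rewrite !ltW.
rewrite /C cos2Dsin2 -/(C t) => st.
rewrite mulr_gt0 ?expR_gt0// divr_gt0 ?exprn_gt0//.
have -> : t ^+ 2 * 1 + 2 * t * C t * S t + S t ^+ 2 =
  (t + C t * S t) ^+ 2 + (1 - C t ^+ 2) * S t ^+ 2 by ring.
rewrite /C -sin2cos2 -/(S t).
by rewrite ltr_wpDl ?sqr_ge0// mulr_gt0// exprn_gt0.
Qed.

Definition sinc y := if y == 0 then 1 else sin y / y.

Lemma sincE y : y * sinc y = sin y.
Proof.
rewrite /sinc; case: eqP => [->|/eqP y0]; first by rewrite sin0 mul0r.
by rewrite mulrC divfK.
Qed.

Lemma sincN y : sinc (- y) = sinc y.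
Proof. by rewrite /sinc oppr_eq0 sinN invrN mulrNN. Qed.

Lemma sinc_norm y : sinc `|y| = sinc y.
Proof. by have [?|?] := leP 0 y;
  [rewrite ger0_norm|rewrite ltr0_norm// sincN]. Qed.

Lemma sinc_sub1 y : `|1 - sinc y| <= `|y|.
Proof.
rewrite /sinc; case: eqP => [->|/eqP y0]; first by rewrite subrr.
have y0' : 0 < `|y| by rewrite normr_gt0.
rewrite -(ler_pM2r y0') -normrM mulrBl divfK// mul1r distrC.
by apply: (le_trans (sin_sub_norm_le y)); rewrite -real_normK ?num_real.
Qed.

Lemma continuous_sinc : continuous sinc.
Proof.
move=> y; have [->|y0] := eqVneq y 0.
  apply/cvgrPdist_lt => e e0; exists e => //= t.
  rewrite /ball_/= => te; have {}te : `|t| < e by rewrite -normrN -sub0r.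
  by rewrite {1}/sinc eqxx; apply: (le_lt_trans (sinc_sub1 t)).
have h : \forall t \near y, sin t / t = sinc t.
  have : \forall t \near y, t != 0 by exact: (cvgr_neq0 (f := id) y cvg_id y0).
  by apply: filterS => t t0; rewrite /sinc (negbTE t0).
apply: (cvg_trans (near_eq_cvg h)).
rewrite /sinc (negbTE y0).
apply: cvgM; first exact: continuous_sin.
by apply: cvgV => //; exact: cvg_id.
Qed.

End Trig.

(** * The map in coordinates and the regions bounded by the curves *)

Section Regions.
Variables (R : realType) (a : R).
Hypothesis ha : 3 <= a.
Implicit Types (x y : R) (z w : CC R).

(** The factor in [im (fa a z) = a e^(x + a) * y * qfun x y]. It is
    continuous and even in [y] with [qfun x 0 = x + a], so that its sign
    describes the partition on both sides of the real axis at once. *)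
Definition qfun x y : R := (x + a - 1) * sinc y + cos y.
Definition Qfun z := qfun (re z) (im z).
(** The modulus of [a exp (z + a)]. *)
Definition efun z : R := a * expR (re z + a).

Lemma efun_gt0 z : 0 < efun z.
Proof. by apply: mulr_gt0; [have := ha; lra|exact: expR_gt0]. Qed.

Lemma re_fa z : re (fa a z) =
  efun z * ((re z + a - 1) * cos (im z) - im z * sin (im z)).
Proof. by case: z => x y; rewrite /fa /expC /efun /= !addr0 !subr0; ring. Qed.

Lemma im_fa z : im (fa a z) =
  efun z * ((re z + a - 1) * sin (im z) + im z * cos (im z)).
Proof. by case: z => x y; rewrite /fa /expC /efun /= !addr0 !subr0; ring. Qed.

Lemma qfun_mul x y : y * qfun x y = (x + a - 1) * sin y + y * cos y.
Proof. by rewrite /qfun mulrDr mulrCA sincE. Qed.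

Lemma im_faQ z : im (fa a z) = efun z * (im z * Qfun z).
Proof. by rewrite im_fa /Qfun qfun_mul. Qed.

Lemma nsq_fa z : nsq (fa a z) = efun z ^+ 2 * ((re z + a - 1) ^+ 2 + im z ^+ 2).
Proof.
rewrite /nsq re_fa im_fa.
set c := cos _; set s := sin _; set u := re z + a - 1; set y := im z.
have -> : (efun z * (u * c - y * s)) ^+ 2 + (efun z * (u * s + y * c)) ^+ 2
 = efun z ^+ 2 * ((u ^+ 2 + y ^+ 2) * (c ^+ 2 + s ^+ 2)) by ring.
by rewrite cos2Dsin2 mulr1.
Qed.

Lemma continuous_Q : continuous Qfun.
Proof.
move=> z; have FF := nbhs_filter z.
have h1 := cvg_comp _ _ (@continuous_im R z) (@continuous_cos R _).
have h2 := cvg_comp _ _ (@continuous_im R z) (@continuous_sinc R _).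
have h3 : (fun w : CC R => re w + a - 1) @ z --> re z + a - 1.
  exact: (cvgB (cvgD (@continuous_re R z) (cvg_cst _)) (cvg_cst _)).
exact: (cvgD (cvgM h3 h2) h1).
Qed.

Lemma qfunN x y : qfun x (- y) = qfun x y.
Proof. by rewrite /qfun sincN cosN. Qed.

Lemma qfun_norm x y : qfun x `|y| = qfun x y.
Proof. by have [?|?] := leP 0 y;
  [rewrite ger0_norm|rewrite ltr0_norm// qfunN]. Qed.

Lemma qfun0 x : qfun x 0 = x + a.
Proof. by rewrite /qfun /sinc eqxx cos0; ring. Qed.

Lemma sinc_eq0 y : 0 < y -> sin y = 0 -> sinc y = 0.
Proof. by move=> y0 s0; rewrite /sinc gt_eqF// s0 mul0r. Qed.

Lemma qfunpi x : qfun x pi = -1.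
Proof. by rewrite /qfun sinc_eq0 ?pi_gt0 ?sinpi// mulr0 add0r cospi. Qed.

Lemma qfun2pi x : qfun x (2 * pi) = 1.
Proof.
rewrite /qfun mulr_natl sinc_eq0 ?sin2pi//; first by rewrite mulr0 add0r cos2pi.
by rewrite mulrn_wgt0// pi_gt0.
Qed.

Lemma sinpi2_lt0 y : pi < y < 2 * pi -> sin y < 0.
Proof. by rewrite mulr_natl; exact: sinpi_lt0. Qed.

(** For [0 < y < pi] the sign of [qfun x y] is that of [x + a - 1 + y cot
    y], and [y cot y] decreases. *)
Lemma qfun_down x y y' :
  0 <= y' < y -> y < pi -> 0 <= qfun x y -> 0 < qfun x y'.
Proof.
move=> /andP[y'0 yy'] ypi h.
have y0 : 0 < y by apply: le_lt_trans yy'.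
have s0 : 0 < sin y by rewrite sin_gt0_pi// y0.
have h1 : 0 <= (x + a - 1) + y * cos y / sin y.
  by rewrite -(pmulr_lge0 _ s0) mulrDl divfK ?gt_eqF// -qfun_mul mulr_ge0// ltW.
have [y'0'|y'n0] := eqVneq y' 0.
  rewrite y'0' qfun0; have := @ycos_lt_sin R y; rewrite y0 (ltW ypi) =>
    /(_ isT) h2.
  suff : y * cos y / sin y < 1 by lra.
  by rewrite ltr_pdivrMr// mul1r.
have {y'0 y'n0} y'0 : 0 < y' by rewrite lt_def y'n0.
have s'0 : 0 < sin y' by rewrite sin_gt0_pi// y'0 (lt_trans yy').
rewrite -(pmulr_rgt0 _ y'0) qfun_mul.
have -> : (x + a - 1) * sin y' + y' * cos y' =
  ((x + a - 1) + y' * cos y' / sin y') * sin y'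
    by rewrite [RHS]mulrDl divfK// gt_eqF.
rewrite mulr_gt0//.
have := @ycot_decr R y' y yy'; rewrite (ltW y'0) => h2.
suff : y * cos y / sin y < y' * cos y' / sin y' by lra.
apply: h2 => // t /andP[ht1 ht2].
by rewrite gt_eqF// sin_gt0_pi// (lt_le_trans y'0)// (le_lt_trans ht2).
Qed.

(** On [(pi, 2 pi)] the sine is negative, so the sign of [qfun x y] is
    opposite to that of [x + a - 1 + y cot y], where [y cot y] decreases
    again. *)
Lemma qfun_down2 x y y' : pi <= y' < y -> y < 2 * pi -> qfun x y <= 0 ->
  qfun x y' < 0.
Proof.
move=> /andP[]; rewrite le_eqVlt => /predU1P[<- _ _ _|]; first
  by rewrite qfunpi ltrN10.
move=> y'pi yy' y2pi h.
have p0 := @pi_gt0 R.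
have y0 : 0 < y by lra.
have y'0 : 0 < y' by lra.
have s0 : sin y < 0 by apply: sinpi2_lt0; rewrite y2pi; lra.
have s'0 : sin y' < 0 by apply: sinpi2_lt0; apply/andP; split; lra.
have h1 : 0 <= (x + a - 1) + y * cos y / sin y.
  by rewrite -(nmulr_lle0 _ s0) mulrDl divfK ?lt_eqF// -qfun_mul pmulr_rle0.
rewrite -(pmulr_rlt0 _ y'0) qfun_mul.
have -> : (x + a - 1) * sin y' + y' * cos y' =
  ((x + a - 1) + y' * cos y' / sin y') * sin y'
    by rewrite [RHS]mulrDl divfK// lt_eqF.
rewrite nmulr_llt0//.
have := @ycot_decr R y' y yy'; rewrite (ltW y'0) => h2.
suff : y * cos y / sin y < y' * cos y' / sin y' by lra.
apply: h2 => // t /andP[ht1 ht2].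
by rewrite lt_eqF// sinpi2_lt0//; apply/andP; split; lra.
Qed.

Lemma sinc_gt0 y : `|y| < pi -> 0 < sinc y.
Proof.
rewrite -sinc_norm => h; rewrite /sinc; case: eqP => // /eqP y0.
have y1 : 0 < `|y| by rewrite lt_def y0 normr_ge0.
by rewrite divr_gt0// sin_gt0_pi// y1.
Qed.

Lemma sinc_lt0 y : pi < `|y| < 2 * pi -> sinc y < 0.
Proof.
rewrite -sinc_norm => h; have p0 := @pi_gt0 R; rewrite /sinc ifF; last first.
  by apply/negbTE; rewrite gt_eqF//; lra.
have ? := sinpi2_lt0 h.
by rewrite pmulr_llt0// invr_gt0; lra.
Qed.

Lemma qfun_incr_x x x' y : `|y| < pi -> (qfun x y < qfun x' y) = (x < x').
Proof.
move=> h; rewrite /qfun ltrD2r ltr_pM2r ?sinc_gt0//.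
by rewrite -!addrA ltrD2r.
Qed.

Lemma qfun_decr_x x x' y : pi < `|y| < 2 * pi ->
  (qfun x y < qfun x' y) = (x' < x).
Proof.
move=> h; rewrite /qfun ltrD2r ltr_nM2r ?sinc_lt0//.
by rewrite -!addrA ltrD2r.
Qed.

(** [reg0], [reg1] and [regS] are [T0], [T1] and [strip] in closed form;
    [curve0] is the union of the curves eta with [- a], and [curve1] that of
    the curves zeta. *)
Definition reg0 : set (CC R) := [set z | `|im z| < pi /\ 0 < Qfun z].
Definition reg1 : set (CC R) := [set z | `|im z| < 2 * pi /\ Qfun z < 0].
Definition regS : set (CC R) :=
  [set z | `|im z| < pi \/ (`|im z| < 2 * pi /\ Qfun z < 0)].
Definition curve0 : set (CC R) := [set z | `|im z| < pi /\ Qfun z = 0].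
Definition curve1 : set (CC R) := [set z | pi < `|im z| < 2 * pi /\ Qfun z = 0].

Lemma Q_pi z : `|im z| = pi -> Qfun z = -1.
Proof. by move=> h; rewrite /Qfun -qfun_norm h qfunpi. Qed.
Lemma Q_2pi z : `|im z| = 2 * pi -> Qfun z = 1.
Proof. by move=> h; rewrite /Qfun -qfun_norm h qfun2pi. Qed.

Lemma continuous_absim : continuous (fun z => `|im z|).
Proof. by move=> z; exact: (cvg_comp _ _ (@continuous_im R z)
  (@norm_continuous R R^o _)). Qed.

Lemma open_absim_lt b : open [set z : CC R | `|im z| < b].
Proof. exact: (open_comp (fun z _ => @continuous_absim z) (@open_lt R b)). Qed.
Lemma closed_absim_le b : closed [set z : CC R | `|im z| <= b].
Proof. exact: (closed_comp (fun z _ => @continuous_absim z)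
  (@closed_le R b)). Qed.
Lemma open_Q_lt b : open [set z | Qfun z < b].
Proof. exact: (open_comp (fun z _ => @continuous_Q z) (@open_lt R b)). Qed.
Lemma open_Q_gt b : open [set z | b < Qfun z].
Proof. exact: (open_comp (fun z _ => @continuous_Q z) (@open_gt R b)). Qed.
Lemma closed_Q_le b : closed [set z | Qfun z <= b].
Proof. exact: (closed_comp (fun z _ => @continuous_Q z) (@closed_le R b)). Qed.
Lemma closed_Q_ge b : closed [set z | b <= Qfun z].
Proof. exact: (closed_comp (fun z _ => @continuous_Q z) (@closed_ge R b)). Qed.

Lemma open_reg0 : open reg0.
Proof. exact: (openI (@open_absim_lt pi) (@open_Q_gt 0)). Qed.
Lemma open_reg1 : open reg1.
Proof. exact: (openI (@open_absim_lt (2 * pi)) (@open_Q_lt 0)). Qed.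
Lemma open_regS : open regS.
Proof.
exact: (openU (@open_absim_lt pi)
  (openI (@open_absim_lt (2 * pi)) (@open_Q_lt 0))).
Qed.

Lemma closure_sub (T : topologicalType) (A B : set T) :
  closed B -> A `<=` B -> closure A `<=` B.
Proof. by move=> /closure_id {2}-> ; exact: closureS. Qed.

Lemma frontier_open (T : topologicalType) (A : set T) : open A -> frontier A =
  closure A `\` A.
Proof. by move=> /interior_id h; rewrite /frontier h. Qed.

(** Boundary points of the regions are approached horizontally, because
    [qfun x y] is strictly monotone in [x] on every line that meets the
    curves. *)
Lemma closure_horiz (A : set (CC R)) z (s : R) :
  (forall e, 0 < e -> exists2 d, 0 < d < e & A (mkC (re z + s * d) (im z))) ->
  `|s| <= 1 -> closure A z.
Proof.
move=> h s1 B /nearC[e e0 hB]; have [d /andP[d0 de] Ad] := h _ e0.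
exists (mkC (re z + s * d) (im z)); split => //; apply: hB => /=; last
  by rewrite subrr normr0.
rewrite addrC addKr normrM (gtr0_norm d0).
by apply: le_lt_trans de; rewrite -[leRHS]mul1r ler_pM2r.
Qed.

Lemma frontier_reg0 : frontier reg0 = curve0.
Proof.
rewrite (frontier_open open_reg0); apply/seteqP; split => z.
  move=> [cz nz].
  have h : [set z : CC R | `|im z| <= pi /\ 0 <= Qfun z] z.
    apply: closure_sub cz; first exact: (closedI (@closed_absim_le pi)
      (@closed_Q_ge 0)).
    by move=> w [? ?]; split; apply: ltW.
  move: h => [h1 h2]; have {}h1 : `|im z| < pi.
    by rewrite lt_neqAle h1 andbT; apply/eqP => /Q_pi; lra.
  split => //; apply/eqP; rewrite eq_le h2 andbT leNgt; apply/negP => h3.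
  exact: nz.
move=> [h1 h2]; split; last by move=> [_]; rewrite h2 ltxx.
apply: (@closure_horiz _ _ 1); last by rewrite normr1.
move=> e e0; exists (e / 2); first lra.
by split => //=; rewrite -h2 /Qfun /= qfun_incr_x//; lra.
Qed.

Lemma frontier_reg1 : frontier reg1 = curve0 `|` curve1.
Proof.
have p0 := @pi_gt0 R.
rewrite (frontier_open open_reg1); apply/seteqP; split => z.
  move=> [cz nz].
  have h : [set z : CC R | `|im z| <= 2 * pi /\ Qfun z <= 0] z.
    apply: closure_sub cz; first exact: (closedI (@closed_absim_le (2 * pi))
      (@closed_Q_le 0)).
    by move=> w [? ?]; split; apply: ltW.
  move: h => [h1 h2]; have {}h1 : `|im z| < 2 * pi.
    by rewrite lt_neqAle h1 andbT; apply/eqP => /Q_2pi; lra.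
  have h3 : Qfun z = 0.
    apply/eqP; rewrite eq_le h2 leNgt; apply/negP => h3; exact: nz.
  have [h4|h4|/Q_pi] := ltgtP `|im z| pi; last by rewrite h3; lra.
    by left.
  by right; split; rewrite ?h4.
move=> [[h1 h2]|[h1 h2]]; (split; last by move=> [_]; rewrite h2 ltxx).
  apply: (@closure_horiz _ _ (-1)); last by rewrite normrN1.
  move=> e e0; exists (e / 2); first lra.
  by split => /=; [lra|rewrite -h2 /Qfun /= qfun_incr_x//; lra].
apply: (@closure_horiz _ _ 1); last by rewrite normr1.
move=> e e0; exists (e / 2); first lra.
by split => /=; [lra|rewrite -h2 /Qfun /= qfun_decr_x//; lra].
Qed.

Lemma frontier_regS : frontier regS = curve1.
Proof.
have p0 := @pi_gt0 R.
rewrite (frontier_open open_regS); apply/seteqP; split => z.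
  move=> [cz nz].
  have h : ([set z : CC R | `|im z| <= pi] `|` [set z : CC R | `|im z| <=
    2 * pi /\ Qfun z <= 0]) z.
    apply: closure_sub cz.
      exact: (closedU (@closed_absim_le pi)
        (closedI (@closed_absim_le (2 * pi)) (@closed_Q_le 0))).
    by move=> w [?|[? ?]]; [left|right; split]; apply: ltW.
  have h0 : pi < `|im z|.
    rewrite ltNge le_eqVlt; apply/negP => /orP[/eqP h1|h1]; apply: nz; last
      by left.
    by right; split; [lra|rewrite (Q_pi h1); lra].
  move: h => [/= h|[/= h1 h2]]; first lra.
  have {}h1 : `|im z| < 2 * pi.
    by rewrite lt_neqAle h1 andbT; apply/eqP => /Q_2pi; lra.
  split; first by rewrite h0.
  by apply/eqP; rewrite eq_le h2 leNgt; apply/negP => h3; apply: nz; right.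
move=> [h1 h2]; split; last by move=> [|[_]]; rewrite ?h2 ?ltxx//; lra.
apply: (@closure_horiz _ _ 1); last by rewrite normr1.
move=> e e0; exists (e / 2); first lra.
by right; split => /=; [lra|rewrite -h2 /Qfun /= qfun_decr_x//; lra].
Qed.

End Regions.

(** * Connected sets in the plane *)

Section Conn.
Variable R : realType.
Implicit Types (x y : R) (z w : CC R) (A C U : set (CC R)).

(** A barrier principle: it confines domains to one side of given curves,
    and the preimages of a small disc to a bounded window. *)
Lemma connected_frontier_sub (T : topologicalType) (U A : set T) (z : T) :
  connected U -> U z -> A z -> (forall w : T, U w -> ~ frontier A w) ->
    U `<=` A.
Proof.
move=> cU Uz Az UfA.
have h (w : T) : U w -> closure A w -> interior A w.
  by move=> Uw cw; apply: contrapT => nw; apply: (UfA _ Uw); split.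
suff <- : U `&` A = U by move=> w [].
apply: cU; first by exists z.
  exists A°; first exact: open_interior.
  apply/seteqP; split => w [Uw Aw]; split => //; last exact: interior_subset.
  by apply: h => //; exact: subset_closure.
exists (closure A); first exact: closed_closure.
apply/seteqP; split => w [Uw Aw]; split => //; first exact: subset_closure.
by apply: interior_subset; exact: h.
Qed.

Lemma connected_im_itv (I : interval R) (f : R -> CC R) :
  {in [set` I], continuous f} -> connected (f @` [set` I]).
Proof.
move=> cf; apply: connected_continuous_connected.
  by apply/connected_intervalP; exact: interval_is_interval.
exact: continuous_in_subspaceT.
Qed.

Lemma connected_IVT U (g : CC R -> R) z w c : connected U -> continuous g ->
  U z -> U w -> g z <= c <= g w -> exists2 v, U v & g v = c.
Proof.
move=> cU cg Uz Uw h.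
have : connected (g @` U).
  by apply: connected_continuous_connected => //; exact: continuous_subspaceT.
move=> /connected_intervalP /(_ (g z) (g w)) /=.
case/(_ _ _ c h) => //; first by exists z.
  by exists w.
by move=> v Uv <-; exists v.
Qed.

Lemma component_segment A z w :
  (forall t, 0 <= t <= 1 ->
    A (mkC (re z + t * (re w - re z)) (im z + t * (im w - im z)))) ->
  connected_component A z w.
Proof.
move=> h.
pose f t := mkC (re z + t * (re w - re z)) (im z + t * (im w - im z)).
apply: (@connected_component_max _ A (f @` `[0, 1])).
- exists 0; first by rewrite /= in_itv /= lexx ler01.
  by rewrite /f !mul0r !addr0 -mkC_reim.
- by move=> _ [t + <-]; rewrite /= in_itv /= => /h.
- apply: connected_im_itv => t _.
  by apply: (cvg_mkC (nbhs_filter t)); apply: cvgD;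
    [exact: cvg_cst|apply: cvgMl; exact: cvg_id|exact: cvg_cst|apply: cvgMl;
      exact: cvg_id].
- exists 1; first by rewrite /= in_itv /= lexx ler01.
  by rewrite /f !mul1r !subrKC -mkC_reim.
Qed.

Lemma component_hsegment A x x' y :
  (forall t, Num.min x x' <= t <= Num.max x x' -> A (mkC t y)) ->
  connected_component A (mkC x y) (mkC x' y).
Proof.
move=> h; apply: component_segment => t /andP[t0 t1] /=;
  rewrite subrr mulr0 addr0; apply: h.
by rewrite minEle maxEle; case: (leP x x') => ?; apply/andP; split; nra.
Qed.

Lemma component_vsegment A x y y' :
  (forall t, Num.min y y' <= t <= Num.max y y' -> A (mkC x t)) ->
  connected_component A (mkC x y) (mkC x y').
Proof.
move=> h; apply: component_segment => t /andP[t0 t1] /=;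
  rewrite subrr mulr0 addr0; apply: h.
by rewrite minEle maxEle; case: (leP y y') => ?; apply/andP; split; nra.
Qed.

Lemma connected_by A z : (forall w, A w -> connected_component A z w) ->
  connected A.
Proof.
move=> h; suff -> : A = connected_component A z by exact: component_connected.
by apply/seteqP; split => [w /h//|]; exact: connected_component_sub.
Qed.

(** A domain is a connected component of the complement of its frontier,
    hence is determined by the frontier and one of its points. *)
Lemma bounded_by_unique (K U V : set (CC R)) z :
  bounded_by K U -> bounded_by K V -> U z -> V z -> U = V.
Proof.
move=> [oU cU fU] [oV cV fV] Uz Vz.
have disj (W : set (CC R)) : open W -> frontier W = K -> forall w, W w -> ~ K w.
  by move=> oW <- w Ww; rewrite (frontier_open oW) => -[_].
apply/seteqP; split.
  by apply: (connected_frontier_sub cU Uz Vz) => w /(disj _ oU fU); rewrite fV.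
by apply: (connected_frontier_sub cV Vz Uz) => w /(disj _ oV fV); rewrite fU.
Qed.

End Conn.

(** * The preimage of the positive axis *)

Section ZetaCurves.
Variables (R : realType) (a : R).
Hypothesis ha : 3 <= a.
Implicit Types (x y s : R) (z w : CC R).
Notation Qfun := (Qfun a).
Notation qfun := (qfun a).

Lemma real_subsetP (A : set R) z : real_subset A z <-> im z = 0 /\ A (re z).
Proof.
split; first by move=> [x Ax <-].
by move=> [h1 h2]; exists (re z) => //; rewrite [RHS]mkC_reim h1.
Qed.

(** The curve zeta of index 1 for [s = 1], of index -1 for [s = -1]. *)
Definition zset s : set (CC R) :=
  [set z | pi < s * im z < 2 * pi /\ Qfun z = 0].

Definition pospre : set (CC R) := fa a @^-1` real_subset `]0, +oo[.

Lemma sgnP s : s = 1 \/ s = -1 -> forall y, 0 <= s * y -> s * y = `|y|.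
Proof.
by move=> [->|->] y; rewrite ?mul1r ?mulN1r => h;
  [rewrite ger0_norm|rewrite -normrN ger0_norm].
Qed.

Lemma pospre_real_or z : pospre z -> im z = 0 \/ Qfun z = 0.
Proof.
move=> /real_subsetP[/eqP + _]; rewrite im_faQ.
by rewrite mulf_eq0 gt_eqF ?(efun_gt0 ha)//= mulf_eq0 => /orP[]/eqP;
  [left|right].
Qed.

(** Where [qfun] vanishes off the real axis, the value of [fa a] is real and
    equal to [- a e^(x + a) y / sin y]; its sign is read off from [sinc y]. *)
Lemma re_fa_curve z : Qfun z = 0 -> im z != 0 ->
  sinc (im z) * re (fa a z) = - efun a z.
Proof.
move=> q0 y0; have := qfun_mul a (re z) (im z).
rewrite -/(Qfun z) q0 mulr0 => h; rewrite re_fa.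
apply: (mulfI y0); rewrite [LHS]mulrA sincE mulrN.
transitivity (efun a z * (cos (im z) *
    ((re z + a - 1) * sin (im z) + im z * cos (im z))
   - im z * (cos (im z) ^+ 2 + sin (im z) ^+ 2))); first by ring.
by rewrite -h cos2Dsin2; ring.
Qed.

Lemma zset_pospre s : s = 1 \/ s = -1 -> zset s `<=` pospre.
Proof.
move=> hs z [h1 h2]; have p0 := @pi_gt0 R.
have h3 : s * im z = `|im z| by apply: sgnP => //; lra.
rewrite h3 in h1.
have y0 : im z != 0 by rewrite -normr_eq0 gt_eqF//; lra.
apply/real_subsetP; split; first by rewrite im_faQ h2 !mulr0.
rewrite /= in_itv /= andbT.
have := re_fa_curve h2 y0; have := sinc_lt0 h1; have := efun_gt0 ha z.
by move=> e0 s0 h; rewrite -(nmulr_rlt0 _ s0) h oppr_lt0.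
Qed.

(** On the lines [im z = k pi] with [k <> 0] the function [qfun] is 1 or -1,
    so the preimage of the positive axis avoids them, and a connected part
    of it cannot change band. *)
Lemma pospre_connected_zset s (C : set (CC R)) z :
  s = 1 \/ s = -1 -> connected C ->
  C `<=` pospre -> C z -> pi < s * im z < 2 * pi -> C `<=` zset s.
Proof.
move=> hs cC CP Cz hz w Cw; have p0 := @pi_gt0 R.
have ci : continuous (fun z : CC R => s * im z).
  by move=> v; have FF := nbhs_filter v;
    exact: (cvgM (cvg_cst s) (@continuous_im R v)).
have avoid v : C v -> s * im v != pi /\ s * im v != 2 * pi.
  move=> Cv; have /pospre_real_or := CP _ Cv.
  have [h|h] := eqVneq (im v) 0.
    by move=> _; rewrite h mulr0; split; rewrite lt_eqF//; lra.
  move=> [/eqP|Q0]; first by rewrite (negbTE h).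
  split; apply/eqP => h'; have := sgnP hs (y := im v); rewrite h' =>
    /(_ ltac:(lra)) /esym.
    by move/(Q_pi a); rewrite Q0; lra.
  by move/(Q_2pi a); rewrite Q0; lra.
have hw : pi < s * im w < 2 * pi.
  apply/andP; split; rewrite ltNge; apply/negP => hw.
    have [|v Cv] := connected_IVT (c := pi) cC ci Cw Cz.
      by rewrite hw; lra.
    by apply/eqP; case: (avoid _ Cv).
  have [|v Cv] := connected_IVT (c := 2 * pi) cC ci Cz Cw.
    by rewrite hw; lra.
  by apply/eqP; case: (avoid _ Cv).
split => //; case: (pospre_real_or (CP _ Cw)) => // h.
by move: hw; rewrite h mulr0; lra.
Qed.

Lemma sinc_neq0_mid y : pi < y < 2 * pi -> sinc y != 0.
Proof.
move=> h; have p0 := @pi_gt0 R; rewrite lt_eqF//; apply: sinc_lt0.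
by rewrite gtr0_norm//; lra.
Qed.

Lemma zset_connected s : s = 1 \/ s = -1 -> connected (zset s).
Proof.
move=> hs; have p0 := @pi_gt0 R.
have ss : s * s = 1 by case: hs => ->; lra.
pose f y := mkC (1 - a - cos y / sinc y) (s * y).
have -> : zset s = f @` `]pi, 2 * pi[.
  apply/seteqP; split => [z [h1 h2]|_ [y + <-]].
    exists (s * im z); first by rewrite /= in_itv.
    apply: eq_reim => /=; last by rewrite mulrA ss mul1r.
    have h3 := sinc_neq0_mid h1; apply: (mulIf h3); rewrite mulrBl divfK//.
    have : qfun (re z) (s * im z) = 0.
      by rewrite -h2 /Qfun; case: hs => ->; rewrite ?mul1r// mulN1r qfunN.
    rewrite /qfun; lra.
  rewrite /= in_itv /= => h; split => /=; first by rewrite mulrA ss mul1r.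
  have -> : Qfun (f y) = qfun (1 - a - cos y / sinc y) y.
    by rewrite /Qfun /=; case: hs => ->; rewrite ?mul1r// mulN1r qfunN.
  have ns := sinc_neq0_mid h; rewrite /qfun; field; exact: ns.
apply: connected_im_itv => y; rewrite inE /= in_itv /= => h.
apply: (cvg_mkC (nbhs_filter y)); last by apply: cvgMr; exact: cvg_id.
apply: cvgB; first exact: cvg_cst.
apply: cvgM; first exact: continuous_cos.
by apply: cvgV; [exact: sinc_neq0_mid|exact: continuous_sinc].
Qed.

Lemma zeta_exists x : exists y, pi < y < 2 * pi /\ qfun x y = 0.
Proof.
have p0 := @pi_gt0 R.
have [|||y] := @IVT R (qfun x) pi (2 * pi) 0.
- lra.
- apply: continuous_subspaceT => y; apply: cvgD; last exact: continuous_cos.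
  by apply: cvgMr; exact: continuous_sinc.
- have h : (-1 : R) <= 1 by lra.
  by rewrite qfunpi qfun2pi min_l// max_r// lerN10 ler01.
rewrite in_itv /= => /andP[h1 h2] h3; exists y; split => //.
rewrite !lt_neqAle h1 h2 !andbT; apply/andP; split; apply/eqP => h.
  by move: h3; rewrite -h qfunpi; lra.
by move: h3; rewrite h qfun2pi; lra.
Qed.

Definition zeta x : R := xget 0 [set y | pi < y < 2 * pi /\ qfun x y = 0].

Lemma zetaP x : pi < zeta x < 2 * pi /\ qfun x (zeta x) = 0.
Proof. by rewrite /zeta; case: xgetP => // h; have [y hy] := zeta_exists x;
  case: (h y). Qed.

Lemma zeta_gt x y : pi < y < 2 * pi -> (y < zeta x) = (qfun x y < 0).
Proof.
move=> hy; have [hz q0] := zetaP x; apply/idP/idP => h.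
  by apply: (@qfun_down2 _ _ _ (zeta x)); rewrite ?q0//; lra.
rewrite ltNge le_eqVlt; apply/negP => /orP[/eqP h'|h'].
  by move: h; rewrite -h' q0 ltxx.
have : qfun x (zeta x) < 0 by apply: (@qfun_down2 _ _ _ y); rewrite ?(ltW h)//;
  lra.
by rewrite q0 ltxx.
Qed.

Lemma zeta_lt x y : pi < y < 2 * pi -> (zeta x < y) = (0 < qfun x y).
Proof.
move=> hy; have [hz q0] := zetaP x.
have [h|h|h] := ltgtP (zeta x) y.
- apply/esym; rewrite ltNge le_eqVlt -zeta_gt// negb_or -leNgt (ltW h) andbT.
  apply/eqP => h'; have : qfun x (zeta x) < 0.
    by apply: (@qfun_down2 _ _ _ y); rewrite ?h'//; lra.
  by rewrite q0 ltxx.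
- by apply/esym/negbTE; rewrite -leNgt ltW// -zeta_gt.
- by rewrite -h q0 ltxx.
Qed.

Lemma zeta_homo : {homo zeta : x y / x < y}.
Proof.
move=> x x' xx'; have [h q0] := zetaP x.
rewrite zeta_gt// -q0 qfun_decr_x// gtr0_norm//.
by have := @pi_gt0 R; lra.
Qed.

Lemma zeta_pinfty : zeta x @[x --> +oo] --> (2 * pi : R).
Proof.
have p0 := @pi_gt0 R.
apply/cvgrPdist_lt => e e0.
have [y hy ye] : exists2 y, pi < y < 2 * pi & 2 * pi - e < y.
  have [h|h] := leP pi e; first by exists (3 / 2 * pi); lra.
  by exists (2 * pi - e / 2); lra.
have ns := sinc_neq0_mid hy.
exists (1 - a - cos y / sinc y); split; first exact: num_real.
move=> x hx; have [h q0] := zetaP x.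
have : y < zeta x.
  rewrite zeta_gt//.
  have -> : 0 = qfun (1 - a - cos y / sinc y) y by rewrite /qfun; field;
    exact: ns.
  by rewrite qfun_decr_x// gtr0_norm//; lra.
by move=> h'; rewrite ltr_norml; lra.
Qed.

Lemma zeta_ninfty : zeta x @[x --> -oo] --> (pi : R).
Proof.
have p0 := @pi_gt0 R.
apply/cvgrPdist_lt => e e0.
have [y hy ye] : exists2 y, pi < y < 2 * pi & y < pi + e.
  have [h|h] := leP pi e; first by exists (3 / 2 * pi); lra.
  by exists (pi + e / 2); lra.
have ns := sinc_neq0_mid hy.
exists (1 - a - cos y / sinc y); split; first exact: num_real.
move=> x hx; have [h q0] := zetaP x.
have : zeta x < y.
  rewrite zeta_lt//.
  have -> : 0 = qfun (1 - a - cos y / sinc y) y by rewrite /qfun; field;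
    exact: ns.
  by rewrite qfun_decr_x// gtr0_norm//; lra.
by move=> h'; rewrite ltr_norml; lra.
Qed.

Lemma graph_zeta s : s = 1 \/ s = -1 -> graph_of (fun x => s * zeta x) = zset s.
Proof.
move=> hs; have ss : s * s = 1 by case: hs => ->; lra.
apply/seteqP; split => z.
  move=> h; rewrite /graph_of /= in h.
  have [h1 h2] := zetaP (re z).
  have h3 : s * im z = zeta (re z) by rewrite h mulrA ss mul1r.
  split; first by rewrite h3.
  by rewrite -h2 -h3 /Qfun; case: hs => ->; rewrite ?mul1r// mulN1r qfunN.
move=> [h1 h2]; rewrite /graph_of /=.
have h3 : qfun (re z) (s * im z) = 0.
  by rewrite -h2 /Qfun; case: hs => ->; rewrite ?mul1r// mulN1r qfunN.
suff -> : zeta (re z) = s * im z by rewrite mulrA ss mul1r.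
apply/eqP; rewrite eq_le !leNgt zeta_gt// zeta_lt// h3 ltxx.
by [].
Qed.

Lemma zset_component s : s = 1 \/ s = -1 -> is_component pospre (zset s).
Proof.
move=> hs.
have : zset s (mkC 0 (s * zeta 0)) by rewrite -(graph_zeta hs); exact: erefl.
set z0 := mkC _ _ => h0; exists z0; first exact: (zset_pospre hs).
apply/seteqP; split.
  by apply: connected_component_max => //;
    [exact: (zset_pospre hs)|exact: (zset_connected hs)].
apply: (@pospre_connected_zset s _ z0 hs (@component_connected _ pospre z0)).
- exact: connected_component_sub.
- by apply: connected_component_refl; exact: (zset_pospre hs).
- by case: h0.
Qed.

(** The two limits force the graph to cross the line [s * im z = 3 pi / 2],
    which places it in the band of [zset s]; two graphs of total functions
    that are included in one another coincide. *)
Lemma is_zeta_sub s (h : R -> R) : s = 1 \/ s = -1 ->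
  is_component pospre (graph_of h) ->
  h x @[x --> -oo] --> s * pi -> h x @[x --> +oo] --> s * (2 * pi) ->
  graph_of h = zset s.
Proof.
move=> hs [x0 _ hc] hn hp; have p0 := @pi_gt0 R.
have ss : s * s = 1 by case: hs => ->; lra.
have hns (r : R) : `|s * r| = `|r| by case: hs => ->;
  rewrite ?mul1r// mulN1r normrN.
have cg : connected (graph_of h) by rewrite hc; exact: component_connected.
have gP : graph_of h `<=` pospre by rewrite hc; exact: connected_component_sub.
have p4 : 0 < pi / 4 :> R by lra.
have ap (F : set_system R) (FF : ProperFilter F) (l : R) :
    h x @[x --> F] --> s * l -> exists x, `|l - s * h x| < pi / 4.
  move=> /cvgrPdist_lt /(_ _ p4) /filter_ex[x hx]; exists x.
  by rewrite -hns mulrBr mulrA ss mul1r.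
have [x1 h1] := ap _ _ _ hn; have [x2 h2] := ap _ _ _ hp.
have ci : continuous (fun z : CC R => s * im z).
  by move=> v; have FF := nbhs_filter v;
    exact: (cvgM (cvg_cst s) (@continuous_im R v)).
have [z gz hz] : exists2 z, graph_of h z & s * im z = 3 / 2 * pi.
  apply: (@connected_IVT R _ (fun z => s * im z) (mkC x1 (h x1))
    (mkC x2 (h x2))) => //=.
  by move: h1 h2; rewrite !ltr_norml => /andP[? ?] /andP[? ?]; apply/andP;
    split; lra.
have sub : graph_of h `<=` zset s.
  by apply: (pospre_connected_zset hs cg gP gz); rewrite hz; lra.
apply/seteqP; split => // w zw.
have /sub := (erefl : graph_of h (mkC (re w) (h (re w)))).
rewrite -graph_zeta// /graph_of /= => ->.
by move: zw; rewrite -graph_zeta// /graph_of /=.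
Qed.

Lemma zeta_curve1 : zeta_curve a 1 = zset 1.
Proof.
have e1 : (Num.sg (1 : int))%:~R * (2 * `|1 : int|%:~R - 1) * pi = 1 * pi :> R.
  rewrite normr1 sgr1; have -> : 1%:~R = 1 :> R by [].
  lra.
have e2 : 2 * (1 : int)%:~R * pi = 1 * (2 * pi) :> R.
  by have -> : 1%:~R = 1 :> R by []; lra.
have h1 : 1 = 1 :> R \/ 1 = -1 :> R by left.
apply/seteqP; split => z.
  move=> [h [_ hc h2 h3] gz]; rewrite -(@is_zeta_sub 1 h)//.
    by rewrite -e1.
  by rewrite -e2.
move=> hz; exists (fun x => 1 * zeta x); last by rewrite graph_zeta.
split.
- by left => x y h; rewrite !mul1r; exact: zeta_homo.
- by rewrite graph_zeta//; apply: zset_component.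
- by rewrite e1; apply: cvgMr; exact: zeta_ninfty.
- by rewrite e2; apply: cvgMr; exact: zeta_pinfty.
Qed.

Lemma zeta_curveN1 : zeta_curve a (-1) = zset (-1).
Proof.
have e1 : (Num.sg (-1 : int))%:~R * (2 * `|-1 : int|%:~R - 1) * pi =
  -1 * pi :> R.
  rewrite normrN1 mulr1; have -> : Num.sg (-1 : int) = -1 by [].
  by rewrite mulrN1z; lra.
have e2 : 2 * (-1 : int)%:~R * pi = -1 * (2 * pi) :> R by rewrite mulrN1z; lra.
apply/seteqP; split => z.
  move=> [h [_ h1 h2 h3] gz]; rewrite -(@is_zeta_sub (-1) h)//; first by right.
    by rewrite -e1.
  by rewrite -e2.
move=> hz; exists (fun x => -1 * zeta x); last first.
  by rewrite graph_zeta//; right.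
split.
- by right => x y h; rewrite !mulN1r ltrN2; exact: zeta_homo.
- by rewrite graph_zeta; [apply: zset_component|]; right.
- by rewrite e1; apply: cvgMr; exact: zeta_ninfty.
- by rewrite e2; apply: cvgMr; exact: zeta_pinfty.
Qed.

Lemma zset_curve1 : zset 1 `|` zset (-1) = curve1 a.
Proof.
have p0 := @pi_gt0 R.
apply/seteqP; split => z.
  move=> [[h1 h2]|[h1 h2]]; split => //.
    by rewrite -(sgnP (s := 1) (or_introl erefl))//; lra.
  by rewrite -(sgnP (s := -1) (or_intror erefl))//; lra.
move=> [h1 h2]; have [h|h] := leP 0 (im z).
  by left; split; rewrite // mul1r -[im z]ger0_norm.
by right; split; rewrite // mulN1r -[- im z]ger0_norm ?normrN// oppr_ge0 ltW.
Qed.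

End ZetaCurves.

(** * The strip and the domains T0 and T1 *)

Section Ident.
Variables (R : realType) (a : R).
Hypothesis ha : 3 <= a.
Implicit Types (x y s : R) (z w : CC R).
Notation Qfun := (Qfun a).
Notation qfun := (qfun a).

Lemma QfunE z : Qfun z = qfun (re z) `|im z|.
Proof. by rewrite /Qfun qfun_norm. Qed.

Lemma between0 y t : Num.min y 0 <= t <= Num.max y 0 -> `|t| <= `|y|.
Proof.
rewrite minEle maxEle; case: (leP y 0) => h /andP[h1 h2]; rewrite ler_norml.
  by rewrite (ler0_norm h); apply/andP; split; lra.
by rewrite (gtr0_norm h); apply/andP; split; lra.
Qed.

(** Vertical segments lead to the real axis. *)
Lemma connected_regS : connected (regS a).
Proof.
have p0 := @pi_gt0 R.
apply: (@connected_by _ _ (mkC 0 0)) => z hz.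
apply: connected_component_sym.
apply: (@connected_component_trans _ _ (mkC (re z) 0)); last first.
  by apply: component_hsegment => t _; left => /=; rewrite normr0.
rewrite {1}(mkC_reim z); apply: component_vsegment => t ht.
have tz : `|t| <= `|im z|.
  exact: between0.
case: hz => [hz|[hz q0]]; first by left => /=; lra.
have [tpi|tpi] := ltP `|t| pi; first by left.
right; split => /=; first lra.
rewrite QfunE /=; move: tz; rewrite le_eqVlt => /predU1P[->|tz]; first
  by rewrite -QfunE.
apply: (@qfun_down2 _ _ _ `|im z|); rewrite ?tpi ?tz// -QfunE.
exact: ltW.
Qed.

Lemma connected_reg0 : connected (reg0 a).
Proof.
have p0 := @pi_gt0 R; have a0 := ha.
apply: (@connected_by _ _ (mkC 0 0)) => z [hz q0].
have zr : forall t, `|t| <= `|im z| -> reg0 a (mkC (re z) t).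
  move=> t tz; split => /=; first lra.
  rewrite QfunE /=; move: tz; rewrite le_eqVlt => /predU1P[->|tz]; first
    by rewrite -QfunE.
  by apply: (@qfun_down _ _ _ `|im z|); rewrite ?normr_ge0 ?tz// -QfunE ltW.
apply: connected_component_sym.
apply: (@connected_component_trans _ _ (mkC (re z) 0)); last first.
  apply: component_hsegment => t ht; split => /=; first by rewrite normr0.
  have [|_] := zr 0; first by rewrite normr0.
  rewrite /Qfun /= !qfun0 => h.
  by move: ht; rewrite minEle; case: (leP (re z) 0) => _ /andP[h1 h2]; lra.
rewrite {1}(mkC_reim z); apply: component_vsegment => t ht; apply: zr.
exact: between0.
Qed.

(** Contrapositive of [qfun_down]: on a vertical half-line the set where
    [qfun] is negative is closed upwards until the line [im z = pi]. *)
Lemma qfun_up x y y' : 0 <= y -> qfun x y < 0 -> y <= y' <= pi -> qfun x y' < 0.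
Proof.
move=> y0 q0 /andP[]; rewrite le_eqVlt => /predU1P[<-//|yy'].
rewrite le_eqVlt => /predU1P[->|y'pi]; first by rewrite qfunpi; lra.
rewrite ltNge; apply/negP => /(@qfun_down _ _ _ y' y); rewrite y0 yy' =>
  /(_ isT y'pi).
lra.
Qed.

(** Vertical segments lead to one of the lines [|im z| = pi], on which
    [qfun] is -1; the vertical line through [- a - 1] joins these two. *)
Lemma connected_reg1 : connected (reg1 a).
Proof.
have p0 := @pi_gt0 R; have a0 := ha.
apply: (@connected_by _ _ (mkC (- a - 1) 0)) => z [hz q0].
apply: connected_component_sym.
have [s [hs sz]] : exists s, (s = 1 \/ s = -1) /\ im z = s * `|im z|.
  have [h|h] := leP 0 (im z); [exists 1|exists (-1)]; split; try
    by [left|right].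
    by rewrite mul1r ger0_norm.
  by rewrite ltr0_norm// mulN1r opprK.
have ns (r : R) : `|s * r| = `|r| by case: hs => ->;
  rewrite ?mul1r// mulN1r normrN.
have npi : `|pi| = pi :> R by rewrite gtr0_norm.
have vert x y1 y2 : 0 <= y1 <= y2 -> (forall t, y1 <= t <= y2 ->
  reg1 a (mkC x t)) ->
    connected_component (reg1 a) (mkC x (s * y1)) (mkC x (s * y2)).
  move=> /andP[y10 y12] H; apply: component_vsegment => t ht.
  have {}H t' : y1 <= `|t'| <= y2 -> reg1 a (mkC x t').
    move=> /H [/= h1 h2]; split; first by move: h1; rewrite normr_id.
    by move: h2; rewrite !QfunE /= normr_id.
  apply: H; move: ht; case: hs => ->; rewrite ?mul1r ?mulN1r.
    by rewrite min_l// max_r// => /andP[h1 h2]; rewrite ger0_norm ?h1//; lra.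
  rewrite min_r ?max_l ?lerN2// => /andP[h1 h2]; rewrite ler0_norm; last lra.
  by apply/andP; split; lra.
apply: (@connected_component_trans _ _ (mkC (re z) (s * pi))).
  rewrite {1}(mkC_reim z) sz.
  have [h|h] := leP `|im z| pi.
    apply: vert => [|t ht]; first by rewrite normr_ge0.
    have t0 : 0 <= t by have := normr_ge0 (im z); lra.
    split; rewrite /= ?QfunE /= ger0_norm//; first lra.
    by apply: (@qfun_up _ `|im z|); rewrite ?normr_ge0 -?QfunE.
  apply: connected_component_sym; apply: vert => [|t ht]; first lra.
  have t0 : 0 <= t by lra.
  split; rewrite /= ?QfunE /= ger0_norm//; first lra.
  move: ht => /andP[ht1]; rewrite le_eqVlt => /predU1P[->|ht2]; first
    by rewrite -QfunE.
  by apply: (@qfun_down2 _ _ _ `|im z|); rewrite ?ht1 ?ht2// -QfunE ltW.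
apply: (@connected_component_trans _ _ (mkC (- a - 1) (s * pi))).
  apply: component_hsegment => t _; split;
    rewrite /= ?QfunE/= ns npi ?qfunpi//; lra.
apply: connected_component_sym.
have {1}-> : 0 = s * 0 :> R by rewrite mulr0.
apply: vert => [|t ht]; first lra.
have t0 : 0 <= t by lra.
split; rewrite /= ?QfunE/= ger0_norm//; first lra.
by apply: (@qfun_up _ 0); rewrite ?qfun0//; lra.
Qed.

(** With [v = z + a] this is [(1 - v) e^v <= 1]. *)
Lemma re_fa_real z : im z = 0 -> - a <= re (fa a z) ?= iff (z == - a%:C).
Proof.
move=> y0; have a0 := ha.
rewrite re_fa y0 cos0 mulr1 mul0r subr0 /efun.
have -> : (z == - a%:C) = (re z + a == 0).
  rewrite eq_complex /= y0 oppr0 eqxx andbT.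
  by rewrite addr_eq0.
set v := re z + a.
have h1 := expRxMexpNx_1 v; have h2 := expR_gt0 v.
have h3 : (- v != 0) -> (1 - v) * expR v < 1.
  by move=> /expR_gt1Dx; nra.
split.
  have [->|h] := eqVneq v 0; first by rewrite expR0; lra.
  by have := h3 ltac:(by rewrite oppr_eq0); nra.
apply/eqP/eqP => [h|->]; last by rewrite expR0; lra.
by apply/eqP/negPn/negP; rewrite -oppr_eq0 => /h3; nra.
Qed.

(** Here [re z + a > 0], and [0 < sinc < 1]. *)
Lemma re_fa_eta z : Qfun z = 0 -> im z != 0 -> `|im z| < pi ->
  re (fa a z) < - a.
Proof.
move=> q0 y0 ypi; have a0 := ha.
have h := re_fa_curve q0 y0.
have yp : 0 < `|im z| by rewrite normr_gt0.
have xa : 0 < re z + a.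
  by rewrite -(qfun0 a); apply: (@qfun_down _ _ _ `|im z|);
    rewrite ?lexx ?yp// -QfunE q0.
have s0 := sinc_gt0 ypi.
have s1 : sinc (im z) < 1.
  by rewrite -sinc_norm /sinc gt_eqF// ltr_pdivrMr// mul1r sin_lt_id.
have e1 : 1 < expR (re z + a) by rewrite expR_gt1.
rewrite /efun in h.
rewrite -(ltr_pM2l s0) h; nra.
Qed.

Lemma curve_split : strip a = regS a -> eta_curves a `|` [set - a%:C] =
  curve0 a.
Proof.
move=> hS; have p0 := @pi_gt0 R; have a0 := ha.
rewrite /eta_curves hS {hS}; apply/seteqP; split => z.
  move=> [[Sz /real_subsetP[fi]]|->]; last first.
    by split; rewrite /= ?oppr0 ?normr0// QfunE /= oppr0 normr0 qfun0; lra.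
  rewrite /= in_itv /= => fr.
  have y0 : im z != 0.
    by apply/eqP => /re_fa_real[h _]; lra.
  have q0 : Qfun z = 0.
    move/eqP: fi; rewrite im_faQ mulf_eq0 gt_eqF ?(efun_gt0 ha)//= mulf_eq0
      (negbTE y0).
    by move/eqP.
  by case: Sz => [//|[_]]; rewrite q0 ltxx.
move=> [h1 h2]; have [h|h] := eqVneq (im z) 0; [right|left].
  move: h2; rewrite QfunE h normr0 qfun0 => h2.
  by apply: eq_reim => /=; rewrite ?h ?oppr0//; lra.
split; first by left.
apply/real_subsetP; split; first by rewrite im_faQ h2 !mulr0.
by rewrite /= in_itv /=; exact: re_fa_eta.
Qed.

Lemma zeta_curves : zeta_curve a 1 `|` zeta_curve a (-1) = curve1 a.
Proof. by rewrite zeta_curve1// zeta_curveN1// zset_curve1. Qed.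

Lemma curve1_pt s : s = 1 \/ s = -1 -> curve1 a (mkC 0 (s * zeta a 0)).
Proof.
move=> hs; have : zset a s (mkC 0 (s * zeta a 0)).
  by rewrite -(graph_zeta a hs); exact: erefl.
by rewrite -zset_curve1; case: hs => ->; [left|right].
Qed.

Lemma bounded_regS : bounded_by (curve1 a) (regS a).
Proof. split; [exact: open_regS|exact: connected_regS|exact: frontier_regS].
  Qed.
Lemma bounded_reg0 : bounded_by (curve0 a) (reg0 a).
Proof. split; [exact: open_reg0|exact: connected_reg0|exact: frontier_reg0].
  Qed.
Lemma bounded_reg1 : bounded_by (curve0 a `|` curve1 a) (reg1 a).
Proof. split; [exact: open_reg1|exact: connected_reg1|exact: frontier_reg1].
  Qed.

(** A second domain with the same frontier would be disjoint from [regS],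
    hence from the real axis. It would lie in one half-plane, and its
    closure would miss one of the two curves. *)
Lemma stripE : strip a = regS a.
Proof.
have p0 := @pi_gt0 R.
rewrite /strip zeta_curves; apply/seteqP; split => [z [U bU Uz]|z Sz];
  last first.
  by exists (regS a) => //; exact: bounded_regS.
have [[w [Uw Sw]]|nU] := pselect (exists w, U w /\ regS a w).
  by rewrite -(bounded_by_unique bU bounded_regS Uw Sw).
exfalso.
have im0 w : U w -> im w != 0.
  by move=> Uw; apply/eqP => h; apply: nU; exists w; split => //; left;
    rewrite h normr0.
case: bU => oU cU fU.
have cl s : s = 1 \/ s = -1 -> closure U (mkC 0 (s * zeta a 0)).
  by move=> /curve1_pt; rewrite -fU => -[].
clear fU.
have zp := (zetaP a 0).1.
have [h|h] := ltP 0 (im z).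
  have /= := closure_sub (closed_comp (fun z _ => @continuous_im R z)
    (@closed_ge R 0))
    _ (cl (-1) (or_intror erefl)).
  rewrite mulN1r => H; suff : 0 <= - zeta a 0 by lra.
  apply: H => w Uw /=; rewrite leNgt; apply/negP => hw.
  have [|v Uv] := connected_IVT (c := 0) cU (@continuous_im R) Uw Uz; first lra.
  by apply/eqP; exact: im0.
have /= := closure_sub (closed_comp (fun z _ => @continuous_im R z)
  (@closed_le R 0))
    _ (cl 1 (or_introl erefl)).
rewrite mul1r => H; suff : zeta a 0 <= 0 by lra.
apply: H => w Uw /=; rewrite leNgt; apply/negP => hw.
have [|v Uv] := connected_IVT (c := 0) cU (@continuous_im R) Uz Uw; first lra.
by apply/eqP; exact: im0.
Qed.

Lemma T0E : T0 a = reg0 a.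
Proof.
have p0 := @pi_gt0 R; have a0 := ha.
have z0 : reg0 a 0 by split; rewrite /= ?normr0// QfunE /= normr0 qfun0; lra.
rewrite /T0 (curve_split stripE); apply/seteqP; split =>
  [z [U [bU U0] Uz]|z Sz].
  by rewrite -(bounded_by_unique bU bounded_reg0 U0 z0).
by exists (reg0 a) => //; split => //; exact: bounded_reg0.
Qed.

(** A second domain would avoid the lines [|im z| = pi], which lie in
    [reg1]; its closure would miss either [- a] or the curves zeta. *)
Lemma T1E : T1 a = reg1 a.
Proof.
have p0 := @pi_gt0 R; have a0 := ha.
have -> : T1 a = \bigcup_(U in bounded_by (curve0 a `|` curve1 a)) U.
  rewrite /T1 -(setUA (zeta_curve a (-1))) (curve_split stripE).
  by rewrite (setUC (zeta_curve a (-1))) -setUA (setUC (zeta_curve a (-1)))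
    zeta_curves.
apply/seteqP; split => [z [U bU Uz]|z Sz]; last first.
  by exists (reg1 a) => //; exact: bounded_reg1.
have [[w [Uw Sw]]|nU] := pselect (exists w, U w /\ reg1 a w).
  by rewrite -(bounded_by_unique bU bounded_reg1 Uw Sw).
exfalso.
have im0 w : U w -> `|im w| != pi.
  move=> Uw; apply/eqP => h; apply: nU; exists w; split => //; split; first lra.
  by rewrite (Q_pi a h); lra.
case: bU => oU cU fU.
have zp := (zetaP a 0).1.
have c1 : closure U (- a%:C).
  suff : frontier U (- a%:C) by case.
  by rewrite fU {fU}; left; split; rewrite /= ?QfunE /= ?oppr0 normr0 ?qfun0//;
    lra.
have c0 : closure U (mkC 0 (1 * zeta a 0)).
  suff : frontier U (mkC 0 (1 * zeta a 0)) by case.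
  by rewrite fU; right; apply: curve1_pt; left.
clear fU; have [h|h] := ltP pi `|im z|.
  have /= := closure_sub (closed_comp (fun z _ => @continuous_absim R z)
    (@closed_ge R pi))
    _ c1.
  rewrite oppr0 normr0 => H; suff : pi <= 0 :> R by lra.
  apply: H => w Uw /=; rewrite leNgt; apply/negP => hw.
  have [|v Uv] := connected_IVT (c := pi) cU (@continuous_absim R) Uw Uz;
    first lra.
  by apply/eqP; exact: im0.
have /= := closure_sub (closed_comp (fun z _ => @continuous_absim R z)
  (@closed_le R pi))
    _ c0.
rewrite mul1r gtr0_norm; last lra.
move=> H; suff : zeta a 0 <= pi by lra.
apply: H => w Uw /=; rewrite leNgt; apply/negP => hw.
have [|v Uv] := connected_IVT (c := pi) cU (@continuous_absim R) Uz Uw;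
  first lra.
by apply/eqP; exact: im0.
Qed.

End Ident.

(** * Arguments and moduli *)

Section Polar.
Variable R : realType.
Implicit Types (x y p W : R) (z w : CC R).

Lemma polar_coordinates w : im w != 0 -> exists r p : R,
  [/\ 0 < r, 0 < p < 2 * pi, re w = r * cos p, im w = r * sin p
    & (0 < im w -> p < pi) /\ (im w < 0 -> pi < p)].
Proof.
move=> w0; have p0 := @pi_gt0 R.
pose r := Num.sqrt (nsq w).
have n0 : 0 < nsq w by rewrite /nsq ltr_wpDl ?sqr_ge0// exprn_even_gt0.
have r0 : 0 < r by rewrite sqrtr_gt0.
have r2 : r ^+ 2 = re w ^+ 2 + im w ^+ 2 by rewrite sqr_sqrtr ?ltW.
pose c := re w / r.
have im2 : 0 < im w ^+ 2 by rewrite exprn_even_gt0.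
have c1 : -1 < c < 1.
  have : c ^+ 2 < 1.
    by rewrite /c expr_div_n ltr_pdivrMr ?exprn_gt0// mul1r r2 ltrDl.
  by rewrite -[X in _ < X -> _](expr1n _ 2) -(real_normK (num_real c)) ltr_pXn2r
    ?nnegrE// ltr_norml.
have cle : -1 <= c <= 1 by lra.
have cc : cos (acos c) = c by rewrite acosK// in_itv.
have a0 : 0 < acos c by apply: acos_gt0; lra.
have a1 : acos c < pi by apply: acos_ltpi; lra.
have ss : sin (acos c) = `|im w| / r.
  rewrite sin_acos//.
  have -> : 1 - c ^+ 2 = (im w / r) ^+ 2.
    rewrite /c; apply: (mulIf (lt0r_neq0 (exprn_gt0 2 r0))).
    rewrite -exprMn divfK ?gt_eqF// mulrBl -exprMn divfK ?gt_eqF// r2; ring.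
  by rewrite sqrtr_sqr normrM normfV (gtr0_norm r0).
have [h|h] := ltP 0 (im w).
  exists r, (acos c); split => //; first lra.
  - by rewrite cc /c mulrC divfK// gt_eqF.
  - by rewrite ss gtr0_norm// mulrC divfK// gt_eqF.
  - by split => // h'; lra.
have {}h : im w < 0 by rewrite lt_neqAle w0.
have e : 2 * pi - acos c = - acos c + pi *+ 2 by rewrite mulr_natl addrC.
exists r, (2 * pi - acos c); split => //; first lra.
- by rewrite e cosD2pi cosN cc /c mulrC divfK// gt_eqF.
- by rewrite e sinD2pi sinN ss ltr0_norm// mulNr opprK mulrC divfK// gt_eqF.
- by split => h'; lra.
Qed.

Lemma sin_pos_range (d : R) : - pi < d < 2 * pi -> 0 < sin d -> 0 < d < pi.
Proof.
move=> /andP[h1 h2] s0; have p0 := @pi_gt0 R.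
apply/andP; split; rewrite ltNge; apply/negP => h.
  by have := @sin_ge0_pi R (- d); rewrite sinN; lra.
have e : sin d = - sin (d - pi) by rewrite -{1}(subrK pi d) sinDpi.
by have := @sin_ge0_pi R (d - pi); lra.
Qed.

Lemma polar_mod0 p : polar_mod p 0 = 0.
Proof. by rewrite /polar_mod !mul0r. Qed.

Lemma polar_mod_cont p y : sin (p - y) != 0 -> {for y,
  continuous (polar_mod p)}.
Proof.
move=> s0.
have h : (fun t => p - t) @ y --> p - y by apply: cvgB;
  [exact: cvg_cst|exact: cvg_id].
have hs := cvg_comp _ _ h (@continuous_sin R _).
have hc := cvg_comp _ _ h (@continuous_cos R _).
have hi : (fun t => (sin (p - t))^-1) @ y --> (sin (p - y))^-1 by apply: cvgV.
apply: cvgM; first by apply: cvgM => //; exact: cvg_id.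
have hm : (fun t => t * cos (p - t) / sin (p - t)) @ y --> y * cos (p - y)
  / sin (p - y).
  by apply: cvgM => //; apply: cvgM => //; exact: cvg_id.
exact: (cvg_comp _ _ hm (@continuous_expR R _)).
Qed.

Lemma polar_mod_big p W : 0 < p -> 0 < W -> exists d, [/\ 0 < d <= 1, d < p &
  W <= polar_mod p (p - d)].
Proof.
move=> p0 W0; exists (Num.min 1 (Num.min (p / 2) (p / (2 * W)))).
set d := Num.min _ _.
have d0 : 0 < d by rewrite !lt_min ltr01 !divr_gt0// mulr_gt0.
have [d1 [d2 d3]] : d <= 1 /\ (d <= p / 2 /\ d <= p / (2 * W)).
  by rewrite /d !ge_min !lexx /= !orbT.
split; [by rewrite d0|lra|].
have pi2 := @pihalf_ge1 R; have p2 := @pi_ge2 R.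
have s0 : 0 < sin d by apply: sin2_gt0; lra.
have sd := sin_lt_id d0.
have c0 : 0 <= cos d by apply: cos_ge0_pihalf; lra.
rewrite /polar_mod; have -> : p - (p - d) = d by lra.
have h1 : 1 <= expR ((p - d) * cos d / sin d).
  rewrite -expR0 ler_expR; apply: divr_ge0; last exact: ltW.
  by apply: mulr_ge0 => //; lra.
have h2 : W <= (p - d) / sin d.
  rewrite ler_pdivlMr//.
  have h3 : W * sin d <= W * d by rewrite ler_pM2l// ltW.
  have h4 : W * d <= p / 2.
    move: d3; rewrite ler_pdivlMr ?mulr_gt0//; lra.
  lra.
rewrite -[W]mulr1; apply: ler_pM => //; exact: ltW.
Qed.

Lemma polar_mod_small p W : pi < p < 2 * pi -> 0 < W -> exists d,
  0 < d <= 1 /\ polar_mod p (p - pi + d) <= W.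
Proof.
move=> hp W0; have p2 := @pi_ge2 R.
pose y0 := p - pi; have y00 : 0 < y0 by rewrite /y0; lra.
exists (Num.min 1 (y0 * W / 8)).
set d := Num.min _ _.
have d0 : 0 < d by rewrite !lt_min ltr01 !divr_gt0// mulr_gt0.
have [d1 d3] : d <= 1 /\ d <= y0 * W / 8 by rewrite /d !ge_min !lexx /= !orbT.
split; first by rewrite d0.
have s0 : 0 < sin d by apply: sin2_gt0; lra.
have sd := sin_lt_id d0.
have c0 : 1 / 2 <= cos d by have := one_sub_cos_le d; nra.
rewrite /polar_mod.
have -> : p - (p - pi + d) = - d + pi by lra.
rewrite sinDpi cosDpi sinN cosN opprK -/y0.
set X := (y0 + d) / sin d.
have X0 : 0 < X by rewrite divr_gt0//; lra.
have -> : (y0 + d) * - cos d / sin d = - (X * cos d) by rewrite /X; ring.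
have h1 : expR (- (X * cos d)) <= expR (- (X / 2)) by rewrite ler_expR lerN2;
  nra.
(* hence [X * expR (- X / 2) <= 8 / X], which is at most [W]
  by the choice of [d] *)
have h2 : X ^+ 2 / 8 <= expR (X / 2).
  have := @expR_ge1Dxn R (X / 2) 1; rewrite expr_div_n => /(_ ltac:(lra)).
  have -> : (2`!)%:R = 2 :> R by []; lra.
have h3 : 8 <= X * W.
  rewrite /X mulrAC ler_pdivlMr//.
  have : 8 * d <= y0 * W by lra.
  have : 0 <= d * W by rewrite mulr_ge0 ?ltW.
  lra.
apply: (@le_trans _ _ (X * expR (- (X / 2)))); first by rewrite ler_pM2l.
rewrite expRN ler_pdivrMr ?expR_gt0//.
apply: (@le_trans _ _ (W * (X ^+ 2 / 8))); last by rewrite ler_pM2l.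
have : 0 <= (X * W - 8) * X by rewrite mulr_ge0 ?subr_ge0// ltW.
lra.
Qed.

(** Intermediate values between a point where the modulus is large ([p - y]
    near 0) and one where it is small ([y = 0] or [p - y] near [pi]). *)
Lemma polar_mod_surj p W : 0 < p < 2 * pi -> p != pi -> 0 < W ->
  exists y, [/\ 0 < y < p, 0 < sin (p - y) & polar_mod p y = W].
Proof.
move=> /andP[p0 p2pi] ppi W0; have pi2 := @pi_ge2 R.
have [d [d0 dp hd]] := polar_mod_big p0 W0.
suff [lo [lo0 lod slo hlo]] : exists lo, [/\ 0 <= lo, lo <= p - d, p - lo < pi
    & polar_mod p lo <= W].
  have sp t : lo <= t <= p - d -> 0 < sin (p - t).
    by move=> ht; apply: sin_gt0_pi; lra.
  have [||y + hy] := @IVT R (polar_mod p) lo (p - d) W lod.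
  - apply: continuous_in_subspaceT => t; rewrite inE /= in_itv /= => ht.
    by apply: polar_mod_cont; rewrite gt_eqF// sp.
  - rewrite min_l ?max_r ?hlo//; exact: (le_trans hlo).
  rewrite in_itv /= => hy2; exists y; split => //; last exact: sp.
  have y0 : y != 0 by apply/eqP => y0; move: hy; rewrite y0 polar_mod0; lra.
  by rewrite lt_def y0 /=; lra.
have [h|h|/eqP] := ltgtP p pi; last by rewrite (negbTE ppi).
  by exists 0; split; rewrite ?polar_mod0 ?subr0; lra.
have [||e [e0 he]] := @polar_mod_small p W => //; first by rewrite h.
by exists (p - pi + e); split => //; lra.
Qed.

End Polar.

(** * Bijectivity of the map on the pieces of the partition *)

Section Branch.
Variables (R : realType) (a : R).
Hypothesis ha : 3 <= a.
Implicit Types (x y p W : R) (z w : CC R) (s : asymbol) (h : half).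

Definition sg h : R := if h is Upper then 1 else -1.
(** The half-plane onto which [fa a] maps the piece [s] of the partition. *)
Definition target s : half := if s.1 then opposite s.2 else s.2.

Lemma sg_pm h : sg h = 1 \/ sg h = -1.
Proof. by case: h; [right|left]. Qed.

Lemma halfplaneE h z : halfplane h z = (0 < sg h * im z) :> Prop.
Proof.
by case: h; rewrite /halfplane /= ?mul1r ?mulN1r ?oppr_gt0.
Qed.

Lemma sg_opposite h : sg (opposite h) = - sg h.
Proof. by case: h; rewrite /= ?opprK. Qed.

Lemma halfplane_im h z : halfplane h z -> im z != 0.
Proof. by rewrite halfplaneE => h1; apply/eqP => e; move: h1;
  rewrite e mulr0 ltxx. Qed.

(** Inside its band, a piece of the partition is cut out by the sign of [im
    (fa a z)]. *)
Lemma TpartP s z : Tpart a s z <->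
  [/\ `|im z| < (if s.1 then 2 * pi else pi), halfplane s.2 z
    & halfplane (target s) (fa a z)].
Proof.
rewrite /Tpart T0E// T1E// /target; case: s => b h /=.
rewrite !halfplaneE im_faQ.
have e0 := efun_gt0 ha z.
case: b; rewrite ?sg_opposite; split.
- move=> [[h1 h2] h3]; split => //; rewrite mulNr oppr_gt0.
  by rewrite mulrCA pmulr_rlt0// mulrA pmulr_rlt0.
- move=> [h1 h2 h3]; split => //; split => //; move: h3.
  by rewrite mulNr oppr_gt0 mulrCA pmulr_rlt0// mulrA pmulr_rlt0.
- by move=> [[h1 h2] h3]; split => //;
    rewrite mulrCA pmulr_rgt0// mulrA pmulr_rgt0.
- move=> [h1 h2 h3]; split => //; split => //; move: h3.
  by rewrite mulrCA pmulr_rgt0// mulrA pmulr_rgt0.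
Qed.

(** The equation [fa a z = r e^(i p)] after rotation by [- im z]. *)
Lemma fa_polar z r p : re (fa a z) = r * cos p -> im (fa a z) = r * sin p ->
  efun a z * (re z + a - 1) = r * cos (p - im z) /\
  efun a z * im z = r * sin (p - im z).
Proof.
rewrite re_fa im_fa => h1 h2; rewrite cosB sinB.
set e := efun a z in h1 h2 *; set u := re z + a - 1 in h1 h2 *.
set y := im z in h1 h2 *; split.
  transitivity (e * u * (cos y ^+ 2 + sin y ^+ 2)); first
    by rewrite cos2Dsin2 mulr1.
  have -> : r * (cos p * cos y + sin p * sin y) =
    (r * cos p) * cos y + (r * sin p) * sin y by ring.
  by rewrite -h1 -h2; ring.
transitivity (e * y * (cos y ^+ 2 + sin y ^+ 2)); first
  by rewrite cos2Dsin2 mulr1.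
have -> : r * (sin p * cos y - cos p * sin y) =
  (r * sin p) * cos y - (r * cos p) * sin y by ring.
by rewrite -h1 -h2; ring.
Qed.

Lemma fa_polar_mod z r p : 0 < r ->
  re (fa a z) = r * cos p -> im (fa a z) = r * sin p -> sin (p - im z) != 0 ->
  polar_mod p (im z) = r / (a * expR 1) /\
  re z + a - 1 = im z * cos (p - im z) / sin (p - im z).
Proof.
move=> r0 h1 h2 s0; have [h3 h4] := fa_polar h1 h2; have a0 : 0 < a by have :=
  ha; lra.
have e0 := efun_gt0 ha z.
have rn : r != 0 by rewrite gt_eqF.
have hu : re z + a - 1 = im z * cos (p - im z) / sin (p - im z).
  apply: (mulIf s0); rewrite divfK//; apply: (mulfI rn).
  by rewrite mulrCA -h4 [RHS]mulrCA -h3; ring.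
split => //; rewrite /polar_mod -hu.
have -> : expR (re z + a - 1) = expR (re z + a) / expR 1 by rewrite expRB.
have hy : im z / sin (p - im z) = r / efun a z.
  apply: (mulIf s0); rewrite divfK//; apply: (mulfI (lt0r_neq0 e0)).
  by rewrite h4 mulrA [_ * (r / _)]mulrC divfK// gt_eqF.
rewrite hy /efun; field.
by rewrite !gt_eqF ?expR_gt0.
Qed.

Definition conjp z : CC R := mkC (re z) (- im z).

Lemma conjpK z : conjp (conjp z) = z.
Proof. by apply: eq_reim; rewrite /= ?opprK. Qed.

Lemma fa_conjp z : fa a (conjp z) = conjp (fa a z).
Proof.
apply: eq_reim.
  rewrite -[RHS]/(re (fa a z)) !re_fa /efun /= cosN sinN; ring.
rewrite -[RHS]/(- im (fa a z)) !im_fa /efun /= cosN sinN; ring.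
Qed.

Lemma halfplane_conjp h z : halfplane (opposite h) (conjp z)
  = halfplane h z :> Prop.
Proof. by rewrite !halfplaneE sg_opposite /= mulrNN. Qed.

Lemma Tpart_conjp s z : Tpart a (s.1, opposite s.2) (conjp z) <-> Tpart a s z.
Proof.
rewrite !TpartP fa_conjp /= normrN /target /=.
by case: s => -[] h; rewrite /= !halfplane_conjp.
Qed.

(** [sin (p - im z)] is positive and [p - im z] lies in [(- pi, 2 pi)]. *)
Lemma polar_range b z r p : Tpart a (b, Upper) z -> 0 < r -> 0 < p < 2 * pi ->
  re (fa a z) = r * cos p -> im (fa a z) = r * sin p ->
  (0 < im (fa a z) -> p < pi) /\ (im (fa a z) < 0 -> pi < p) ->
  0 < p - im z < pi.
Proof.
move=> /TpartP[/= h1 h2 h3] r0 hp hr hi [hp1 hp2].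
have a0 : 0 < efun a z by exact: efun_gt0.
have [_ h4] := fa_polar hr hi; rewrite /halfplane /= in h2.
have s0 : 0 < sin (p - im z) by rewrite -(pmulr_rgt0 _ r0) -h4 mulr_gt0.
rewrite (gtr0_norm h2) in h1.
apply: sin_pos_range => //; move: h1 h3; case: b => /= h1 h3.
  by have := hp2 h3; lra.
by have := hp1 h3; lra.
Qed.

(** The modulus [polar_mod] is strictly monotone on the set where the
    argument of [fa a] is prescribed. *)
Lemma fa_inj_upper b z w : Tpart a (b, Upper) z -> Tpart a (b, Upper) w ->
  fa a z = fa a w -> z = w.
Proof.
move=> Tz Tw zw.
have im0 : im (fa a z) != 0 by case/TpartP: Tz => _ _ /halfplane_im.
have [r [p [r0 hp hr hi hh]]] := polar_coordinates im0.
have dz := polar_range Tz r0 hp hr hi hh.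
have dw : 0 < p - im w < pi by apply: (polar_range Tw r0 hp); rewrite -zw.
have sz := sin_gt0_pi dz; have sw := sin_gt0_pi dw.
have [mz uz] := fa_polar_mod r0 hr hi (lt0r_neq0 sz).
have [|||mw uw] := @fa_polar_mod w r p r0; rewrite -?zw ?gt_eqF//.
have yy : im z = im w.
  have yz0 : 0 < im z by case: Tz.
  have yw0 : 0 < im w by case: Tw.
  have [h|h|//] := ltgtP (im z) (im w).
    have := @polar_mod_incr R p (im z) (im w); rewrite mz mw ltxx (ltW yz0) h.
    suff hs t : im z <= t <= im w -> 0 < sin (p - t) by move=> /(_ isT hs).
    by move=> ht; apply: sin_gt0_pi; lra.
  have := @polar_mod_incr R p (im w) (im z); rewrite mz mw ltxx (ltW yw0) h.
  suff hs t : im w <= t <= im z -> 0 < sin (p - t) by move=> /(_ isT hs).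
  by move=> ht; apply: sin_gt0_pi; lra.
apply: eq_reim => //.
by rewrite yy in uz; rewrite -uw in uz; lra.
Qed.

Lemma fa_surj_upper b w : halfplane (target (b, Upper)) w ->
  exists2 z, Tpart a (b, Upper) z & fa a z = w.
Proof.
move=> hw; have a0 : 0 < a by have := ha; lra.
have p0 := @pi_gt0 R.
have [r [p [r0 hp hr hi [hp1 hp2]]]] := polar_coordinates (halfplane_im hw).
have ppi : p != pi.
  apply/eqP => e; move: hi; rewrite e sinpi mulr0.
  by apply/eqP; exact: halfplane_im hw.
have W0 : 0 < r / (a * expR 1) by rewrite divr_gt0// mulr_gt0// expR_gt0.
have [y [hy sy hm]] := polar_mod_surj hp ppi W0.
pose u := y * cos (p - y) / sin (p - y).
pose z : CC R := mkC (u + 1 - a) y.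
have eu : re z + a - 1 = u by rewrite /=; ring.
have ez : efun a z = a * (expR u * expR 1).
  by rewrite /efun -expRD; congr (_ * expR _); rewrite /=; ring.
have ey : efun a z * y = r * sin (p - y).
  have sn : sin (p - y) != 0 by rewrite gt_eqF.
  have en : a * expR 1 != 0 by rewrite gt_eqF// mulr_gt0// expR_gt0.
  rewrite ez; apply: (mulIf (invr_neq0 sn)); rewrite mulfK//.
  apply: (mulIf (invr_neq0 en)); rewrite -hm /polar_mod -/u.
  by field; rewrite sn gt_eqF// gt_eqF// expR_gt0.
have eyu : efun a z * u = r * cos (p - y).
  have -> : efun a z * u = efun a z * y * cos (p - y) / sin (p - y)
    by rewrite /u; ring.
  by rewrite ey mulrAC mulfK// gt_eqF.
have fz : fa a z = w.
  apply: eq_reim; rewrite ?re_fa ?im_fa eu ?hr ?hi /=.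
    have -> : efun a z * (u * cos y - y * sin y) =
      efun a z * u * cos y - efun a z * y * sin y by ring.
    have -> : cos p = cos (p - y) * cos y - sin (p - y) * sin y.
      by rewrite -cosD subrK.
    by rewrite ey eyu; ring.
  have -> : efun a z * (u * sin y + y * cos y) =
      efun a z * u * sin y + efun a z * y * cos y by ring.
  have -> : sin p = sin (p - y) * cos y + cos (p - y) * sin y.
    by rewrite -sinD subrK.
  by rewrite ey eyu; ring.
exists z => //; apply/TpartP; split => //=; last by rewrite fz.
  rewrite gtr0_norm; last lra.
  by move: hw; case: b => /= hw; [lra|have := hp1 hw; lra].
by lra.
Qed.

Lemma fa_inj s z w : Tpart a s z -> Tpart a s w -> fa a z = fa a w -> z = w.
Proof.
case: s => b [] Tz Tw zw; last exact: (fa_inj_upper Tz Tw).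
have Tz' := (Tpart_conjp (b, Lower) z).2 Tz; have Tw' := (Tpart_conjp (b,
  Lower) w).2 Tw.
have := fa_inj_upper Tz' Tw'; rewrite !fa_conjp zw => /(_ erefl)
  /(congr1 conjp).
by rewrite !conjpK.
Qed.

Lemma fa_surj s w : halfplane (target s) w ->
  exists2 z, Tpart a s z & fa a z = w.
Proof.
case: s => b [] hw; last exact: fa_surj_upper.
have hw' : halfplane (target (b, Upper)) (conjp w).
  by move: hw; rewrite -halfplane_conjp; case: b.
have [z Tz fz] := fa_surj_upper hw'.
exists (conjp z); last by rewrite fa_conjp fz conjpK.
by apply: (Tpart_conjp (b, Upper) z).2.
Qed.

Lemma branchP s w : halfplane (target s) w ->
  Tpart a s (branch a s w) /\ fa a (branch a s w) = w.
Proof.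
move=> hw; rewrite /branch; case: xgetP => // h.
by have [z Tz fz] := fa_surj hw; case: (h z).
Qed.

Lemma branch_fa s z : Tpart a s z -> branch a s (fa a z) = z.
Proof.
move=> Tz; have hw : halfplane (target s) (fa a z) by case/TpartP: Tz.
by have [h1 h2] := branchP hw; exact: (fa_inj h1 Tz).
Qed.

End Branch.

(** * Growth of the map and continuity of the inverse branches *)

Section BranchCont.
Variables (R : realType) (a : R).
Hypothesis ha : 3 <= a.
Implicit Types (x y p W : R) (z w : CC R) (s : asymbol) (h : half).

(** The asymptotic value 0 on the left: [e^x] beats any power of [x]. *)
Lemma fa_left_small m : 0 < m -> exists2 L, 0 < L &
  forall z, `|im z| <= 8 -> re z <= - L -> nsq (fa a z) < m.
Proof.
move=> m0; have a0 := ha.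
(* with [t = - (re z + a)],
  the squared modulus is at most [18 * a ^+ 2 / (8 * t)] for [t >= 8] *)
pose L := a + 8 + 3 * a ^+ 2 / m.
have q0 : 0 < 3 * a ^+ 2 / m by rewrite divr_gt0// mulr_gt0// exprn_gt0//; lra.
exists L; first by rewrite /L; lra.
move=> z hy hx; rewrite nsq_fa /efun.
pose t := - (re z + a).
have t8 : 8 + 3 * a ^+ 2 / m <= t by rewrite /t; move: hx; rewrite /L; lra.
have -> : re z + a = - t by rewrite /t opprK.
have y2 : im z ^+ 2 <= 64.
  rewrite -(real_normK (num_real (im z))).
  have -> : 64 = 8 ^+ 2 :> R by lra.
  by rewrite ler_pXn2r ?nnegrE.
have E := expR_gt0 t.
have h2 : t ^+ 3 / 6 <= expR t ^+ 2 / 8.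
  have := @expR_ge1Dxn R (2 * t) 2; rewrite expRM_natl => /(_ ltac:(lra)).
  have -> : (3`!)%:R = 6 :> R by [].
  rewrite exprMn; lra.
rewrite expRN exprMn exprVn.
have E2 : 0 < expR t ^+ 2 by rewrite exprn_gt0.
rewrite mulrAC ltr_pdivrMr//.
have h3 : (- t - 1) ^+ 2 + im z ^+ 2 <= 3 * t ^+ 2 by nra.
have h4 : 3 * a ^+ 2 < m * (t - 1).
  rewrite [X in _ < X]mulrC -ltr_pdivrMr//; lra.
have a2 : 0 < a ^+ 2 by rewrite exprn_gt0//; lra.
apply: (@le_lt_trans _ _ (a ^+ 2 * (3 * t ^+ 2))); first by rewrite ler_pM2l.
have t2 : 0 < t ^+ 2 by rewrite exprn_gt0//; lra.
have h5 : m * t ^+ 3 * (4 / 3) <= m * expR t ^+ 2 by nra.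
have h6 : a ^+ 2 * (3 * t ^+ 2) < m * (t - 1) * t ^+ 2.
  by rewrite mulrA [a ^+ 2 * 3]mulrC ltr_pM2r.
have h7 : m * (t - 1) * t ^+ 2 <= m * t ^+ 3 * (4 / 3).
  have -> : m * t ^+ 3 * (4 / 3) = m * (t * (4 / 3)) * t ^+ 2 by ring.
  by rewrite ler_pM2r// ler_pM2l//; lra.
lra.
Qed.

Lemma fa_right_ge z : 0 <= re z + a -> (re z + a - 1) ^+ 2 <= nsq (fa a z).
Proof.
move=> h; have a0 := ha; rewrite nsq_fa.
have e1 : 1 <= efun a z.
  have : 1 <= expR (re z + a) by rewrite -expR0 ler_expR.
  rewrite /efun; nra.
have : 1 <= efun a z ^+ 2 by rewrite expr_ge1//; lra.
have := sqr_ge0 (re z + a - 1); have := sqr_ge0 (im z).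
set A := re z + _ - _; nra.
Qed.

Lemma fa_right_grow z C : 0 <= C -> C <= re z -> `|im (fa a z)| <= 8 ->
  C < `|re (fa a z)|.
Proof.
move=> C0 hz hi; have a0 := ha.
have e1 : 3 * (re z + 4) <= efun a z.
  have : re z + 4 <= expR (re z + a) by have := expR_ge1Dx (re z + a); lra.
  rewrite /efun; nra.
have i2 : im (fa a z) ^+ 2 <= 64.
  rewrite -(real_normK (num_real (im (fa a z)))).
  have -> : 64 = 8 ^+ 2 :> R by lra.
  by rewrite ler_pXn2r ?nnegrE.
rewrite -(ltr_pXn2r (n := 2)) ?nnegrE// real_normK ?num_real//.
have : efun a z ^+ 2 * (re z + a - 1) ^+ 2 <= nsq (fa a z).
  rewrite nsq_fa ler_wpM2l ?sqr_ge0//; have := sqr_ge0 (im z); lra.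
have h1 : re z + 2 <= re z + a - 1 by lra.
have h2 : (3 * (re z + 4)) ^+ 2 * (re z + 2) ^+ 2 <=
  efun a z ^+ 2 * (re z + a - 1) ^+ 2.
  by apply: ler_pM; rewrite ?sqr_ge0// ler_pXn2r ?nnegrE//; lra.
have h3 : C ^+ 2 <= re z ^+ 2 by rewrite ler_pXn2r ?nnegrE//; lra.
have h4 : 16 * re z ^+ 2 + 100 <= (3 * (re z + 4)) ^+ 2 * (re z + 2) ^+ 2.
  have -> : (3 * (re z + 4)) ^+ 2 * (re z + 2) ^+ 2 =
    9 * ((re z + 4) * (re z + 2)) ^+ 2 by ring.
  have h5 : 4 * re z + 8 <= (re z + 4) * (re z + 2) by nra.
  have : (4 * re z + 8) ^+ 2 <= ((re z + 4) * (re z + 2)) ^+ 2.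
    by rewrite ler_pXn2r ?nnegrE//; nra.
  by nra.
rewrite /nsq; have := sqr_ge0 (re z); lra.
Qed.

Definition imbound s : R := if s.1 then 2 * pi else pi.

(** A closed set containing [Tpart a s], with the property that its only
    points that [fa a] maps into the open half-plane, respectively to [- a],
    are those of [Tpart a s], respectively [- a]. *)
Definition Tclos s : set (CC R) := [set z | [/\ `|im z| <= imbound s,
  0 <= sg R s.2 * im z & 0 <= sg R (target s) * im (fa a z)]].

Lemma imbound_le s : imbound s <= 2 * pi.
Proof. by have p0 := @pi_gt0 R; rewrite /imbound; case: ifP => _; lra. Qed.

Lemma imbound_le8 s : imbound s <= 8.
Proof. by have := @pi_lt4 R; have := imbound_le s; lra. Qed.

Lemma Tpart_Tclos s z : Tpart a s z -> Tclos s z.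
Proof.
move=> /(TpartP ha)[h1]; rewrite !halfplaneE => h2 h3; split; exact: ltW.
Qed.

Lemma sg_mul_eq0 h y : sg R h * y = 0 -> y = 0.
Proof. by case: h; rewrite /= ?mul1r// mulN1r => /eqP; rewrite oppr_eq0 =>
  /eqP. Qed.

Lemma Tclos_Tpart s z : Tclos s z -> im (fa a z) != 0 -> Tpart a s z.
Proof.
move=> [h1 h2 h3] h0; apply/(TpartP ha).
have y0 : im z != 0.
  by apply: contra h0 => /eqP h; rewrite im_faQ h mul0r mulr0.
have h2' : 0 < sg R s.2 * im z.
  by rewrite lt_neqAle h2 andbT; apply: contra y0 => /eqP/esym/sg_mul_eq0 ->.
have h3' : 0 < sg R (target s) * im (fa a z).
  by rewrite lt_neqAle h3 andbT; apply: contra h0 => /eqP/esym/sg_mul_eq0 ->.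
split; rewrite ?halfplaneE//.
rewrite lt_neqAle h1 andbT; apply/eqP => e.
have e0 := efun_gt0 ha z.
have := h3'; rewrite im_faQ mulrCA pmulr_rgt0// mulrA.
move: e h2'; rewrite /imbound /target; case: s.1 => e h2'.
  by rewrite (Q_2pi a e) mulr1 sg_opposite; lra.
by rewrite (Q_pi a e) mulrN1; lra.
Qed.

Lemma Tclos_center s z : Tclos s z -> fa a z = - a%:C -> z = - a%:C.
Proof.
move=> [h1 _ _] fz; have a0 := ha; have p0 := @pi_gt0 R.
have fr : re (fa a z) = - a by rewrite fz.
have fi : im (fa a z) = 0 by rewrite fz /= oppr0.
have [y0|y0] := eqVneq (im z) 0.
  by have [_] := re_fa_real ha y0; rewrite fr eqxx => /esym/eqP.
have q0 : Qfun a z = 0.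
  move/eqP: fi; rewrite im_faQ mulf_eq0 gt_eqF ?(efun_gt0 ha)//= mulf_eq0
    (negbTE y0).
  by move/eqP.
exfalso.
have [h|h|/(Q_pi a)] := ltgtP `|im z| pi; last by rewrite q0; lra.
  by have := re_fa_eta ha q0 y0 h; rewrite fr ltxx.
have h2 : pi < `|im z| < 2 * pi.
  rewrite h lt_neqAle (le_trans h1 (imbound_le s)) andbT.
  by apply/eqP => /(Q_2pi a); rewrite q0; lra.
have := re_fa_curve q0 y0; rewrite fr.
have := sinc_lt0 h2; have := efun_gt0 ha z; nra.
Qed.

Lemma continuous_imfa : continuous (fun z => im (fa a z)).
Proof. by move=> z; exact: (cvg_comp _ _ (@continuous_fa R a z)
  (@continuous_im R _)). Qed.

Lemma closed_Tclos s : closed (Tclos s).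
Proof.
have c1 : continuous (fun z : CC R => sg R s.2 * im z).
  by move=> z; have FF := nbhs_filter z; exact: (cvgM (cvg_cst _)
    (@continuous_im R z)).
have c2 : continuous (fun z => sg R (target s) * im (fa a z)).
  by move=> z; have FF := nbhs_filter z; exact: (cvgM (cvg_cst _)
    (@continuous_imfa z)).
have h1 := closed_comp (fun z _ => c1 z) (@closed_ge R 0).
have h2 := closed_comp (fun z _ => c2 z) (@closed_ge R 0).
have := closedI (closedI (@closed_absim_le R (imbound s)) h1) h2.
by congr closed; apply/seteqP; split => z [] => [[]|]; split.
Qed.

Definition branch_dom s : set (CC R) := [set w | halfplane (target s) w \/ w =
  - a%:C].

(** The inverse branch extended by the fixed critical point, needed to pull
    back connected sets that contain [- a]. *)
Definition branch_ext s w : CC R :=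
  if w == - a%:C then - a%:C else branch a s w.

Lemma center_fix : fa a (- a%:C) = - a%:C.
Proof.
apply: eq_reim; rewrite ?re_fa ?im_fa /efun /= ?oppr0 ?sin0 ?cos0 ?addNr
  ?expR0; ring.
Qed.

Lemma center_Tclos s : Tclos s (- a%:C).
Proof.
have p0 := @pi_gt0 R.
by split; rewrite ?center_fix /= ?oppr0 ?mulr0// normr0 /imbound; case: ifP =>
  _; lra.
Qed.

Lemma branch_ext_half s w : halfplane (target s) w -> branch_ext s w =
  branch a s w.
Proof.
move=> hw; rewrite /branch_ext ifF//; apply/eqP => e.
by have := halfplane_im hw; rewrite e /= oppr0 eqxx.
Qed.

Lemma branch_extP s w : branch_dom s w -> Tclos s (branch_ext s w)
  /\ fa a (branch_ext s w) = w.
Proof.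
case=> [hw|->].
  rewrite branch_ext_half//; have [h1 h2] := branchP ha hw.
  by split => //; exact: Tpart_Tclos.
by rewrite /branch_ext eqxx; split; [exact: center_Tclos|exact: center_fix].
Qed.

Lemma branch_ext_uniq s w z : branch_dom s w -> Tclos s z -> fa a z = w -> z =
  branch_ext s w.
Proof.
case=> [hw|->] Tz fz.
  have Tz' : Tpart a s z by apply: Tclos_Tpart => //; rewrite fz;
    exact: halfplane_im hw.
  by rewrite branch_ext_half// -fz (branch_fa ha Tz').
by rewrite /branch_ext eqxx; exact: (Tclos_center Tz fz).
Qed.

(** The map is proper on the closed piece: preimages of points near [w] stay
    in a box, because [fa a] is large on the right and small on the left
    while [w] is not 0. The part of the box outside [O] is compact, and so
    is its image, which does not contain [w]. *)
Lemma branch_ext_near s w (O : set (CC R)) : branch_dom s w -> open O ->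
  O (branch_ext s w) ->
  \forall w' \near w, branch_dom s w' -> O (branch_ext s w').
Proof.
move=> Dw oO Ow; have a0 := ha.
have w0 : 0 < nsq w.
  case: Dw => [/halfplane_im h|->].
    by rewrite /nsq ltr_wpDl ?sqr_ge0// exprn_even_gt0.
  by rewrite /nsq /= oppr0 expr0n addr0 sqrrN exprn_gt0//; lra.
have [|L L0 hL] := @fa_left_small (nsq w / 2); first lra.
(* on the right the squared modulus of the value exceeds [re z],
  so [M] bounds the real parts of preimages of points near [w] *)
pose M := nsq w + 2.
pose Z := [set z : CC R | - L <= re z <= M /\ - 8 <= im z <=
  8] `&` (Tclos s `&` ~` O).
have cZ : compact Z.
  apply: compact_closedI; first exact: compact_box.
  by apply: closedI; [exact: closed_Tclos|exact: open_closedC].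
have cfZ : closed (fa a @` Z).
  apply: compact_closed; first exact: hausdorff_CC.
  by apply: continuous_compact => //; apply: continuous_subspaceT;
    exact: continuous_fa.
have wZ : ~ (fa a @` Z) w.
  move=> [z [_ [Tz nO]] fz]; apply: nO.
  by rewrite (branch_ext_uniq Dw Tz fz).
have n1 : \forall w' \near w, ~ (fa a @` Z) w'.
  exact: (open_nbhs_nbhs (conj (closed_openC cfZ) wZ)).
have FF := nbhs_filter w.
have cn : nsq w' @[w' --> w] --> nsq w.
  have h1 := @continuous_re R w; have h2 := @continuous_im R w.
  exact: (cvgD (cvgM h1 h1) (cvgM h2 h2)).
have n2 : \forall w' \near w, nsq w / 2 <= nsq w'.
  by apply: (cvgr_ge _ cn); lra.
have n3 : \forall w' \near w, nsq w' <= nsq w + 1.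
  by apply: (cvgr_le _ cn); lra.
apply: filterS3 n1 n2 n3 => w' h1 h2 h3 Dw'.
have [Tg fg] := branch_extP Dw'.
apply: contrapT => nO; apply: h1; exists (branch_ext s w') => //; split => //.
set g := branch_ext s w' in Tg fg *.
have ig : `|im g| <= 8 by case: Tg => h _ _; exact: le_trans h (imbound_le8 s).
split; last by rewrite -ler_norml.
apply/andP; split.
  rewrite leNgt; apply/negP => hg; have := hL g ig (ltW hg).
  by rewrite fg ltNge h2.
rewrite leNgt /M; apply/negP => hg.
have := @fa_right_ge g; rewrite fg => /(_ ltac:(lra)) h4.
have : re g + 2 <= re g + a - 1 by lra.
have n0 : 0 <= nsq w by exact: ltW.
nra.
Qed.

Lemma branch_ext_within s (C : set (CC R)) : C `<=` branch_dom s ->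
  {within C, continuous (branch_ext s)}.
Proof.
move=> CD; rewrite continuous_subspace_in => w; rewrite inE => Cw A.
rewrite nbhsE => -[V [oV Vw] VA].
have : within C (nbhs w) (branch_ext s @^-1` A).
  have FF := nbhs_filter w; rewrite /within /=.
  apply: filterS (branch_ext_near (CD _ Cw) oV Vw) => w' h Cw'.
  by apply: VA; apply: h; exact: CD.
by rewrite (nbhs_subspace_in Cw).
Qed.

Lemma branch_cont s w : halfplane (target s) w -> {for w,
  continuous (branch a s)}.
Proof.
move=> hw A; rewrite nbhsE => -[V [oV Vw] VA].
have Dw : branch_dom s w by left.
have Vw' : V (branch_ext s w) by rewrite branch_ext_half.
have oH : open (halfplane (target s) : set (CC R)).
  have c1 : continuous (fun z : CC R => sg R (target s) * im z).
    by move=> z; have FF := nbhs_filter z; exact: (cvgM (cvg_cst _)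
      (@continuous_im R z)).
  have := open_comp (fun z _ => c1 z) (@open_gt R 0).
  by congr open; apply/seteqP; split => z; rewrite /= halfplaneE.
have nH : \forall w' \near w, halfplane (target s) w' by exact: open_nbhs_nbhs.
have FF := nbhs_filter w.
apply: filterS2 nH (branch_ext_near Dw oV Vw') => w' h1 h2; apply: VA.
by rewrite -branch_ext_half//; apply: h2; left.
Qed.

End BranchCont.

(** * Curves of bounded hyperbolic speed *)

Section Curves.
Variable R : realType.
Implicit Types (x y u v K b t M lam : R) (z w : CC R) (c d : R -> CC R).

Lemma is_derive_quot (f : R -> R) (x l : R) :
  is_derive x 1 f l <-> (fun h => h^-1 * (f (h + x) - f x)) @ 0^' --> l.
Proof.
have e : (fun h : R => h^-1 *: ((f \o shift x) (h *: 1) - f x)) =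
         (fun h => h^-1 * (f (h + x) - f x)).
  by apply/funext => h; rewrite /GRing.scale /= mulr1.
split.
  by case; rewrite /derivable /derive e => h <-.
move=> h; apply: DeriveDef; first by rewrite /derivable e; apply/cvg_ex;
  exists l.
by rewrite /derive e; apply/cvg_lim.
Qed.

Lemma derive_lip (f df : R -> R) K b : 0 <= b ->
  (forall t, is_derive t 1 f (df t)) ->
  (forall t, 0 <= t <= b -> `|df t| <= K) ->
  `|f b - f 0| <= K * b.
Proof.
move=> b0 fd fK.
have fd' t : t \in `]0, b[%R -> is_derive t 1 f (df t) by move=> _; exact: fd.
have [|t tb ->] := @MVT_segment _ f df 0 b b0 fd'.
- apply: continuous_subspaceT => t.
  by apply: differentiable_continuous; apply/derivable1_diffP; case: (fd t).
- rewrite subr0 normrM (ger0_norm b0) ler_wpM2r//; apply: fK.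
  by move: tb; rewrite in_itv.
Qed.

(** [M] bounds the speed for the metric [|dz| / |im z|] on [[0, pi / 2]].
    Segments are parametrized by [sin t ^+ 2], which stays in [[0, 1]] for
    every real [t], so that curves can be asked to be differentiable on the
    whole line. *)
Definition slow_curve (h : half) (M : R) c :=
  (forall t, halfplane h (c t)) /\
  exists d, forall t, [/\ is_derive t 1 (fun t => re (c t)) (re (d t)),
    is_derive t 1 (fun t => im (c t)) (im (d t)) &
    0 <= t <= pi / 2 -> nsq (d t) <= M ^+ 2 * im (c t) ^+ 2].

Lemma derive_continuous (f df : R -> R) : (forall t, is_derive t 1 f (df t)) ->
  continuous f.
Proof.
by move=> fd t; apply: differentiable_continuous; apply/derivable1_diffP;
  case: (fd t).
Qed.

Lemma slow_curve_cont h M c : slow_curve h M c -> continuous c.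
Proof.
move=> [_ [d hd]] t; have FF := nbhs_filter t; apply: cvgCP.
  by apply: (derive_continuous (f := fun t => re (c t)) (df := fun t =>
    re (d t))) => s; case: (hd s).
by apply: (derive_continuous (f := fun t => im (c t)) (df := fun t =>
  im (d t))) => s; case: (hd s).
Qed.

Lemma sqr_le_norm x y : 0 <= y -> x ^+ 2 <= y ^+ 2 -> `|x| <= y.
Proof.
by move=> y0; rewrite -(real_normK (num_real x)) ler_pXn2r ?nnegrE.
Qed.

(** The derivative of the logarithm of the height is bounded by [M], and [pi
    / 2 < 2]. *)
Lemma slow_curve_height h M c t : 0 <= M -> slow_curve h M c -> 0 <= t <=
  pi / 2 ->
  `|im (c t)| <= expR (2 * M) * `|im (c 0)| /\
  `|im (c 0)| <= expR (2 * M) * `|im (c t)|.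
Proof.
move=> M0 [hc [d hd]] ht.
pose g s := ln (sg R h * im (c s)).
have sy (s : R) : 0 < sg R h * im (c s) by rewrite -halfplaneE.
have dg (s : R) : is_derive s 1 g (im (d s) / im (c s)).
  have [_ h2 _] := hd s.
  have h3 : is_derive s 1 (fun s => sg R h * im (c s)) (sg R h * im (d s)).
    by apply: is_derive_eq; rewrite /GRing.scale /=; ring.
  have h4 := is_derive1_ln (sy s).
  have -> : im (d s) / im (c s) = (sg R h * im (d s)) * (sg R h * im (c s))^-1.
    have := sy s; case: (h) => /=; rewrite ?mul1r// !mulN1r oppr_gt0 =>
      /lt_eqF/negbT c0.
    by field.
  rewrite mulrC.
  exact: (@is_derive1_comp _ (@ln R) (fun s => sg R h * im (c s)) s _ _ h4 h3).
have hM (s : R) : 0 <= s <= t -> `|im (d s) / im (c s)| <= M.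
  move=> hs; have [_ _ h3] := hd s.
  have {}h3 : nsq (d s) <= M ^+ 2 * im (c s) ^+ 2 by apply: h3; lra.
  have c0 : im (c s) != 0 by exact: halfplane_im (hc s).
  rewrite normrM normfV ler_pdivrMr ?normr_gt0//.
  apply: sqr_le_norm; first by rewrite mulr_ge0.
  rewrite exprMn real_normK ?num_real//; apply: le_trans h3.
  by rewrite /nsq lerDr sqr_ge0.
have [t0 t2] : 0 <= t /\ t <= 2 by have := @pihalf_lt2 R; lra.
have h1 := derive_lip t0 dg hM.
have h2 : `|g t - g 0| <= 2 * M by apply: (le_trans h1);
  rewrite mulrC ler_wpM2r.
have ns (s : R) : `|im (c s)| = expR (g s).
  rewrite /g lnK ?posrE//; have := sy s; case: (h) => /=.
    by rewrite mulN1r oppr_gt0 => /ltr0_norm.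
  by rewrite mul1r => /gtr0_norm.
rewrite !ns -!expRD !ler_expR; move: h2; rewrite ler_norml; lra.
Qed.

Lemma slow_curve_dist h M c t : 0 <= M -> slow_curve h M c -> 0 <= t <=
  pi / 2 ->
  `|re (c t) - re (c 0)| <= 2 * M * expR (2 * M) * `|im (c 0)| /\
  `|im (c t) - im (c 0)| <= 2 * M * expR (2 * M) * `|im (c 0)|.
Proof.
move=> M0 sc ht; have hh := slow_curve_height M0 sc.
case: (sc) => [hc [d hd]].
have [t0 t2] : 0 <= t /\ t <= 2 by have := @pihalf_lt2 R; lra.
pose K := M * (expR (2 * M) * `|im (c 0)|).
have K0 : 0 <= K by rewrite !mulr_ge0// expR_ge0.
have e : 2 * M * expR (2 * M) * `|im (c 0)| = K * 2 by rewrite /K; ring.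
have nd (s : R) : 0 <= s <= t -> nsq (d s) <= K ^+ 2.
  move=> hs; have [_ _ h3] := hd s.
  apply: (@le_trans _ _ (M ^+ 2 * im (c s) ^+ 2)); first by apply: h3; lra.
  rewrite /K exprMn ler_wpM2l ?sqr_ge0// -(real_normK (num_real (im (c s)))).
  rewrite ler_pXn2r ?nnegrE ?mulr_ge0 ?expR_ge0//.
  by have [|h1 _] := hh s; first lra.
rewrite e; split.
  apply: (@le_trans _ _ (K * t)); last by rewrite ler_wpM2l.
  apply: (derive_lip (f := fun t => re (c t)) (df := fun t => re (d t))) => //.
    by move=> s; case: (hd s).
  move=> s /nd hs; apply: sqr_le_norm => //; apply: le_trans hs.
  by rewrite /nsq lerDl sqr_ge0.
apply: (@le_trans _ _ (K * t)); last by rewrite ler_wpM2l.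
apply: (derive_lip (f := fun t => im (c t)) (df := fun t => im (d t))) => //.
  by move=> s; case: (hd s).
move=> s /nd hs; apply: sqr_le_norm => //; apply: le_trans hs.
by rewrite /nsq lerDr sqr_ge0.
Qed.

(** The segment stays at height at least [y0], and its length is at most [2
    B]. *)
Lemma slow_segment h z w y0 B : 0 < y0 -> halfplane h z -> halfplane h w ->
  y0 <= `|im z| -> y0 <= `|im w| ->
  `|re z - re w| <= B -> `|im z - im w| <= B ->
  exists c, [/\ slow_curve h (2 * B / y0) c, c 0 = z & c (pi / 2) = w].
Proof.
move=> y00 hz hw yz yw hB1 hB2.
pose c t := mkC (re z + sin t ^+ 2 * (re w - re z))
  (im z + sin t ^+ 2 * (im w - im z)).
exists c; split; last 2 first.
- by apply: eq_reim; rewrite /= sin0 expr0n /= mul0r addr0.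
- by apply: eq_reim; rewrite /= sin_pihalf expr1n mul1r; ring.
have s01 t : 0 <= sin t ^+ 2 <= 1.
  by have := cos2Dsin2 t; have := sqr_ge0 (cos t); have := sqr_ge0 (sin t); lra.
have hy t : y0 <= sg R h * im (c t).
  move: hz hw yz yw; rewrite !halfplaneE => hz hw.
  have -> : `|im z| = sg R h * im z.
    by case: (sg_pm R h) hz => ->; rewrite ?mul1r ?mulN1r ?oppr_gt0 =>
      /[dup] ? ; [rewrite gtr0_norm|rewrite ltr0_norm].
  have -> : `|im w| = sg R h * im w.
    by case: (sg_pm R h) hw => ->; rewrite ?mul1r ?mulN1r ?oppr_gt0 =>
      /[dup] ? ; [rewrite gtr0_norm|rewrite ltr0_norm].
  move=> yz yw; rewrite /c /=; have := s01 t; set q := sin t ^+ 2 =>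
    /andP[q0 q1].
  have -> : sg R h * (im z + q * (im w - im z)) =
    (1 - q) * (sg R h * im z) + q * (sg R h * im w) by ring.
  nra.
split; first by move=> t; rewrite halfplaneE (lt_le_trans y00).
exists (fun t => mkC (2 * (sin t * cos t) * (re w - re z)) (2 * (sin t * cos t)
  * (im w - im z))).
move=> t; split.
- by rewrite /c /=; apply: is_derive_eq; rewrite /GRing.scale /=; ring.
- by rewrite /c /=; apply: is_derive_eq; rewrite /GRing.scale /=; ring.
move=> _; rewrite /nsq /=.
have B0 : 0 <= B by apply: le_trans hB1.
have dr : (re w - re z) ^+ 2 <= B ^+ 2.
  by rewrite -sqrrN opprB -(real_normK (num_real _)) ler_pXn2r ?nnegrE.
have di : (im w - im z) ^+ 2 <= B ^+ 2.
  by rewrite -sqrrN opprB -(real_normK (num_real (im z - im w)))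
    ler_pXn2r ?nnegrE.
have sc : (2 * (sin t * cos t)) ^+ 2 <= 1.
  have -> : (2 * (sin t * cos t)) ^+ 2 =
    (cos t ^+ 2 + sin t ^+ 2) ^+ 2 - (cos t ^+ 2 - sin t ^+ 2) ^+ 2 by ring.
  by rewrite cos2Dsin2 expr1n lerBlDr lerDl sqr_ge0.
have iy : y0 ^+ 2 <= im (c t) ^+ 2.
  have -> : im (c t) ^+ 2 = (sg R h * im (c t)) ^+ 2.
    by case: (sg_pm R h) => ->; rewrite ?mul1r// mulN1r sqrrN.
  by have := hy t; set q := sg R h * _ => hq; rewrite ler_pXn2r ?nnegrE//; lra.
rewrite !(exprMn _ (2 * (sin t * cos t))) -mulrDr.
set S := (2 * (sin t * cos t)) ^+ 2 in sc *.
have S0 : 0 <= S by exact: sqr_ge0.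
have sum2 : (re w - re z) ^+ 2 + (im w - im z) ^+ 2 <= 4 * B ^+ 2.
  have := sqr_ge0 B; lra.
apply: (@le_trans _ _ (4 * B ^+ 2)).
  have sum0 : 0 <= (re w - re z) ^+ 2 + (im w - im z) ^+ 2
    by rewrite addr_ge0 ?sqr_ge0.
  by apply: le_trans sum2; rewrite -[leRHS]mul1r ler_wpM2r.
have -> : 4 * B ^+ 2 = (2 * B / y0) ^+ 2 * y0 ^+ 2 by field; rewrite gt_eqF.
by rewrite ler_wpM2l ?sqr_ge0.
Qed.

End Curves.

(** * Pulling curves back by an inverse branch *)

Section Pullback.
Variables (R : realType) (a : R).
Hypothesis ha : 3 <= a.
Implicit Types (x y u v K b t M lam : R) (z w : CC R) (c d : R -> CC R)
  (s : asymbol).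

(** The complex derivative of [fa a]. *)
Definition dfa z : CC R := a%:C * (z + a%:C) * expC (z + a%:C).

Lemma expCD z w : expC (z + w) = expC z * expC w.
Proof.
apply: eq_reim; rewrite ?reM ?imM /= !reD !imD expRD ?cosD ?sinD; ring.
Qed.

Definition expq z : CC R := if z == 0 then 1 else (expC z - 1) / z.

Lemma expqE z : expC z - 1 = z * expq z.
Proof.
rewrite /expq; case: eqP => [->|/eqP z0]; last by rewrite mulrC divfK.
by rewrite mul0r; apply: eq_reim; rewrite /= expR0 ?cos0 ?sin0; ring.
Qed.

Lemma expq_bound z : `|re z| <= 1 / 2 -> `|im z| <= 1 / 2 ->
  nsq (expq z - 1) <= 8 * nsq z.
Proof.
move=> hx hy; have [->|z0] := eqVneq z 0.
  by rewrite /expq eqxx subrr /nsq /= expr0n /=; lra.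
have n0 : 0 < nsq z.
  rewrite lt_def addr_ge0 ?sqr_ge0// andbT; apply: contra z0.
  rewrite /nsq paddr_eq0 ?sqr_ge0// !sqrf_eq0 => /andP[/eqP h1 /eqP h2].
  by apply/eqP; apply: eq_reim.
rewrite -(ler_pM2l n0) -nsqM mulrBr -expqE mulr1.
set x := re z in hx *; set y := im z in hy *.
have /andP[e1 e2] := expR_sub_bound hx.
have c1 := one_sub_cos_le y; have c2 := cos_le1 y.
have s1 := sin_sub_norm_le y; have s2 := sin_norm_le y.
have e3 : expR x <= 2.
  by move: hx; rewrite ler_norml => /andP[? ?]; nra.
have e4 := expR_gt0 x.
have r1 : `|re (expC z - 1 - z)| <= 2 * nsq z.
  rewrite !reD !reN /= -/x -/y ler_norml /nsq -/x -/y.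
  have h1 : 0 <= expR x * (1 - cos y) by rewrite mulr_ge0 ?subr_ge0// ltW.
  have h2 : expR x * (1 - cos y) <= 2 * (y ^+ 2 / 2).
    by apply: ler_pM => //; rewrite ?subr_ge0// ltW.
  have h3 := sqr_ge0 x; have h4 := sqr_ge0 y.
  by apply/andP; split; lra.
have i1 : `|im (expC z - 1 - z)| <= 2 * nsq z.
  rewrite !imD !imN /= -/x -/y /nsq -/x -/y.
  have -> : expR x * sin y - 0 - y = (expR x - 1) * sin y + (sin y - y) by ring.
  apply: (le_trans (ler_normD _ _)); rewrite normrM.
  have h1 : `|expR x - 1| <= 2 * `|x|.
    move: hx; rewrite !ler_norml => /andP[hx1 hx2].
    have x2 : x ^+ 2 <= `|x| / 2.
      rewrite -(real_normK (num_real x)) expr2.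
      by rewrite ler_wpM2l// ler_norml; apply/andP; split; lra.
    by have := ler_norm x; have := ler_norm (- x); rewrite normrN; lra.
  have h2 : `|expR x - 1| * `|sin y| <= 2 * `|x| * `|y| by apply: ler_pM.
  have h3 : 2 * `|x| * `|y| <= x ^+ 2 + y ^+ 2.
    have := sqr_ge0 (`|x| - `|y|).
    by rewrite -(real_normK (num_real x)) -(real_normK (num_real y)); lra.
  have h4 := sqr_ge0 x; lra.
have -> : nsq (expC z - 1 - z)
  = `|re (expC z - 1 - z)| ^+ 2 + `|im (expC z - 1 - z)| ^+ 2.
  by rewrite !real_normK ?num_real.
have := normr_ge0 (re (expC z - 1 - z)); have :=
  normr_ge0 (im (expC z - 1 - z)).
nra.
Qed.

Lemma expq_cvg : expq z @[z --> (0 : CC R)] --> (1 : CC R).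
Proof.
move=> A /nearC[e e0 hA]; apply/nearC.
have m0 : 0 < Num.min (1 / 2) (e / 8) by rewrite lt_min; apply/andP; split; lra.
exists (Num.min (1 / 2) (e / 8)) => // z.
rewrite /= !subr0 !lt_min => /andP[h1 h2] /andP[h3 h4].
have hb := expq_bound (ltW h1) (ltW h3); have e8 : 0 <= e / 8 by lra.
have n1 : nsq z <= 2 * (e / 8) ^+ 2.
  rewrite /nsq -(real_normK (num_real (re z))) -(real_normK (num_real (im z))).
  have : `|re z| ^+ 2 <= (e / 8) ^+ 2 by rewrite ler_pXn2r ?nnegrE// ltW.
  have : `|im z| ^+ 2 <= (e / 8) ^+ 2 by rewrite ler_pXn2r ?nnegrE// ltW.
  lra.
have n2 : nsq (expq z - 1) < e ^+ 2.
  apply: (le_lt_trans hb); have : 0 < e ^+ 2 by rewrite exprn_gt0.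
  lra.
move: n2; rewrite /nsq !reD !imD !reN !imN => n2.
have q1 := sqr_ge0 (re (expq z) - re 1); have q2 := sqr_ge0 (im (expq z)
  - im 1).
by apply: hA; rewrite -(ltr_pXn2r (n := 2))
  ?nnegrE ?normr_ge0 ?(ltW e0)// real_normK ?num_real//;
  lra.
Qed.

(** Caratheodory's slope function of [fa a] at [z]: continuous in [w], with
    value [dfa z] at [z]. Dividing by it differentiates the inverse
    branches. *)
Definition fquot z w : CC R :=
  a%:C * expC (z + a%:C) * ((z - (1 - a)%:C) * expq (w - z) + expC (w - z)).

Lemma fquotE z w : fa a w - fa a z = fquot z w * (w - z).
Proof.
have -> : fa a w = a%:C * (z + (w - z) - (1 - a)%:C) * (expC (z + a%:C)
  * expC (w - z)).
  rewrite -expCD; congr (_ * (_ - _) * expC _); ring.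
have -> : expC (w - z) = 1 + (w - z) * expq (w - z) by rewrite -expqE; ring.
rewrite /fquot /fa.
have -> : expC (w - z) = 1 + (w - z) * expq (w - z) by rewrite -expqE; ring.
ring.
Qed.

Lemma fquot_cvg (T : Type) (F : set_system T) (FF : Filter F)
    (g : T -> CC R) z :
  g @ F --> z -> (fun i : T => fquot z (g i)) @ F --> dfa z.
Proof.
move=> hg.
have h0 : (fun i : T => g i - z) @ F --> (0 : CC R).
  have E : (0 : CC R) = z - z by rewrite subrr.
  by rewrite E; exact: (cvgCD hg (@cvgC_cst _ _ _ FF (- z))).
have h1 : (fun i : T => expq (g i - z)) @ F --> (1 : CC R).
  exact: (cvg_comp _ _ h0 expq_cvg).
have h2 : (fun i : T => expC (g i - z)) @ F --> (1 : CC R).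
  have -> : (1 : CC R) = expC 0.
    by apply: eq_reim; rewrite /= expR0 ?cos0 ?sin0; ring.
  exact: (cvg_comp _ _ h0 (@continuous_expC R 0)).
have E : dfa z = a%:C * expC (z + a%:C) * ((z - (1 - a)%:C) * 1 + 1) :> CC R.
  by rewrite /dfa; apply: eq_reim; rewrite !reimE /=; ring.
rewrite E.
exact: (cvgCM (@cvgC_cst _ _ _ FF (a%:C * expC (z + a%:C)))
  (cvgCD (cvgCM (@cvgC_cst _ _ _ FF (z - (1 - a)%:C)) h1) h2)).
Qed.

Lemma nsq_dfa z : nsq (dfa z) = efun a z ^+ 2 * ((re z + a) ^+ 2 + im z ^+ 2).
Proof.
rewrite /dfa !nsqM.
have -> : nsq (expC (z + a%:C)) = expR (re z + a) ^+ 2.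
  have h w : nsq (expC w) = expR (re w) ^+ 2.
    by rewrite /nsq /= !exprMn -mulrDr cos2Dsin2 mulr1.
  by rewrite h reD.
by rewrite /nsq !reD !imD /= addr0 /efun; ring.
Qed.

Lemma im_fa_le z : im (fa a z) ^+ 2 <= im z ^+ 2 * nsq (dfa z).
Proof.
rewrite nsq_dfa im_fa exprMn.
have := im_deriv_le (re z + a - 1) (im z); rewrite subrK => h.
rewrite [leRHS]mulrCA ler_wpM2l ?sqr_ge0//.
Qed.

Lemma im_fa_contract y0 : 0 < y0 -> exists2 lam, 0 <= lam < 1 & forall z,
  y0 <= `|im z| <= 8 -> im (fa a z) ^+ 2 <=
    lam ^+ 2 * (im z ^+ 2 * nsq (dfa z)).
Proof.
move=> y00; have [lam hl H] := @im_deriv_contract R 8 y0 y00; exists lam =>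
  // z hz.
have := H (re z + a - 1) (im z) hz; rewrite subrK => h.
rewrite nsq_dfa im_fa exprMn.
have -> : lam ^+ 2 * (im z ^+ 2 * (efun a z ^+ 2 * ((re z + a)
  ^+ 2 + im z ^+ 2))) =
  efun a z ^+ 2 * (lam ^+ 2 * (im z ^+ 2 * ((re z + a) ^+ 2 + im z ^+ 2)))
    by ring.
by rewrite ler_wpM2l ?sqr_ge0.
Qed.

(** Pulling back divides the speed by the modulus of the derivative;
    comparison with the change of height is the Schwarz-Pick inequality of
    the hypothesis. *)
Lemma slow_pullback s M lam c : slow_curve (target s) M c ->
  (forall t, 0 <= t <= pi / 2 -> im (fa a (branch a s (c t))) ^+ 2 <=
     lam ^+ 2 * (im (branch a s (c t)) ^+ 2 * nsq (dfa (branch a s (c t))))) ->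
  slow_curve s.2 (lam * M) (branch a s \o c).
Proof.
move=> sc hl; have cc := slow_curve_cont sc; case: (sc) => hc [d hd].
have bP t := branchP ha (hc t).
split; first by move=> t; case/(TpartP ha): (bP t).1.
exists (fun t => d t / dfa (branch a s (c t))) => t.
set z := branch a s (c t).
have imz0 : im z != 0 by case/(TpartP ha): (bP t).1 => _ /halfplane_im.
have d0 : dfa z != 0.
  apply/eqP => h; have := nsq_dfa z; rewrite h {1}/nsq /= expr0n addr0 =>
    /esym/eqP.
  rewrite mulf_eq0 sqrf_eq0 gt_eqF ?(efun_gt0 ha)//= paddr_eq0 ?sqr_ge0//
    !sqrf_eq0.
  by rewrite (negbTE imz0) andbF.
have FF : Filter (0 : R)^' by exact: _.
have qc : (fun h => (h^-1)%:C * (c (h + t) - c t)) @ 0^' --> d t.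
  have [/is_derive_quot h1 /is_derive_quot h2 _] := hd t.
  by apply: cvgCP; under eq_fun do rewrite ?reM ?imM ?reD ?imD ?reN ?imN /=
    mul0r ?subr0 ?addr0.
have sh : (fun h => h + t) @ (0 : R)^' --> t.
  have : (fun h => h + t) @ (0 : R) --> t.
    by rewrite -{2}[t]add0r; apply: cvgD; [exact: cvg_id|exact: cvg_cst].
  exact: cvg_within_filter.
have gc : (fun h => branch a s (c (h + t))) @ 0^' --> z.
  exact: (cvg_comp _ _ (cvg_comp _ _ sh (cc t)) (branch_cont ha (hc t))).
have qf := fquot_cvg FF gc.
have qi := @cvgCV _ _ _ FF _ _ d0 qf.
have qq : (fun h => (h^-1)%:C * (branch a s (c (h + t)) - z)) @ 0^' -->
  d t / dfa z.
  have h1 := @cvgCM _ _ _ FF _ _ _ _ qc qi.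
  apply: cvg_trans h1; apply: near_eq_cvg.
  have n0 : \forall h \near 0^', fquot z (branch a s (c (h + t))) != 0.
    exact: (cvgr_neq0 _ qf d0).
  apply: filterS n0 => h q0.
  have e : c (h + t) - c t = fquot z (branch a s (c (h + t)))
    * (branch a s (c (h + t)) - z).
    by rewrite -fquotE /z !(bP _).2.
  by rewrite e [fquot _ _ * _]mulrC mulrA mulfK.
split.
- apply/is_derive_quot; have := cvg_re FF qq.
  by under eq_fun do rewrite reM reD reN /= mul0r subr0.
- apply/is_derive_quot; have := cvg_im FF qq.
  by under eq_fun do rewrite imM imD imN /= mul0r addr0.
move=> ht; have [_ _ /(_ ht) h3] := hd t.
have n0 : 0 < nsq (dfa z).
  by rewrite nsq_dfa mulr_gt0 ?exprn_gt0 ?(efun_gt0 ha)// ltr_wpDl ?sqr_ge0//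
    exprn_even_gt0.
have -> : nsq (d t / dfa z) = nsq (d t) / nsq (dfa z).
  by apply: (mulIf (lt0r_neq0 n0)); rewrite -nsqM !divfK// gt_eqF.
rewrite ler_pdivrMr//; apply: (le_trans h3).
have := hl t ht; rewrite (bP t).2 -/z => h4.
apply: (@le_trans _ _ (M ^+ 2 * (lam ^+ 2 * (im z ^+ 2 * nsq (dfa z))))).
  by rewrite ler_wpM2l ?sqr_ge0.
by rewrite /= -/z exprMn le_eqVlt; apply/orP; left; apply/eqP; ring.
Qed.

End Pullback.

(** * Contraction along an itinerary *)

Section Contraction.
Variables (R : realType) (a : R).
Hypothesis ha : 3 <= a.
Implicit Types (x y K b M lam : R) (z w p q : CC R) (c d : R -> CC R)
  (t : aseq).

Local Notation f := (fa a).

Definition follows t n p := forall i, (i < n)%N -> Tpart a (t i) (iter i f p).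

Lemma follows_shift t n p : follows t n.+1 p ->
  Tpart a (t 0%N) p /\ follows (ashift t) n (f p).
Proof.
move=> h; split; first exact: (h 0%N).
by move=> i hi; rewrite -iterSr; exact: h.
Qed.

Lemma SigmaA_shift t : SigmaA t -> SigmaA (ashift t).
Proof. by move=> h n; exact: h. Qed.

Definition visits y0 n p : nat := (\sum_(i < n) (y0 <= `|im (iter i f p)|)%R)%N.

Lemma visitsS y0 n p : visits y0 n.+1 p = ((y0 <=
  `|im p|)%R + visits y0 n (f p))%N.
Proof.
rewrite /visits big_ord_recl; congr (_ + _)%N.
by apply: eq_bigr => i _; rewrite -iterSr.
Qed.

Lemma Tpart_im8 s z : Tpart a s z -> `|im z| <= 8.
Proof. by move=> /(Tpart_Tclos ha)[h _ _];
  exact: le_trans h (imbound_le8 _ _). Qed.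

(** Every pullback keeps the hyperbolic speed, and one that lands on a curve
    starting at height at least [y0] multiplies it by [lam]: such a curve
    stays above height [y0 * expR (- (2 * M0))], where the contraction is
    uniform. *)
Lemma itinerary_pullback y0 M0 lam : 0 < y0 -> 0 <= M0 -> 0 <= lam < 1 ->
  (forall z, y0 * expR (- (2 * M0)) <= `|im z| <= 8 ->
    im (f z) ^+ 2 <= lam ^+ 2 * (im z ^+ 2 * nsq (dfa a z))) ->
  forall n t p q c M, SigmaA t -> follows t n p -> follows t n q ->
    0 <= M <= M0 -> slow_curve (t n).2 M c ->
    c 0 = iter n f p -> c (pi / 2) = iter n f q ->
  exists c', [/\ slow_curve (t 0%N).2 (lam ^+ visits y0 n p * M) c',
    c' 0 = p & c' (pi / 2) = q].
Proof.
move=> y00 M00 hlam H; elim=> [|n IH] t p q c M tA fp fq hM sc cp cq.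
  by exists c; rewrite /visits big_ord0 expr0 mul1r.
have [Tp fp'] := follows_shift fp; have [Tq fq'] := follows_shift fq.
rewrite !iterSr in cp cq.
have [c1 [sc1 c1p c1q]] := IH _ _ _ _ _ (SigmaA_shift tA) fp' fq' hM sc cp cq.
have tgt : (ashift t 0%N).2 = target (t 0%N) by exact: tA.
rewrite tgt in sc1.
set M1 := lam ^+ _ * M in sc1.
have /andP[lam0 lam1] := hlam; have /andP[Mp MM] := hM.
have l0 : 0 <= lam ^+ visits y0 n (f p) by exact: exprn_ge0.
have l1 : lam ^+ visits y0 n (f p) <= 1 by apply: exprn_ile1 => //; exact: ltW.
have hM1 : 0 <= M1 <= M0.
  by rewrite mulr_ge0//=; apply: le_trans MM; rewrite ler_piMl.
have M10 : 0 <= M1 by case/andP: hM1.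
have sc2 : slow_curve (t 0%N).2 (1 * M1) (branch a (t 0%N) \o c1).
  by apply: slow_pullback => // s _; rewrite expr1n mul1r; exact: im_fa_le.
rewrite mul1r in sc2.
have e0 : (branch a (t 0%N) \o c1) 0 = p by rewrite /= c1p (branch_fa ha Tp).
have e1 : (branch a (t 0%N) \o c1) (pi / 2) = q
  by rewrite /= c1q (branch_fa ha Tq).
exists (branch a (t 0%N) \o c1); split => //.
rewrite visitsS; case: (boolP (y0 <= `|im p|)) => [hp|_] /=; last
  by rewrite add0n.
rewrite exprS -mulrA; apply: slow_pullback => // s hs.
set z := branch a (t 0%N) (c1 s); apply: H; apply/andP; split.
  have [_] := slow_curve_height (t := s) M10 sc2 hs.
  rewrite e0 /= -/z => h.
  rewrite expRN ler_pdivrMr ?expR_gt0// mulrC.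
  apply: (le_trans hp); apply: (le_trans h); rewrite ler_wpM2r//.
  by rewrite ler_expR ler_pM2l//; case/andP: hM1.
by have [hT _] := branchP ha (sc1.1 s); exact: Tpart_im8 hT.
Qed.

Lemma expr_small lam (e : R) : 0 <= lam < 1 -> 0 < e -> exists N : nat,
  forall n, (N <= n)%N -> lam ^+ n < e.
Proof.
move=> hl e0.
have : lam ^+ n @[n --> \oo] --> (0 : R) by apply: cvg_expr; rewrite ger0_norm;
  lra.
by move=> /cvgr_lt /(_ _ e0) [N _ hN]; exists N.
Qed.

(** The segment between the end points has hyperbolic speed [2 * B / y0].
    After [N] visits its pullback has at most [lam ^+ N] times this speed,
    and the length of a curve is controlled by its speed. *)
Lemma itinerary_contraction (y0 B e : R) : 0 < y0 -> 0 < B -> 0 < e ->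
  exists N : nat,
  forall n t p q, SigmaA t -> follows t n p -> follows t n q -> (0 < n)%N ->
    halfplane (t n).2 (iter n f p) -> halfplane (t n).2 (iter n f q) ->
    y0 <= `|im (iter n f p)| -> y0 <= `|im (iter n f q)| ->
    `|re (iter n f p) - re (iter n f q)| <= B ->
    `|im (iter n f p) - im (iter n f q)| <= B ->
    (N <= visits y0 n p)%N ->
    `|re q - re p| < e /\ `|im q - im p| < e.
Proof.
move=> y00 B0 e0.
pose M0 := 2 * B / y0.
have M00 : 0 < M0 by rewrite !divr_gt0// mulr_gt0.
(* the least height of a curve of speed [M0] that starts at height [y0] *)
have y10 : 0 < y0 * expR (- (2 * M0)) by rewrite mulr_gt0// expR_gt0.
have [lam hlam H] := im_fa_contract a y10.
pose K := 2 * M0 * expR (2 * M0) * 8.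
have K0 : 0 < K by rewrite /K; have := expR_gt0 (2 * M0); set E := expR _; nra.
have [|N hN] := @expr_small lam (e / K) hlam; first by rewrite divr_gt0.
exists N => n t p q tA fp fq n0 hp hq yp yq hr hi hv.
have [c [sc c0 c1]] := slow_segment y00 hp hq yp yq hr hi.
have hM : 0 <= M0 <= M0 by rewrite lexx ltW.
have [c' [sc' c'0 c'1]] := itinerary_pullback y00 (ltW M00)
  hlam H tA fp fq hM sc c0 c1.
set l := lam ^+ visits y0 n p in sc'.
have /andP[lam0 lam1] := hlam.
have l0 : 0 <= l by exact: exprn_ge0.
have l1 : l <= 1 by apply: exprn_ile1 => //; exact: ltW.
have le : l < e / K by exact: hN.
have p2 : 0 <= (pi : R) / 2 by apply: divr_ge0 => //; exact: pi_ge0.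
have p20 : is_true (0 <= (pi : R) / 2 <= (pi : R) / 2) by rewrite p2 /=.
have lM : 0 <= l * M0 by rewrite mulr_ge0// ltW.
have := slow_curve_dist lM sc' p20; rewrite c'0 c'1 => -[h1 h2].
have ip : `|im p| <= 8 by apply: (@Tpart_im8 (t 0%N)); exact: (fp 0%N).
have bnd : 2 * (l * M0) * expR (2 * (l * M0)) * `|im p| <= l * K.
  have -> : l * K = 2 * (l * M0) * expR (2 * M0) * 8 by rewrite /K; ring.
  have h0 : 0 <= 2 * (l * M0) by rewrite mulr_ge0.
  apply: ler_pM => //; first by rewrite mulr_ge0 ?expR_ge0.
  by rewrite ler_wpM2l// ler_expR ler_pM2l// ler_piMl// ltW.
have lK : l * K < e by rewrite -ltr_pdivlMr.
by split; [apply: (le_lt_trans h1)|apply: (le_lt_trans h2)];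
  apply: le_lt_trans lK.
Qed.

Lemma visits_unbounded y0 p : (forall N, exists2 i, (N <= i)%N & y0 <=
  `|im (iter i f p)|) ->
  forall N, exists n0, forall n, (n0 <= n)%N -> (N <= visits y0 n p)%N.
Proof.
move=> h; elim=> [|N [n0 IH]]; first by exists 0%N.
have [i hi yi] := h n0; exists i.+1 => n hn.
have mono m k : (m <= k)%N -> (visits y0 m p <= visits y0 k p)%N.
  move=> /subnKC <-; elim: (k - m)%N => [|j IHj]; first by rewrite addn0.
  by rewrite addnS; apply: (leq_trans IHj);
    rewrite /visits big_ord_recr leq_addr.
apply: (leq_trans _ (mono _ _ hn)).
rewrite /visits big_ord_recr /= yi addn1 ltnS; exact: IH.
Qed.

End Contraction.

(** * The immediate basin *)

Section Basin.
Variables (R : realType) (a : R).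
Hypothesis ha : 3 <= a.
Implicit Types (x y K b M lam r e : R) (z w p q v : CC R) (t : aseq) (h : half).

Local Notation f := (fa a).
Local Notation center := (- a%:C : CC R).
Local Notation Astar := (immediate_basin a).

Definition cdist2 z : R := nsq (z + a%:C).
Definition cdisc r : set (CC R) := [set z | cdist2 z < r ^+ 2].

Lemma cdist2E z : cdist2 z = (re z + a) ^+ 2 + im z ^+ 2.
Proof. by rewrite /cdist2 /nsq !reimE /= addr0. Qed.

Lemma continuous_cdist2 : continuous cdist2.
Proof.
move=> z; have FF := nbhs_filter z.
have h1 : (fun z => re z + a) @ z --> re z + a.
  exact: (cvgD (@continuous_re R z) (cvg_cst _)).
have h2 := @continuous_im R z.
have -> : cdist2 = (fun z => (re z + a) * (re z + a) + im z * im z).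
  by apply/funext => w; rewrite cdist2E.
exact: (cvgD (cvgM h1 h1) (cvgM h2 h2)).
Qed.

Lemma open_cdisc r : open (cdisc r).
Proof. exact: (open_comp (fun z _ => @continuous_cdist2 z)
  (@open_lt R (r ^+ 2))). Qed.

Lemma cdist2_center : cdist2 center = 0.
Proof. by rewrite cdist2E /= oppr0 addNr !expr0n /= addr0. Qed.

Lemma cdisc_box r z : 0 < r -> cdisc r z -> `|re z + a| < r /\ `|im z| < r.
Proof.
move=> r0; rewrite /cdisc /= cdist2E => h.
have h1 := sqr_ge0 (re z + a); have h2 := sqr_ge0 (im z).
by split; rewrite -(ltr_pXn2r (n := 2))
  ?nnegrE ?(ltW r0)// real_normK ?num_real//; lra.
Qed.

(** The derivative vanishes at [- a]. *)
Lemma center_contract : exists2 r, 0 < r & forall z, cdisc r z -> cdist2 (f z)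
  <= cdist2 z / 4.
Proof.
have FF := nbhs_filter center.
have hid : (fun w : CC R => w) @ center --> center by exact: cvg_id.
have := fquot_cvg (a := a) FF hid.
have -> : dfa a center = 0.
  by rewrite /dfa addNr mulr0 mul0r.
move=> hq.
have : \forall w \near center, nsq (fquot a center w) < 1 / 4.
  apply: (hq [set w | nsq w < 1 / 4]); apply/nearC; exists (1 / 4) => [|w];
    first lra.
  rewrite /= !subr0 /nsq => h1 h2.
  rewrite -(real_normK (num_real (re w))) -(real_normK (num_real (im w))).
  have := normr_ge0 (re w); have := normr_ge0 (im w); nra.
move=> /nearC[r r0 hr]; exists r => // z hz.
have [h1 h2] := cdisc_box r0 hz.
have {hr} := hr z; rewrite /= opprK oppr0 subr0 => /(_ h1 h2) hn.
have fz : f z + a%:C = fquot a center z * (z + a%:C).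
  by have := fquotE a center z; rewrite center_fix// !opprK.
rewrite /cdist2 fz nsqM mulrC ler_wpM2l ?addr_ge0 ?sqr_ge0//.
by move: hn; lra.
Qed.

Definition trap r : Prop := 0 < r /\ forall z, cdisc r z -> cdist2 (f z)
  <= cdist2 z / 4.

Lemma trap_le r r' : trap r -> 0 < r' <= r -> trap r'.
Proof.
move=> [r0 hr] /andP[r'0 r'r]; split => // z hz; apply: hr.
by apply: (lt_le_trans hz); rewrite ler_pXn2r ?nnegrE// ltW.
Qed.

Lemma cdist2_ge0 z : 0 <= cdist2 z.
Proof. by rewrite addr_ge0 ?sqr_ge0. Qed.

Lemma trap_iter r z n : trap r -> cdisc r z -> cdisc r (iter n f z) /\
  cdist2 (iter n f z) <= (1 / 4) ^+ n * cdist2 z.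
Proof.
move=> [r0 hr] hz; elim: n => [|n [h1 h2]]; first by rewrite expr0 mul1r.
have h3 := hr _ h1; have h4 := cdist2_ge0 (iter n f z).
split; rewrite iterS.
  by rewrite /cdisc /=; apply: (le_lt_trans h3); apply: (le_lt_trans _ h1); lra.
by apply: (le_trans h3); rewrite exprS; lra.
Qed.

Lemma trap_basin r z : trap r -> cdisc r z -> basin a z.
Proof.
move=> tr hz; have r0 := tr.1.
have hb := cdisc_box r0.
suff key e : 0 < e -> \forall n \near \oo, cdisc e (iter n f z).
  have FF : Filter \oo by exact: _.
  apply: cvgCP; apply/cvgrPdist_lt => e e0; have := key e e0; apply: filterS =>
    n hn.
    by have [h _] := cdisc_box e0 hn; rewrite /= distrC opprK.
  by have [_ h] := cdisc_box e0 hn; rewrite /= oppr0 sub0r normrN.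
move=> e0.
have [||N hN] := @expr_small R (1 / 4) (e ^+ 2 / (1 + cdist2 z)); first lra.
  by rewrite divr_gt0 ?exprn_gt0//; have := cdist2_ge0 z; lra.
exists N => // n /= /hN hn; have [_ h] := trap_iter n tr hz.
have c0 := cdist2_ge0 z.
rewrite /cdisc /=; apply: (le_lt_trans h).
have : (1 / 4) ^+ n * (1 + cdist2 z) < e ^+ 2 by rewrite -ltr_pdivlMr//; lra.
have : 0 <= (1 / 4 : R) ^+ n by apply: exprn_ge0; lra.
by move=> ?; apply: le_lt_trans; rewrite ler_wpM2l//; lra.
Qed.

Lemma basin_trap r z : 0 < r -> basin a z -> exists n, cdisc r (iter n f z).
Proof.
move=> r0 hz.
have : \forall n \near \oo, cdisc r (iter n f z).
  apply: hz; apply: open_nbhs_nbhs; split; first exact: open_cdisc.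
  by rewrite /cdisc /= cdist2_center exprn_gt0.
by move=> /filter_ex[n hn]; exists n.
Qed.

Lemma basin_iter n z : basin a (iter n f z) <-> basin a z.
Proof.
rewrite /basin /mkset -(cvg_shiftn n (fun k => iter k f z) (nbhs center)).
suff -> : (fun k => iter k f (iter n f z)) = (fun k => iter (k + n) f z) by [].
by apply/funext => k; rewrite iterD.
Qed.

Lemma basin_f z : basin a (f z) <-> basin a z.
Proof. exact: (basin_iter 1). Qed.

Lemma continuous_iter n : continuous (iter n f).
Proof.
elim: n => [|n IH] z; first exact: cvg_id.
exact: (cvg_comp _ _ (IH z) (@continuous_fa R a _)).
Qed.

Lemma open_iter_disc n r : open (iter n f @^-1` cdisc r).
Proof. exact: (open_comp (fun z _ => @continuous_iter n z)
  (@open_cdisc r)). Qed.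

Lemma basin_bigcup r : trap r -> basin a = \bigcup_n (iter n f @^-1` cdisc r).
Proof.
move=> tr; apply/seteqP; split => z.
  by move=> /(basin_trap tr.1)[n hn]; exists n.
by move=> [n _ hn]; apply/(basin_iter n); exact: (trap_basin tr hn).
Qed.

Lemma open_basin : open (basin a).
Proof.
have [r r0 hr] := center_contract; rewrite (@basin_bigcup r)//.
by apply: bigcup_open => n _; exact: open_iter_disc.
Qed.

Lemma center_basin : basin a center.
Proof.
have [r r0 hr] := center_contract; apply: (@trap_basin r) => //.
by rewrite /cdisc /= cdist2_center exprn_gt0.
Qed.

Lemma component_box (O : set (CC R)) z : open O -> O z -> exists2 e, 0 < e &
  forall w, `|re w - re z| < e -> `|im w - im z| < e ->
    connected_component O z w.
Proof.
move=> oO Oz; have /nearC[e e0 he] := open_nbhs_nbhs (conj oO Oz).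
exists e => // w h1 h2; apply: component_segment => s /andP[s0 s1];
  apply: he => /=.
  by rewrite addrC addKr normrM ger0_norm//; apply: le_lt_trans h1;
    rewrite ler_piMl.
by rewrite addrC addKr normrM ger0_norm//; apply: le_lt_trans h2;
  rewrite ler_piMl.
Qed.

Lemma Astar_center : Astar center.
Proof. exact: connected_component_refl center_basin. Qed.

Lemma Astar_basin z : Astar z -> basin a z.
Proof. exact: connected_component_sub. Qed.

Lemma image_connected (n : nat) (C : set (CC R)) : connected C ->
  connected (iter n f @` C).
Proof.
move=> cC; apply: connected_continuous_connected => //.
by apply: continuous_subspaceT; exact: continuous_iter.
Qed.

Lemma Astar_f z : Astar z -> Astar (f z).
Proof.
move=> hz; apply: (@connected_component_max _ _ (f @` Astar)).
- by exists center; [exact: Astar_center|exact: center_fix].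
- by move=> _ [w hw <-]; apply/basin_f; exact: Astar_basin.
- by apply: (@image_connected 1); exact: component_connected.
- by exists z.
Qed.

Lemma Astar_iter n z : Astar z -> Astar (iter n f z).
Proof. by move=> hz; elim: n => // n IH; rewrite iterS; exact: Astar_f. Qed.

Lemma closure_Astar_iter n z : closure Astar z -> closure Astar (iter n f z).
Proof.
move=> hz B nB; have [w [Aw Bw]] := hz _ (@continuous_iter n z _ nB).
by exists (iter n f w); split => //; exact: Astar_iter.
Qed.

(** The basin is open and the plane locally connected. *)
Lemma frontier_not_basin z : frontier Astar z -> ~ basin a z.
Proof.
move=> [cz nz] bz; apply: nz.
have [e e0 he] := component_box open_basin bz.
have [w [Aw]] : Astar `&` [set w | `|re w - re z| < e /\ `|im w - im z| <
  e] !=set0.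
  by apply: cz; apply/nearC; exists e.
move=> [h1 h2]; apply/nearC; exists e => // v hv1 hv2.
apply: (connected_component_trans Aw).
apply: (@connected_component_trans _ _ z); last exact: he.
by apply: connected_component_sym; exact: he.
Qed.

Definition window : set (CC R) :=
  [set z | regS a z /\ - (2 * a + 1) < re z < -1].

Lemma open_window : open window.
Proof.
have h := openI (@open_regS R a) (openI
  (open_comp (fun z _ => @continuous_re R z) (@open_gt R (- (2 * a + 1))))
  (open_comp (fun z _ => @continuous_re R z) (@open_lt R (-1)))).
move: h; congr open; apply/seteqP; split => z [h1] => [[h2 h3]|/andP[h2 h3]];
  split => //.
by apply/andP; split.
Qed.

Lemma center_window : window center.
Proof.
have p0 := @pi_gt0 R; have a0 := ha.
by split; [left; rewrite /= oppr0 normr0|rewrite /=; lra].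
Qed.

Lemma expR1_ge24 : (24 / 10 : R) <= expR 1.
Proof.
have e : expR 1 = expR (4^-1 : R) ^+ 4.
  by rewrite -expRM_natl divff// pnatr_eq0.
rewrite e; set q := 4^-1.
have h : 5 / 4 <= expR q by have := expR_ge1Dx q; rewrite /q; lra.
have h2 : (5 / 4) ^+ 4 <= expR q ^+ 4.
  by rewrite ler_pXn2r ?nnegrE ?expR_ge0//; lra.
by apply: le_trans h2; lra.
Qed.

Lemma expR_nat_ge24 n : (24 / 10 : R) ^+ n <= expR n%:R.
Proof.
by rewrite -[n%:R]mulr1 expRM_natl; have h := expR1_ge24; apply: lerXn2r;
  rewrite ?nnegrE ?expR_ge0//; lra.
Qed.

Lemma regS_im8 z : regS a z -> `|im z| <= 8.
Proof. by have := @pi_lt4 R; have := @pi_gt0 R; move=> h1 h2 [h|[h _]];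
  lra. Qed.

Lemma sqr_im64 z : `|im z| <= 8 -> im z ^+ 2 <= 64.
Proof.
move=> h; rewrite -(real_normK (num_real (im z))).
have -> : 64 = 8 ^+ 2 :> R by lra.
by rewrite ler_pXn2r ?nnegrE.
Qed.

(** For [re z = - (2 a + 1)] the value is within 1 of the asymptotic value
    0, while the window lies to the left of -1. *)
Lemma window_left z : `|im z| <= 8 -> re z = - (2 * a + 1) -> ~ window (f z).
Proof.
move=> /sqr_im64 hy hx [_ hf]; have a0 := ha.
have : 1 < nsq (f z).
  by rewrite /nsq; have := sqr_ge0 (im (f z)); nra.
rewrite nsq_fa /efun hx.
have -> : - (2 * a + 1) + a = - (a + 1) by lra.
rewrite expRN exprMn exprVn.
set E := expR (a + 1).
(* polynomials in [a - 3] are compared coefficientwise;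
  [2 * (a + 1)] is 8 plus twice [a - 3] *)
have hE : (3 + (a - 3)) ^+ 2 * ((5 + (a - 3)) ^+ 2 + 64) <= E ^+ 2.
  set b := a - 3; have b0 : 0 <= b by rewrite /b; lra.
  have -> : E ^+ 2 = expR 8%:R * expR (b / 2) ^+ 4.
    by rewrite /E -!expRM_natl -expRD; congr expR; rewrite /b; field.
  have h1 := expR_nat_ge24 8.
  have h2 : (1 + b / 2) ^+ 4 <= expR (b / 2) ^+ 4.
    by rewrite ler_pXn2r ?nnegrE ?expR_ge0//; [exact: expR_ge1Dx|lra].
  have h3 : 1000 * (1 + b / 2) ^+ 4 <= expR 8%:R * expR (b / 2) ^+ 4.
    apply: ler_pM; [exact: ler0n|by apply: exprn_ge0; lra| |exact: h2].
    by apply: le_trans h1; lra.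
  apply: le_trans h3.
  have b2 := sqr_ge0 b; have b3 : 0 <= b ^+ 3 by exact: exprn_ge0.
  have b4 : 0 <= b ^+ 4 by exact: exprn_ge0.
  lra.
have E0 : 0 < E ^+ 2 by rewrite exprn_gt0// expR_gt0.
rewrite mulrAC ltr_pdivlMr// mul1r ltNge; apply/negP; rewrite negbK.
apply: le_trans hE.
have -> : 3 + (a - 3) = a by lra.
by rewrite ler_wpM2l ?sqr_ge0//; nra.
Qed.

(** For [re z = - 1] the modulus of the value exceeds that of every point of
    the window. *)
Lemma window_right z : re z = -1 -> ~ window (f z).
Proof.
move=> hx [/regS_im8/sqr_im64 hy hf]; have a0 := ha.
have : nsq (f z) < (2 * a + 1) ^+ 2 + 64.
  rewrite /nsq; move: hf => /andP[h1 h2].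
  have : re (f z) ^+ 2 < (2 * a + 1) ^+ 2 by nra.
  lra.
rewrite nsq_fa /efun hx.
have h4 : (24 / 10) ^+ 2 <= expR (-1 + a).
  by apply: (le_trans (expR_nat_ge24 2)); rewrite ler_expR; lra.
set E := expR _ in h4 *.
have h5 : a * (24 / 10) ^+ 2 <= a * E by rewrite ler_pM2l//; lra.
have h6 : (a * (24 / 10) ^+ 2) ^+ 2 <= (a * E) ^+ 2.
  by rewrite ler_pXn2r ?nnegrE//; [nra|apply: le_trans h5; nra].
have h7 : 1 <= (-1 + a - 1) ^+ 2 + im z ^+ 2 by have := sqr_ge0 (im z); nra.
have h8 : 0 <= (a * E) ^+ 2 by exact: sqr_ge0.
have h9 : (a * E) ^+ 2 <= (a * E) ^+ 2 * ((-1 + a - 1) ^+ 2 + im z ^+ 2).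
  by rewrite ler_peMr.
nra.
Qed.

(** The upper and lower sides of the window lie on the curves zeta, which
    are mapped to the positive axis; the vertical sides are mapped too close
    to 0 or too far away. *)
Lemma frontier_window z : frontier window z -> ~ window (f z).
Proof.
rewrite (frontier_open open_window) => -[cz nz] Vf.
have [h1 h2] : closure (regS a) z /\ - (2 * a + 1) <= re z <= -1.
  split; first by apply: closureS cz => w [].
  have : ([set w : CC R | - (2 * a + 1) <= re w] `&` [set w : CC R | re w <=
    -1]) z.
    apply: closure_sub cz.
      exact: (closedI (closed_comp (fun z _ => @continuous_re R z)
        (@closed_ge R _))
        (closed_comp (fun z _ => @continuous_re R z) (@closed_le R _))).
    by move=> w [_ /andP[? ?]]; split; exact: ltW.
  by move=> [/= -> ->].
have [Sz|nS] := pselect (regS a z); last first.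
  have : curve1 a z by rewrite -frontier_regS// (frontier_open (@open_regS R
    a)).
  rewrite -zset_curve1 => hz.
  have /real_subsetP[_] : pospre a z.
    by case: hz; apply: zset_pospre => //; [left|right].
  by rewrite /= in_itv /= andbT; case: Vf => _; lra.
have [e|e|e] := ltgtP (re z) (-1); last by exact: (window_right e) Vf.
  have [e'|e'|e'] := ltgtP (re z) (- (2 * a + 1)).
  - by move: h2; lra.
  - by apply: nz; split => //; rewrite e e'.
  - exact: (window_left (regS_im8 Sz) e') Vf.
by move: h2; lra.
Qed.

Lemma window_disc : exists2 r, trap r & cdisc r `<=` window.
Proof.
have [r r0 hr] := center_contract; have tr : trap r by split.
have /nearC[e e0 he] := open_nbhs_nbhs (conj open_window center_window).
exists (Num.min r e).
  by apply: (trap_le tr); rewrite lt_min r0 e0 ge_min lexx.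
move=> z; have m0 : 0 < Num.min r e by rewrite lt_min r0.
move=> /(cdisc_box m0); rewrite !lt_min => -[/andP[_ h1] /andP[_ h2]].
by apply: he; rewrite /= ?opprK ?oppr0 ?addr0.
Qed.

(** The immediate basin is exhausted by the components [U n] of the
    preimages of a small disc. Inductively [U n.+1], which is mapped into [U
    n], cannot cross the frontier of the window. *)
Lemma Astar_window : Astar `<=` window.
Proof.
have [r tr hr] := window_disc.
(* increasing open sets with union the basin *)
pose P n := iter n f @^-1` cdisc r.
pose U n := connected_component (P n) center.
have icen n : iter n f center = center.
  by elim: n => // n IH; rewrite iterS IH center_fix.
have cP n : P n center by rewrite /P /= icen /cdisc /= cdist2_center exprn_gt0
  ?tr.1.
have oP n : open (P n) by exact: open_iter_disc.
have PS n m : (n <= m)%N -> P n `<=` P m.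
  move=> /subnK <- z hz; rewrite /P /= iterD.
  by have [] := trap_iter (m - n) tr hz.
have UV n : U n `<=` window.
  elim: n => [|n IH]; first by move=> z /connected_component_sub; exact: hr.
  apply: (@connected_frontier_sub _ _ _ center).
  - exact: component_connected.
  - exact: connected_component_refl.
  - exact: center_window.
  - move=> w Uw /frontier_window; apply; apply: IH.
    apply: (@connected_component_max _ _ (f @` U n.+1)).
    + by exists center; [exact: connected_component_refl|exact: center_fix].
    + by move=> _ [v /connected_component_sub hv <-]; move: hv;
        rewrite /P /= -iterSr.
    + by apply: (@image_connected 1); exact: component_connected.
    + by exists w.
suff AU : Astar `<=` \bigcup_n U n by move=> z /AU[n _ /UV].
have AE : Astar `&` (\bigcup_n U n) = Astar.
  apply: component_connected.
  - by exists center; split; [exact: Astar_center|exists 0%N => //;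
      exact: connected_component_refl].
  - exists (\bigcup_n U n) => //; apply: bigcup_open => n _.
    rewrite openE => z Uz; have Pz := connected_component_sub Uz.
    have [e e0 he] := component_box (oP n) Pz.
    apply/nearC; exists e => // w h1 h2.
    exact: (connected_component_trans Uz (he _ h1 h2)).
  - exists (closure (\bigcup_n U n)); first exact: closed_closure.
    apply/seteqP; split => z [Az h]; split => //; first exact: subset_closure.
    have : basin a z by exact: Astar_basin.
    rewrite (basin_bigcup tr) => -[n _ Pz].
    have [e e0 he] := component_box (oP n) Pz.
    have [w [[m _ Um] [h1 h2]]] : (\bigcup_n U n) `&` [set w | `|re w - re z| <
      e /\ `|im w - im z| < e] !=set0.
      by apply: h; apply/nearC; exists e.
    have cS k l (q v : CC R) : (k <= l)%N -> connected_component (P k) q v ->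
      connected_component (P l) q v.
      move=> kl hxy; have Pq : P k q.
        by apply: contrapT => nx; move: hxy; rewrite connected_component_out.
      apply: (@connected_component_max _ _ (connected_component (P k) q)) => //.
      + exact: connected_component_refl.
      + by apply: subset_trans (PS _ _ kl); exact: connected_component_sub.
      + exact: component_connected.
    exists (maxn m n) => //.
    apply: (@connected_component_trans _ _ w);
      first exact: (cS m _ _ _ (leq_maxl _ _)).
    apply: connected_component_sym; apply: (cS n _ _ _ (leq_maxr _ _));
      exact: he.
by rewrite -AE => z [].
Qed.

Lemma closure_Astar_re z : closure Astar z -> - (2 * a + 1) <= re z <= -1.
Proof.
move=> cz.
have : ([set w : CC R | - (2 * a + 1) <= re w] `&` [set w : CC R | re w <= -1])
  z.
  apply: closure_sub cz.
    exact: (closedI (closed_comp (fun z _ => @continuous_re R z)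
      (@closed_ge R _))
      (closed_comp (fun z _ => @continuous_re R z) (@closed_le R _))).
  by move=> w /Astar_window[_ /andP[? ?]]; split; exact: ltW.
by move=> [/= -> ->].
Qed.

(** The connection with [- a] that passes to preimages: unlike one that
    certifies mere membership of the immediate basin, the joining set lies
    in the domain of the extended inverse branch, which maps it to a set of
    the same kind. *)
Definition radial h w := exists C : set (CC R), [/\ connected C, C `<=` basin a,
  C w, C center & C `<=` [set v | halfplane h v \/ v = center]].

Lemma radial_Astar h w : radial h w -> Astar w.
Proof.
by move=> [C [cC CB Cw Cc _]]; exact: (@connected_component_max _ _ C).
Qed.

Lemma radial_branch s w : halfplane (target s) w -> radial (target s) w ->
  radial s.2 (branch a s w).
Proof.
move=> hw [C [cC CB Cw Cc CH]]; exists (branch_ext a s @` C); split.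
- by apply: connected_continuous_connected => //; exact: branch_ext_within.
- move=> _ [v Cv <-]; apply/basin_f.
  by have [_ ->] := branch_extP ha (CH _ Cv : branch_dom a s v); exact: CB.
- by exists w => //; rewrite branch_ext_half.
- by exists center => //; rewrite /branch_ext eqxx.
- move=> _ [v Cv <-]; case: (CH _ Cv) => [hv|->]; [left|right]; last
    by rewrite /branch_ext eqxx.
  by rewrite branch_ext_half//; have [/(TpartP ha)[]] := branchP ha hv.
Qed.

Lemma radial_base r h : trap r -> exists p, [/\ halfplane h p, radial h p &
  cdist2 p = (r / 2) ^+ 2].
Proof.
move=> tr; have r0 := tr.1.
have ss : sg R h * sg R h = 1 by case: h => /=; lra.
pose g s := mkC (- a) (sg R h * s).
have cd s : cdist2 (g s) = s ^+ 2.
  by rewrite cdist2E /= addNr expr0n add0r exprMn expr2 ss mul1r.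
have hg s : 0 < s -> halfplane h (g s) by rewrite halfplaneE /= mulrA ss mul1r.
have g0 : g 0 = center by apply: eq_reim; rewrite /= ?mulr0 ?oppr0.
exists (g (r / 2)); split; [apply: hg; lra| |by rewrite cd].
exists (g @` `[0, r / 2]); split.
- apply: connected_im_itv => s _; apply: (cvg_mkC (nbhs_filter s));
    first exact: cvg_cst.
  by apply: cvgMr; exact: cvg_id.
- move=> _ [s + <-]; rewrite /= in_itv /= => hs; apply: (trap_basin tr).
  by rewrite /cdisc /= cd ltr_pXn2r ?nnegrE//; lra.
- by exists (r / 2) => //=; rewrite in_itv /=; lra.
- by exists 0 => //=; rewrite in_itv /=; lra.
- move=> _ [s + <-]; rewrite /= in_itv /= => /andP[]; rewrite le_eqVlt.
  by move=> /predU1P[<- _|/hg ? _]; [right|left].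
Qed.

(** The asymptotic value 0 is interior to [T0], which bounds the real part
    of [z] from below since [f z] is in [T1]. On the resulting compact set
    the height cannot vanish: a real point of the closure of [T1] other than
    [- a] is mapped to the right of [- a], outside the closure of [T1]. *)
Lemma double_visit C r : 0 < r -> exists L y0, [/\ 0 < L, 0 < y0 & forall z,
  reg1 a z -> reg1 a (f z) -> re z <= C -> r ^+ 2 <= cdist2 z ->
  - L <= re z /\ y0 <= `|im z|].
Proof.
move=> r0; have a0 := ha; have p4 := @pi_lt4 R.
have Q0 : Qfun a 0 = a by rewrite /Qfun /= qfun0 add0r.
have /nearC[e e0 he] : \forall w \near (0 : CC R), 0 < Qfun a w.
  apply: open_nbhs_nbhs; split; first exact: open_Q_gt.
  by rewrite /= Q0; lra.
have [|L L0 hL] := @fa_left_small R a ha (e ^+ 2); first by rewrite exprn_gt0.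
have lo z : `|im z| <= 8 -> Qfun a (f z) <= 0 -> - L <= re z.
  move=> h1 h2; rewrite leNgt; apply/negP => /ltW /(hL _ h1) h3.
  suff : 0 < Qfun a (f z) by lra.
  have h4 := sqr_ge0 (re (f z)); have h5 := sqr_ge0 (im (f z)).
  by apply: he; rewrite /= subr0 -(ltr_pXn2r (n := 2)) ?nnegrE ?(ltW e0)//
    real_normK ?num_real//; move: h3; rewrite /nsq; lra.
(* a compact set disjoint from the real axis *)
pose K := [set z : CC R | - L <= re z <= C /\ - 8 <= im z <= 8] `&`
  ([set z | Qfun a z <= 0] `&` ([set z | Qfun a (f z)
    <= 0] `&` [set z | r ^+ 2 <= cdist2 z])).
have cK : compact K.
  apply: compact_closedI; first exact: compact_box.
  apply: closedI; first exact: closed_Q_le.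
  apply: closedI.
    exact: (closed_comp (fun z _ => @continuous_fa R a z) (@closed_Q_le R a 0)).
  exact: (closed_comp (fun z _ => @continuous_cdist2 z)
    (@closed_ge R (r ^+ 2))).
have inK z : reg1 a z -> reg1 a (f z) -> re z <= C -> r ^+ 2 <= cdist2 z -> K z.
  move=> [h1 h2] [h3 h4] h5 h6.
  have h8 : `|im z| <= 8 by lra.
  split; last by split; [exact: ltW|split; [exact: ltW|]].
  split; last by rewrite -ler_norml.
  by rewrite h5 andbT; apply: lo => //; exact: ltW.
exists L.
have [K0|nK] := pselect (K !=set0); last first.
  exists 1; split => // z h1 h2 h3 h4; exfalso; apply: nK; exists z; exact: inK.
have [|c] := compact_EVT_min K0 cK (f := fun z => `|im z|).
  by apply: continuous_subspaceT; exact: continuous_absim.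
rewrite inE => Kc hc.
exists `|im c|; split => //; last first.
  move=> z h1 h2 h3 h4; have Kz := inK z h1 h2 h3 h4.
  by split; [case: Kz => -[/andP[]]|apply: hc; rewrite inE].
rewrite normr_gt0; apply/eqP => ic.
case: Kc => _ [/= q1 [q2 q3]].
have [h1 h2] := re_fa_real ha ic.
have ifc : im (f c) = 0 by rewrite im_faQ ic mul0r mulr0.
move: q2; rewrite /Qfun ifc qfun0 => q2.
have e1 : - a == re (f c) by rewrite eq_le h1; lra.
move: q3; rewrite e1 in h2; move/esym/eqP: h2 => ->.
by rewrite cdist2_center leNgt exprn_gt0.
Qed.

End Basin.

Definition double_one (t : aseq) (n : nat) : Prop := (t n).1 /\ (t n.+1).1.

(** The block of index [N] starts at a position at least [N]. *)
Lemma block_seq_double tau k N :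
  exists2 n, (N <= n)%N & block_seq tau k n /\ block_seq tau k n.+1.
Proof.
pose pre j := tau ++ flatten (mkseq (block \o k) j).
have sz j : (j <= size (pre j))%N.
  elim: j => // j IH.
  rewrite /pre /mkseq -addn1 iotaD map_cat flatten_cat catA size_cat -/(mkseq _
    _) -/(pre j).
  rewrite /= cats0 size_cat /= addnS addn0 -size_cat addnS ltnS;
    apply: (leq_trans IH); exact: leq_addr.
have val j m i : (j < m)%N -> (i < 2)%N ->
    nth false (tau ++ flatten (mkseq (block \o k) m)) (size (pre j) + i).
  move=> jm i2; rewrite /mkseq -(subnKC (ltnW jm))
    iotaD map_cat flatten_cat catA.
  rewrite -/(mkseq _ _) -/(pre j) nth_cat ltnNge leq_addr /= addKn add0n.
  have : (0 < m - j)%N by rewrite subn_gt0.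
  by case: (m - j)%N => //= d _; case: i i2 => [|[|]].
exists (size (pre N)); first exact: sz.
rewrite /block_seq; split.
  by have := @val N (size (pre N)).+1 0%N; rewrite addn0; apply;
    rewrite // ltnS.
by have := @val N (size (pre N)).+2 1%N; rewrite addn1; apply;
  rewrite // ltnS ltnW// ltnS.
Qed.

(** * Hairs and boundary points with a given itinerary *)

Section Hair.
Variables (R : realType) (a : R).
Hypothesis ha : 3 <= a.
Implicit Types (x y C r e rho : R) (z w p q : CC R) (t : aseq) (h : half).

Local Notation f := (fa a).
Local Notation center := (- a%:C : CC R).
Local Notation Astar := (immediate_basin a).

Lemma itinerary_shift t z : has_itinerary a t z <->
  Tpart a (t 0%N) z /\ has_itinerary a (ashift t) (f z).
Proof.
split=> [h|[h0 h] [|n]].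
- by split; [exact: (h 0%N)|move=> n; rewrite -iterSr; exact: (h n.+1)].
- exact: h0.
- by rewrite iterSr; exact: h.
Qed.

(** Pullbacks invert the iterates along the itinerary, so the point of the
    tail from which a point of the hair comes is its image under the
    iterate. *)
Lemma hair_stageP rho n t z : SigmaA t -> hair_stage a rho t n z <->
  has_itinerary a t z /\ forall m, (n <= m)%N -> Hset a rho (iter m f z).
Proof.
elim: n t z => [|n IH] t z tA.
  split.
    by move=> [w [h1 h2] <-]; split => // m _; exact: h2.
  by move=> [h1 h2]; exists z => //; split => // m; exact: h2.
have tgt : (t 1%N).2 = target (t 0%N) by exact: tA.
split.
  move=> [w hw <-] /=.
  set v := pullback a (ashift t) n w.
  have : hair_stage a rho (ashift t) n v by exists w => //; rewrite -iterSr.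
  move=> /(IH _ _ (SigmaA_shift tA))[iv hv].
  have hv0 : halfplane (target (t 0%N)) v by rewrite -tgt; case: (iv 0%N).
  have [Tb fb] := branchP ha hv0.
  split; first by apply/itinerary_shift; rewrite fb.
  by move=> [//|m] nm; rewrite iterSr fb; exact: hv.
move=> [/itinerary_shift[Tz iz] hz].
have /(IH _ _ (SigmaA_shift tA))[w hw ew] : has_itinerary a (ashift t) (f z) /\
    forall m, (n <= m)%N -> Hset a rho (iter m f (f z)).
  by split => // m nm; rewrite -iterSr; exact: hz.
by exists w; [rewrite iterSr|rewrite /= ew (branch_fa ha Tz)].
Qed.

Lemma hair_not_basin rho t z : SigmaA t -> -1 < rho -> hair a rho t z ->
  ~ basin a z.
Proof.
move=> tA hrho [n _ /(hair_stageP _ _ _ tA)[_ h]] /basin_trap.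
have [r tr hr] := window_disc ha; move=> /(_ _ tr.1)[m hm].
have [h1 _] := trap_iter n tr hm; rewrite -iterD in h1.
have [_ h2] := h _ (leq_addr m n); have [_ /andP[_ h3]] := hr _ h1.
lra.
Qed.

(** Suppose that the [n]-th image of the hair lay entirely to the right of
    [C]. Its image would have real parts of modulus larger than [C], and,
    being connected with a point to the right of [rho], would again lie to
    the right of [C]. So all later images would, and the hair would equal
    its stage [n]; but a ray is not exhausted by an initial piece. *)
Lemma hair_stays_left rho t phi n C : SigmaA t -> 0 <= rho ->
  hair_param a rho t phi ->
  rho <= C -> exists2 z, hair a rho t z & re (iter n f z) <= C.
Proof.
move=> tA rho0 [cphi iphi ephi _ sphi] hC; apply: contrapT => nex.
have C0 : 0 <= C by lra.
have big z : hair a rho t z -> C < re (iter n f z).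
  by move=> hz; rewrite ltNge; apply/negP => h; apply: nex; exists z.
have ch : connected (hair a rho t).
  rewrite -ephi; apply: connected_continuous_connected => //.
  by apply/connected_intervalP; exact: interval_is_interval.
have itin z : hair a rho t z -> has_itinerary a t z.
  by move=> [m _ /(hair_stageP _ _ _ tA)[]].
have [z0 hz0 low0] : exists2 z0, hair a rho t z0 & forall m, rho <=
  re (iter m f z0).
  have [al al0 eal] := sphi 0%N.
  have : hair_stage a rho t 0 (phi al).
    by rewrite -eal; exists al => //; rewrite /= in_itv /= al0 lexx.
  move=> hs; exists (phi al); first by exists 0%N.
  by move/(hair_stageP _ _ _ tA): hs => [_ h] m; case: (h m).
have bigm m z : hair a rho t z -> C < re (iter (m + n) f z).
  elim: m z => [|m IH] z hz; first exact: big.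
  have grow w : hair a rho t w -> C < `|re (iter (m.+1 + n) f w)|.
    move=> hw; rewrite addSn iterS; apply: fa_right_grow => //;
      first exact: ltW (IH _ hw).
    by rewrite -iterS; exact: (Tpart_im8 ha (itin _ hw _)).
  have := grow _ hz; have [p|p] := leP 0 (re (iter (m.+1 + n) f z)); first
    by rewrite ger0_norm.
  have cg : continuous (fun z => re (iter (m.+1 + n) f z)).
    by move=> w; exact: (cvg_comp _ _ (@continuous_iter R a _ w)
      (@continuous_re R _)).
  have [|v hv v0] := connected_IVT (c := 0) ch cg hz hz0.
    by rewrite (ltW p) (le_trans rho0 (low0 _)).
  by have := grow _ hv; rewrite v0 normr0; lra.
have [al al0 eal] := sphi n.
have hin : (al + 1) \in `]0, +oo[ by rewrite in_itv /= andbT; lra.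
have : hair a rho t (phi (al + 1)) by rewrite -ephi; exists (al + 1).
move=> hz; have : hair_stage a rho t n (phi (al + 1)).
  apply/(hair_stageP _ _ _ tA); split; first exact: itin.
  move=> m nm; split.
    have [+ _] := itin _ hz m; case: (t m).1 => ?; by [left|right].
  by apply: (le_trans hC); apply: ltW; rewrite -(subnK nm); exact: bigm.
rewrite -eal => -[s]; rewrite /= in_itv /= => /andP[s0 sal] es.
have : s = al + 1 by apply: iphi => //; rewrite in_itv /= s0.
lra.
Qed.

Section SameItinerary.
Variable t : aseq.
Hypothesis tA : SigmaA t.
Hypothesis tD : forall N, exists2 n, (N <= n)%N & double_one t n.

Lemma double_regs n z : double_one t n -> has_itinerary a t z ->
  reg1 a (iter n f z) /\ reg1 a (f (iter n f z)).
Proof.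
move=> [d1 d2] hz; rewrite -iterS; split.
  by have [] := hz n; rewrite /= d1 T1E.
by have [] := hz n.+1; rewrite /= d2 T1E.
Qed.

Lemma not_basin_far r n z : trap a r -> ~ basin a z -> r ^+ 2 <=
  cdist2 a (iter n f z).
Proof.
move=> tr nb; rewrite leNgt; apply/negP => h; apply: nb.
by apply/(basin_iter a n); exact: (trap_basin tr h).
Qed.

(** At a time when the symbol 1 is read twice, orbits that are not too far
    to the right are in the compact set of [double_visit]. The orbit of [p]
    is there infinitely often, which yields arbitrarily strong contraction. *)
Lemma itinerary_close C e p : 0 < e -> has_itinerary a t p -> ~ basin a p ->
  (forall n, re (iter n f p) <= C) ->
  exists n0, forall n q, (n0 <= n)%N -> double_one t n ->
  has_itinerary a t q -> ~ basin a q -> re (iter n f q) <= C ->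
  `|re q - re p| < e /\ `|im q - im p| < e.
Proof.
move=> e0 ip np lp.
have [r tr _] := window_disc ha.
have [L [y0 [L0 y00 dv]]] := double_visit ha C tr.1.
have B0 : 0 < `|C| + L + 16 by have := normr_ge0 C; lra.
have [N hN] := itinerary_contraction ha y00 B0 e0.
have vis q n : double_one t n -> has_itinerary a t q -> ~ basin a q ->
    re (iter n f q) <= C -> - L <= re (iter n f q) /\ y0 <= `|im (iter n f q)|.
  move=> dn iq nq lq; have [h1 h2] := double_regs dn iq.
  by apply: dv => //; exact: not_basin_far.
have [|n0 hn0] := @visits_unbounded R a y0 p _ N.
  move=> M; have [n Mn dn] := tD M; exists n => //.
  by have [] := vis p n dn ip np (lp n).
exists (maxn n0 1%N) => n q; rewrite geq_max => /andP[n0n n1] dn iq nq lq.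
have [p1 p2] := vis p n dn ip np (lp n); have [q1 q2] := vis q n dn iq nq lq.
have Cn := ler_norm C.
have ip8 := Tpart_im8 ha (ip n); have iq8 := Tpart_im8 ha (iq n).
have lpn := lp n.
apply: (hN n t p q) => //.
- by case: (ip n).
- by case: (iq n).
- by rewrite ler_norml; apply/andP; split; lra.
- move: ip8 iq8; rewrite !ler_norml => /andP[? ?] /andP[? ?].
  by have := normr_ge0 C; lra.
- exact: hn0.
Qed.

Lemma frontier_iter_re p n : frontier Astar p -> re (iter n f p) <= -1.
Proof.
by move=> [cp _]; have /andP[] := closure_Astar_re ha (closure_Astar_iter (n :=
  n) cp).
Qed.

Lemma frontier_itinerary_uniq p q : frontier Astar p -> frontier Astar q ->
  has_itinerary a t p -> has_itinerary a t q -> p = q.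
Proof.
move=> fp fq ip iq.
have np := frontier_not_basin fp; have nq := frontier_not_basin fq.
have close e : 0 < e -> `|re q - re p| < e /\ `|im q - im p| < e.
  move=> e0; have [n0 hn0] := itinerary_close e0 ip np (fun n =>
    frontier_iter_re n fp).
  by have [n n0n dn] := tD n0; apply: (hn0 n) => //; exact: frontier_iter_re.
apply: eq_reim; apply/esym/eqP; rewrite -subr_eq0 -normr_le0;
  apply/ler_addgt0Pr => e e0;
  by rewrite add0r ltW//; have [] := close e e0.
Qed.

End SameItinerary.

(** Starting from a point of the small disc, take preimages along the
    itinerary. *)
Lemma radial_preimage_exists r n t : trap a r -> SigmaA t -> exists z,
  [/\ follows a t n z, halfplane (t 0%N).2 z, radial a (t 0%N).2 z &
    cdist2 a (iter n f z) = (r / 2) ^+ 2].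
Proof.
move=> tr; elim: n t => [|n IH] t tA.
  by have [z [h1 h2 h3]] := radial_base (t 0%N).2 tr; exists z; split.
have [w [h1 h2 h3 h4]] := IH _ (SigmaA_shift tA).
have tgt : (ashift t 0%N).2 = target (t 0%N) by exact: tA.
rewrite tgt in h2 h3.
have [Tb fb] := branchP ha h2.
exists (branch a (t 0%N) w); split.
- by move=> [_|i hi]; [exact: Tb|rewrite iterSr fb; exact: h1].
- by case: Tb.
- exact: radial_branch.
- by rewrite iterSr fb.
Qed.

(** A limit of radial points that follow the itinerary longer and longer. Up
    to that time their orbits avoid a disc around [- a], hence are high
    above the real axis whenever 1 is read twice; this survives in the
    limit, keeps the limit out of the basin, and keeps its orbit off the
    boundary of the partition. *)
Lemma frontier_itinerary_exists t : SigmaA t ->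
  (forall N, exists2 n, (N <= n)%N & double_one t n) ->
  exists p, frontier Astar p /\ has_itinerary a t p.
Proof.
move=> tA tD.
have [r tr _] := window_disc ha; have r0 := tr.1.
(* the preimages are those of points at distance exactly [r / 2],
  so their orbits stay outside this smaller disc *)
have tr2 : trap a (r / 2) by apply: trap_le tr _; lra.
have r20 : 0 < r / 2 by lra.
have [L [y0 [L0 y00 dv]]] := double_visit ha (-1) r20.
have /choice[z hz] : forall n, exists z, [/\ follows a t n z, Astar z &
    cdist2 a (iter n f z) = (r / 2) ^+ 2].
  move=> n; have [z [h1 _ h3 h4]] := radial_preimage_exists n tr tA.
  by exists z; split => //; exact: radial_Astar h3.
have zA n : Astar (z n) by case: (hz n).
have [p [_ cp]] := @compact_box R (- (2 * a + 1)) (-1) (-8) 8 (z @ \oo) _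
  (ltac:(exists 0%N => // n _; have [Sz /andP[? ?]] := Astar_window ha (zA n);
    split; [apply/andP; split; exact: ltW|rewrite -ler_norml;
      exact: regS_im8 Sz])).
have clus (F : set (CC R)) : closed F -> (\forall n \near \oo, F (z n)) -> F p.
  by move=> cF hF; move: cp; rewrite clusterE => /(_ F hF);
    move/closure_id: cF => <-.
have cAp : closure Astar p.
  by apply: clus; [exact: closed_closure|near=> n; apply: subset_closure;
    exact: zA].
have Tcl i : Tclos a (t i) (iter i f p).
  apply: (clus (iter i f @^-1` Tclos a (t i))).
    exact: (closed_comp (fun z _ => @continuous_iter R a i z)
      (@closed_Tclos R a (t i))).
  near=> n; apply: (Tpart_Tclos ha); have [h _ _] := hz n; apply: h.
  by near: n; exact: nbhs_infty_gt.
have high i : double_one t i -> y0 <= `|im (iter i f p)|.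
  move=> [d1 d2]; apply: (clus (iter i f @^-1` [set w | y0 <= `|im w|])).
    apply: (closed_comp (fun z _ => @continuous_iter R a i z)).
    exact: (closed_comp (fun z _ => @continuous_absim R z) (@closed_ge R y0)).
  near=> n; have ni : (i.+1 < n)%N by near: n; exact: nbhs_infty_gt.
  have [h1 h2 h3] := hz n.
  have [T1i _] := h1 _ (ltnW ni); have [T1i' _] := h1 _ ni.
  rewrite d1 T1E// in T1i; rewrite d2 T1E// iterS in T1i'.
  have lo : re (iter i f (z n)) <= -1.
    by have [_ /andP[_ /ltW]] := Astar_window ha (Astar_iter i h2).
  have far : (r / 2) ^+ 2 <= cdist2 a (iter i f (z n)).
    rewrite leNgt; apply/negP => hd.
    have [hd' _] := trap_iter (n - i) tr2 hd.
    by move: hd'; rewrite /cdisc /= -iterD subnK ?h3 ?ltxx// ltnW// ltnW.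
  by have [] := dv _ T1i T1i' lo far.
have im0 i : im (iter i f p) != 0.
  apply/eqP => h0; have [j ij dj] := tD i.
  suff hj : im (iter j f p) = 0 by have := high j dj; rewrite hj normr0; lra.
  rewrite -(subnK ij); elim: (j - i)%N => [|m IH] //.
  by rewrite addSn iterS im_faQ IH mul0r mulr0.
have ip : has_itinerary a t p.
  by move=> i; apply: (Tclos_Tpart ha (Tcl i)); rewrite -iterS.
exists p; split => //; split => // /interior_subset /(Astar_basin (a := a)) bp.
have : \forall n \near \oo, `|im (iter n f p)| < y0.
  have FF : Filter \oo by exact: _.
  have h : (fun n => im (iter n f p)) @ \oo --> im center := cvg_im FF bp.
  move/cvgrPdist_lt: h => /(_ _ y00).
  by apply: filterS => n; rewrite /= oppr0 sub0r normrN.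
move=> [N _ hN]; have [n Nn dn] := tD N.
by have := hN n Nn; have := high n dn => /=; lra.
Unshelve. all: by end_near. Qed.

(** At a late time when 1 is read twice, some point of the hair has its
    image not far to the right, by [hair_stays_left]; it started close to
    [p]. *)
Lemma frontier_itinerary_hair rho t phi p : SigmaA t ->
  (forall N, exists2 n, (N <= n)%N & double_one t n) -> 0 <= rho ->
  hair_param a rho t phi -> frontier Astar p -> has_itinerary a t p ->
  closure (hair a rho t) p.
Proof.
move=> tA tD rho0 hphi fp ip B /nearC[e e0 hB].
have np := frontier_not_basin fp.
have lp n : re (iter n f p) <= rho by have := frontier_iter_re n fp; lra.
have [n0 hn0] := itinerary_close tA tD e0 ip np lp.
have [n n0n dn] := tD n0.
have [q hq lq] := hair_stays_left n tA rho0 hphi (lexx rho).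
have rho1 : -1 < rho by lra.
have nq := hair_not_basin tA rho1 hq.
have iq : has_itinerary a t q by case: hq => m _ /(hair_stageP _ _ _ tA)[].
have [h1 h2] := hn0 n q n0n dn iq nq lq.
by exists q; split => //; exact: hB.
Qed.

End Hair.

Theorem theorem4p4 (R : realType) (a : R) (ha : 3 <= a) :
  \forall rho \near +oo,
  forall (tau : seq bool) (k : nat -> nat) (t1 t2 : aseq),
    {homo k : i j / (i < j)%N} ->
    SigmaA t1 -> SigmaA t2 -> t1 <> t2 ->
    aproj t1 = block_seq tau k -> aproj t2 = block_seq tau k ->
    hair a rho t1 <> hair a rho t2 ->
    hair_limits_on_itself a rho t1 -> hair_limits_on_itself a rho t2 ->
    exists! p1 : CC R,
      [/\ frontier (immediate_basin a) p1,
          closure (hair a rho t1) p1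
        & has_itinerary a t1 p1].
Proof.
exists 0; split => // rho /ltW rho0 tau k t1 t2 _ tA _ _ t1E _ _ [phi hphi _] _.
have tD N : exists2 n, (N <= n)%N & double_one t1 n.
  have [n Nn [h1 h2]] := block_seq_double tau k N; exists n => //.
  by move: h1 h2; rewrite -t1E.
have [p [fp ip]] := frontier_itinerary_exists ha tA tD.
exists p; split.
  by split => //; exact: (frontier_itinerary_hair ha tA tD rho0 hphi).
by move=> q [fq _ iq]; exact: (frontier_itinerary_uniq ha tA tD).
Qed.
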